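(* Let $a,b>0$ and $c$ be real numbers with $4a^2<b^2\le4ac$, and let $Q$ be the quadratic external field $Q(x)=a x_3^2+b x_3+c$, $x=(x_1,x_2,x_3)\in\mathbb S^2$. Let $\alpha_0\in(0,\pi)$ be a unique solution in $(0,\pi)$ of the transcendental equation $$8a\cos^3\alpha\,\bigl(2\sin\alpha+3(\pi-\alpha)\bigr)+\cos^2\alpha\,\bigl((2a+9b)\sin\alpha-6(2a-3b)(\pi-\alpha)\bigr)+\tfrac12\sin(2\alpha)(9b-22a)+3(2a-3b)(\pi-\alpha)+9\pi$$ $$=9\cos\alpha\,\bigl(\pi+(2a+b)(\pi-\alpha)\bigr)-2\sin\alpha\,(2a-9b).$$ Set $$\begin{aligned}F(\varphi)=\frac{1}{36\pi^2}\bigg\{&\sqrt{1-\cos\alpha_0}\,\sqrt{\cos\alpha_0-\cos\varphi}\,\bigl(20a\cos\alpha_0+60a\cos\varphi+10a+27b\bigr)\\&-\sqrt{\frac{1-\cos\alpha_0}{\cos\alpha_0-\cos\varphi}}\,\bigl(8a\cos^2\alpha_0+10a\cos\alpha_0\cos\varphi+(4a+9b)\cos\alpha_0\\&\qquad+(20a+27b)\cos\varphi+15a\cos(2\varphi)+9a+18b+18c\bigr)\\&-6\tan^{-1}\sqrt{\frac{\cos\alpha_0-\cos\varphi}{1-\cos\alpha_0}}\,\bigl(15a\cos^2\varphi+9b\cos\varphi-4a+3c\bigr)\bigg\},\end{aligned}$$ $$\begin{aligned}F_Q=\frac{1}{36(\pi-\alpha_0+\sin\alpha_0)}\bigg\{&\tan\!\left(\frac{\alpha_0}{2}\right)\Big[32a\cos^3\alpha_0+4(2a+9b)\cos^2\alpha_0+4(9c-5a)\cos\alpha_0+4a-36b+36c\Big]\\&+12(a+3c)(\pi-\alpha_0)+36\pi\bigg\}.\end{aligned}$$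 Then the density $f$ of the equilibrium measure $\mu_Q$ (that is, $d\mu_Q=f(\varphi)\sin\varphi\,d\theta\,d\varphi$, with $\operatorname{supp}\mu_Q=C_{S,\alpha_0}$) is given by $$f(\varphi)=\frac{F_Q}{4\pi}\left\{1+\frac{2}{\pi}\left[\sqrt{\frac{1-\cos\alpha_0}{\cos\alpha_0-\cos\varphi}}-\tan^{-1}\sqrt{\frac{1-\cos\alpha_0}{\cos\alpha_0-\cos\varphi}}\,\right]\right\}+F(\varphi),\qquad\alpha_0\le\varphi\le\pi.$$
   Context: $\mathbb S^2=\{x\in\mathbb R^3:|x|=1\}$, with $|\cdot|$ the Euclidean norm. Spherical coordinates are $(r,\theta,\varphi)$ with $0\le\varphi\le\pi$ the polar angle measured from the positive $x_3$-axis and $0\le\theta\le2\pi$ the azimuthal angle. For $0<\alpha\le\pi$, $C_{S,\alpha}=\{(r,\theta,\varphi): r=1,\ \alpha\le\varphi\le\pi,\ 0\le\theta\le2\pi\}$. For a unit positive Borel measure $\mu$ on $\mathbb S^2$ put $I(\mu)=\iint\frac{1}{|x-y|}\,d\mu(x)\,d\mu(y)$ and $I_Q(\mu)=I(\mu)+2\int Q\,d\mu$. Let $V_Q$ be the infimum of $I_Q(\mu)$ over all unit positive Borel measures $\mu$ on $\mathbb S^2$. The extremal (equilibrium) measure $\mu_Q$ is the unit positive Borel measure on $\mathbb S^2$ with $I_Q(\mu_Q)=V_Q$. *)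

(* Defs.v *)
From HB Require Import structures.
From mathcomp Require Import all_boot all_order all_algebra.
From mathcomp Require Import all_classical all_reals all_analysis.

Set Implicit Arguments.
Unset Strict Implicit.
Unset Printing Implicit Defensive.

Import Order.TTheory GRing.Theory Num.Theory.
Import numFieldNormedType.Exports.

Local Open Scope classical_set_scope.
Local Open Scope ring_scope.

(* Euclidean 3-space is R * R * R, with x = (x1, x2, x3) given by x.1.1, x.1.2,
   x.2; the product sigma-algebra is its Borel sigma-algebra. *)

Section Sphere.
Context {R : realType}.

(* The library norm on a product is the sup norm. *)
Definition enorm (x : R * R * R) : R :=
  Num.sqrt (x.1.1 ^+ 2 + x.1.2 ^+ 2 + x.2 ^+ 2).

Definition sphere : set (R * R * R) := [set x | enorm x = 1].

(* Azimuth theta, polar angle phi (from the positive x3-axis), radius 1. *)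
Definition sph_point (theta phi : R) : R * R * R :=
  (sin phi * cos theta, sin phi * sin theta, cos phi).

(* The cap of points of the sphere with polar angle in [alpha, pi]. *)
Definition cap (alpha : R) : set (R * R * R) :=
  [set x | exists theta phi : R,
    [/\ 0 <= theta <= 2 * pi, alpha <= phi <= pi & x = sph_point theta phi]].

End Sphere.

Section Energy.
Context {R : realType}.
Implicit Types (mu : probability (R * R * R)%type R) (Q : R * R * R -> R).

(* A unit Borel measure on the sphere is represented by its extension by zero
   to R^3, i.e. by a Borel probability measure carried by the sphere. *)
Definition on_sphere mu : Prop := mu sphere = 1%E.

(* The inverse is that of \bar R: the kernel is +oo on the diagonal. *)
Definition energy mu : \bar R :=
  (\int[mu]_(x in sphere) \int[mu]_(y in sphere) ((enorm (x - y))%:E)^-1)%E.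

Definition weighted_energy Q mu : \bar R :=
  (energy mu + 2%:E * \int[mu]_(x in sphere) (Q x)%:E)%E.

Definition min_energy Q : \bar R :=
  ereal_inf [set weighted_energy Q mu | mu in on_sphere].

Definition extremal Q mu : Prop :=
  on_sphere mu /\ weighted_energy Q mu = min_energy Q.

Definition msupport mu : set (R * R * R) :=
  [set x | forall U : set (R * R * R), open U -> U x -> (0 < mu U)%E].

(* d mu = f(phi) sin(phi) dtheta dphi on the cap of polar angles [alpha, pi]. *)
Definition has_cap_density mu (alpha : R) (f : R -> R) : Prop :=
  forall A : set (R * R * R), measurable A ->
    mu A = (\int[lebesgue_measure]_(phi in `[alpha, pi])
              \int[lebesgue_measure]_(theta in `[0%R, (2 * pi)%R])
                (\1_A (sph_point theta phi) * f phi * sin phi)%:E)%E.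

End Energy.

Section QuadraticField.
Context {R : realType}.
Implicit Types a b c alpha phi : R.

Definition quad_field a b c (x : R * R * R) : R :=
  a * x.2 ^+ 2 + b * x.2 + c.

Definition transcendental_eq a b alpha : Prop :=
  8 * a * cos alpha ^+ 3 * (2 * sin alpha + 3 * (pi - alpha))
  + cos alpha ^+ 2 * ((2 * a + 9 * b) * sin alpha
                      - 6 * (2 * a - 3 * b) * (pi - alpha))
  + 2^-1 * sin (2 * alpha) * (9 * b - 22 * a)
  + 3 * (2 * a - 3 * b) * (pi - alpha) + 9 * pi
  = 9 * cos alpha * (pi + (2 * a + b) * (pi - alpha))
    - 2 * sin alpha * (2 * a - 9 * b).

Definition F_fun a b c alpha phi : R :=
  (36 * pi ^+ 2)^-1 *
  ( Num.sqrt (1 - cos alpha) * Num.sqrt (cos alpha - cos phi)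
      * (20 * a * cos alpha + 60 * a * cos phi + 10 * a + 27 * b)
  - Num.sqrt ((1 - cos alpha) / (cos alpha - cos phi))
      * (8 * a * cos alpha ^+ 2 + 10 * a * cos alpha * cos phi
         + (4 * a + 9 * b) * cos alpha + (20 * a + 27 * b) * cos phi
         + 15 * a * cos (2 * phi) + 9 * a + 18 * b + 18 * c)
  - 6 * atan (Num.sqrt ((cos alpha - cos phi) / (1 - cos alpha)))
      * (15 * a * cos phi ^+ 2 + 9 * b * cos phi - 4 * a + 3 * c)).

Definition F_const a b c alpha : R :=
  (36 * (pi - alpha + sin alpha))^-1 *
  ( tan (alpha / 2)
      * (32 * a * cos alpha ^+ 3 + 4 * (2 * a + 9 * b) * cos alpha ^+ 2
         + 4 * (9 * c - 5 * a) * cos alpha + 4 * a - 36 * b + 36 * c)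
  + 12 * (a + 3 * c) * (pi - alpha) + 36 * pi).

(* At phi = alpha the quotient by cos alpha - cos phi = 0 is 0 by convention;
   this is a single value of phi, irrelevant for the measure. *)
Definition density a b c alpha phi : R :=
  F_const a b c alpha / (4 * pi)
    * (1 + 2 / pi *
         (Num.sqrt ((1 - cos alpha) / (cos alpha - cos phi))
          - atan (Num.sqrt ((1 - cos alpha) / (cos alpha - cos phi)))))
  + F_fun a b c alpha phi.

End QuadraticField.

(* Main.v *)
From HB Require Import structures.
Require Import Defs.
From mathcomp Require Import all_boot all_order all_algebra.
From mathcomp Require Import all_classical all_reals all_analysis.
From mathcomp Require Import measurable_realfun.
From mathcomp Require Import ring lra.
Import Order.TTheory GRing.Theory Num.Theory.
Import numFieldNormedType.Exports.
Local Open Scope classical_set_scope.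
Local Open Scope ring_scope.

(** Write x0 = cos alpha0, Q for the external field and F for the constant
    F_Q.  The theorem is an instance of the Gauss variational principle: it is
    enough to exhibit one unit measure nu on the cap whose potential U
    satisfies U + Q = F on the cap and U + Q >= F on the rest of the sphere.
    Integrating these relations against nu and against an extremal measure muQ
    gives I(muQ) + I(nu) <= 2 I(muQ, nu) ([extremal_le], [mutual_ge],
    [energy_cap]); as the Coulomb kernel is strictly positive definite, muQ and
    nu coincide ([extremal_unique]), and density and support are read off nu.

    The measure nu comes from Copson's method for axially symmetric charges.
    Two circles of latitude at heights x and y interact through
      2 int_(-1)^min(x,y) dz / sqrt ((1 - z^2) (x - z) (y - z))
    ([circle_integral], Landen's transformation of an elliptic integral), which
    separates the two heights.  The potential of a density f is therefore
    obtained by applying two Abel transforms in turn ([cap_potentialE]).  With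
    P a quadratic polynomial and S(z) = sqrt (1 - z) P(z) as the intermediate
    function, the outer transform of S over the whole interval below the height
    xi is elementary, and the coefficients of P ([pcoef]) are those for which
    it equals F - a xi^2 - b xi - c ([potential_inside]).  Inverting the inner
    transform requires S to vanish at x0, and P(x0) = 0 is, up to the nonzero
    factor 1 - x0, the transcendental equation ([pcoef_root]).  The inverse
    f = (1/pi) int -S'(w) / sqrt (w - cos phi) dw has as closed form the stated
    density ([densityE]), and the normalization of its mass is the formula for
    F_Q ([mass_pcoef]).  The condition 4 a^2 < b^2, that is 2 a < b, makes P
    decreasing on [-1, 1]: hence f > 0 inside the cap, and above the cap the
    potential exceeds F - Q because P < 0 there ([Apot_decr]).

    Positive definiteness is obtained from the binomial series: on the sphere
    |x - y|^2 = 2 (1 - x.y), the partial sums of (1 - t)^(-1/2) with an even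
    number of terms increase to it on [-1, 1] (to +oo at t = 1), and each power
    (x.y)^n is a sum of products g(x) g(y) over monomials g of degree n.
    Equality of energies then forces equality of all monomial moments
    ([mom_eq]), and moments determine a measure on a compact set
    ([measure_moments]).  The two poles, where the formula for U is not
    available, are negligible: a measure of finite energy has no atoms
    ([finite_energy_point]). *)

(** * Fundamental theorem of calculus on an open interval *)

Section ImproperFTC.
Context {R : realType}.
Notation mu := (@lebesgue_measure R).
Implicit Types (f F : R -> R) (a b V : R).

(** The integrand may blow up at both ends, as all the inverse square roots
    below do: exhaust ]a, b[ by compact intervals, where the usual theorem
    applies, and use monotone convergence and the continuity of F.  The value V
    is a separate argument so that it can be simplified by the caller. *)
Lemma ge0_FTC_oo f F a b V : V = F b - F a -> a < b ->
  (forall x, a < x < b -> is_derive x 1 F (f x)) ->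
  (forall x, a < x < b -> {for x, continuous f}) ->
  (forall x, a < x < b -> 0 <= f x) ->
  {within `[a, b], continuous F} ->
  (\int[mu]_(x in `]a, b[) (f x)%:E = V%:E)%E.
Proof.
move=> -> ab dF cf f0 cF.
pose h n : R := (b - a) / n.+3%:R.
have h0 n : 0 < h n by rewrite divr_gt0// subr_gt0.
have hle n : h n <= (b - a) / 3.
  by rewrite /h ler_pM2l ?subr_gt0// lef_pV2 ?posrE// ler_nat.
have hnd m n : (m <= n)%N -> h n <= h m.
  by move=> mn; rewrite /h ler_pM2l ?subr_gt0// lef_pV2 ?posrE// ler_nat.
pose I n : set R := `[a + h n, b - h n]%classic.
have Iab n x : I n x -> a < x < b.
  rewrite /I/= in_itv/= => /andP[ax xb].
  by rewrite (lt_le_trans _ ax) ?ltrDl//= (le_lt_trans xb)// ltrBlDr ltrDl.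
have hlim : h n @[n --> \oo] --> (0:R).
  rewrite -(mulr0 (b - a)); apply: cvgM; first exact: cvg_cst.
  have := @cvg_harmonic R.
  rewrite -(cvg_shiftn 2) /=.
  by under eq_fun do rewrite addn2.
have UI : `]a, b[%classic = \bigcup_n I n.
  apply/seteqP; split => x /=; last first.
    by move=> [n _ /Iab]; rewrite in_itv.
  rewrite in_itv/= => /andP[ax xb].
  have e0 : 0 < Num.min (x - a) (b - x) by rewrite lt_min !subr_gt0 ax xb.
  have /cvgrPdist_lt/(_ _ e0) := hlim.
  case=> N _ /(_ N (leqnn _)); rewrite sub0r normrN gtr0_norm//.
  rewrite lt_min => /andP[h1 h2]; exists N => //.
  by rewrite /I /= in_itv/=; lra.
have mf : measurable_fun `]a, b[ f.
  apply: open_continuous_measurable_fun => //.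
  by move=> x; rewrite inE/= in_itv/=; exact: cf.
have step n : (\int[mu]_(x in I n) (f x)%:E = (F (b - h n))%:E - (F (a + h n))%:E)%E.
  have ltn : a + h n < b - h n.
    by have := hle n; have : 0 < b - a by [rewrite subr_gt0]; lra.
  have sub x : x \in `[a + h n, b - h n] -> a < x < b by move/Iab.
  apply: continuous_FTC2 => //.
  - apply: continuous_in_subspaceT => x; rewrite inE => /Iab; exact: cf.
  - have cFn : {within `[a + h n, b - h n], continuous F}.
      apply: continuous_subspaceW cF => x /Iab/andP[/ltW ax /ltW xb].
      by rewrite /= in_itv/= ax.
    move: cFn => /(continuous_within_itvP _ ltn)[_ c1 c2]; split => //.
    move=> x xin; have xab : a < x < b.
      by apply: sub; exact: subset_itv_oo_cc xin.
    by have := dF x xab => ?; exact: ex_derive.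
  - move=> x xin; have xab : a < x < b.
      by apply: sub; exact: subset_itv_oo_cc xin.
    by rewrite derive1E; have := dF x xab => ?; exact: derive_val.
have cvg1 : (\int[mu]_(x in I n) (f x)%:E)%E @[n --> \oo] -->
    (\int[mu]_(x in `]a, b[) (f x)%:E)%E.
  rewrite UI; apply: ge0_nondecreasing_set_cvg_integral.
  - move=> m n mn; apply/subsetPset => x; rewrite /I/= !in_itv/=.
    by have := hnd _ _ mn; lra.
  - by move=> n; exact: measurable_itv.
  - move=> n; apply/measurable_EFinP; apply: measurable_funS mf => //.
    by move=> x /Iab; rewrite /= in_itv.
  - by move=> n x /Iab /f0; rewrite lee_fin.
have [cFo cFa cFb] := (continuous_within_itvP F ab).1 cF.
have cvg2 : (\int[mu]_(x in I n) (f x)%:E)%E @[n --> \oo] --> (F b - F a)%:E.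
  under eq_fun do rewrite step -EFinB.
  apply: cvg_EFin; first exact: nearW.
  have ha : F (a + h n) @[n --> \oo] --> F a.
    apply: (cvg_at_rightP _ _ _).1 cFa _ _ => //; split.
      by move=> n; rewrite ltrDl.
    by rewrite -[X in _ --> X]addr0; apply: cvgD => //; exact: cvg_cst.
  have hb : F (b - h n) @[n --> \oo] --> F b.
    apply: (cvg_at_leftP _ _ _).1 cFb _ _ => //; split.
      by move=> n; rewrite ltrBlDr ltrDl.
    by rewrite -[X in _ --> X]subr0; apply: cvgB => //; exact: cvg_cst.
  exact: cvgB.
exact: (cvg_unique _ cvg1 cvg2).
Qed.

End ImproperFTC.

(** * Derivatives, continuity, inverse square roots and the arcsine *)

Section Calculus.
Context {R : realType}.
Implicit Types (f g : R -> R) (x a b : R).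

Lemma derE f a b x : is_derive x 1 f a -> a = b -> is_derive x 1 f b.
Proof. by move=> ? <-. Qed.
Lemma derC (c x : R) : is_derive x 1 (fun=> c) (0 : R).
Proof. exact: is_derive_cst. Qed.
Lemma derI x : is_derive x 1 (fun y : R => y) (1 : R).
Proof. exact: is_derive_id. Qed.
Lemma derD f g a b x : is_derive x 1 f a -> is_derive x 1 g b ->
  is_derive x 1 (fun y => f y + g y) (a + b).
Proof. by move=> ? ?; exact: is_deriveD. Qed.
Lemma derN f a x : is_derive x 1 f a -> is_derive x 1 (fun y => - f y) (- a).
Proof. by move=> ?; exact: is_deriveN. Qed.
Lemma derM f g a b x : is_derive x 1 f a -> is_derive x 1 g b ->
  is_derive x 1 (fun y => f y * g y) (a * g x + f x * b).
Proof.
move=> fa gb; have H := is_deriveM fa gb.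
by apply: is_derive_eq H _; rewrite /GRing.scale/=; ring.
Qed.
Lemma derX f n a x : is_derive x 1 f a ->
  is_derive x 1 (fun y => f y ^+ n) (n%:R * f x ^+ n.-1 * a).
Proof.
move=> fa; have H := is_deriveX n fa.
have -> : (fun y => f y ^+ n) = f ^+ n by apply/funext => y; rewrite exprfctE.
exact: H.
Qed.
Lemma der_comp f g a b x : is_derive (g x) 1 f a -> is_derive x 1 g b ->
  is_derive x 1 (fun y => f (g y)) (b * a).
Proof.
move=> fa gb; have H := is_derive1_comp fa gb.
by apply: is_derive_eq H _; rewrite /GRing.scale/= ?[a * b]mulrC.
Qed.
Lemma derSqrt g b x : 0 < g x -> is_derive x 1 g b ->
  is_derive x 1 (fun y => Num.sqrt (g y)) (b * (2 * Num.sqrt (g x))^-1).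
Proof. by move=> g0 ?; apply: (@der_comp Num.sqrt); exact: is_derive1_sqrt. Qed.
Lemma derAtan g b x : is_derive x 1 g b ->
  is_derive x 1 (fun y => atan (g y)) (b * (1 + g x ^+ 2)^-1).
Proof. by move=> ?; apply: (@der_comp atan). Qed.
Lemma derSin g b x : is_derive x 1 g b ->
  is_derive x 1 (fun y => sin (g y)) (b * cos (g x)).
Proof. by move=> ?; apply: (@der_comp sin). Qed.
Lemma derCos g b x : is_derive x 1 g b ->
  is_derive x 1 (fun y => cos (g y)) (b * - sin (g x)).
Proof. by move=> ?; apply: (@der_comp cos). Qed.
Lemma derV g b x : g x != 0 -> is_derive x 1 g b ->
  is_derive x 1 (fun y => (g y)^-1) (- b * (g x)^-1 * (g x)^-1).
Proof.
move=> g0 gb; have dg : derivable g x 1 by exact: ex_derive.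
have dV : derivable (fun y => (g y)^-1) x 1 by exact: derivableV.
apply: DeriveDef => //.
rewrite (@deriveV _ _ _ _ _ g0 dg) derive_val /GRing.scale/= -exprVn expr2.
by ring.
Qed.

Section cont.
Context {T : topologicalType}.
Implicit Types (u v : T -> R) (t : T).
Lemma contC (c : R) t : {for t, continuous (fun _ : T => c)}.
Proof. exact: cst_continuous. Qed.
Lemma contD u v t : {for t, continuous u} -> {for t, continuous v} ->
  {for t, continuous (fun y => u y + v y)}.
Proof. by move=> ? ?; exact: continuousD. Qed.
Lemma contN u t : {for t, continuous u} -> {for t, continuous (fun y => - u y)}.
Proof. by move=> ?; exact: continuousN. Qed.
Lemma contM u v t : {for t, continuous u} -> {for t, continuous v} ->
  {for t, continuous (fun y => u y * v y)}.
Proof. by move=> ? ?; exact: continuousM. Qed.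
Lemma contX u n t : {for t, continuous u} -> {for t, continuous (fun y => u y ^+ n)}.
Proof.
move=> ut; elim: n => [|n IH]; first exact: cst_continuous.
have -> : (fun y => u y ^+ n.+1) = (fun y => u y * u y ^+ n).
  by apply/funext => y; rewrite exprS.
exact: contM.
Qed.
Lemma cont_comp (f : R -> R) u t : {for u t, continuous f} -> {for t, continuous u} ->
  {for t, continuous (fun y => f (u y))}.
Proof. by move=> ? ?; exact: continuous_comp. Qed.
Lemma contV u t : u t != 0 -> {for t, continuous u} -> {for t, continuous (fun y => (u y)^-1)}.
Proof. by move=> ? ?; exact: continuousV. Qed.
Lemma contSqrt u t : {for t, continuous u} -> {for t, continuous (fun y => Num.sqrt (u y))}.
Proof. by apply: cont_comp; exact: sqrt_continuous. Qed.
Lemma contAtan u t : {for t, continuous u} -> {for t, continuous (fun y => atan (u y))}.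
Proof. by apply: cont_comp; exact: continuous_atan. Qed.
Lemma contSin u t : {for t, continuous u} -> {for t, continuous (fun y => sin (u y))}.
Proof. by apply: cont_comp; exact: continuous_sin. Qed.
Lemma contCos u t : {for t, continuous u} -> {for t, continuous (fun y => cos (u y))}.
Proof. by apply: cont_comp; exact: continuous_cos. Qed.
End cont.
Lemma contI x : {for x, continuous (fun y : R => y)}.
Proof. by move=> A; exact. Qed.

(** As sqrt and inversion are total, rsq vanishes on the nonpositive reals.
    A factor rsq (x - z) thus also carries the indicator of z < x, and
    integrals over variable ranges can be written over fixed intervals. *)
Definition rsq x : R := (Num.sqrt x)^-1.

Lemma rsq_ge0 x : 0 <= rsq x. Proof. by rewrite invr_ge0 sqrtr_ge0. Qed.
Lemma rsq_le0 x : x <= 0 -> rsq x = 0.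
Proof. by move=> x0; rewrite /rsq ler0_sqrtr// invr0. Qed.
Lemma rsq_gt0 x : 0 < x -> 0 < rsq x.
Proof. by move=> x0; rewrite invr_gt0 sqrtr_gt0. Qed.
Lemma rsqM x y : 0 <= x -> rsq (x * y) = rsq x * rsq y.
Proof. by move=> x0; rewrite /rsq sqrtrM// invfM. Qed.
Lemma rsq_anti x y : 0 < x -> x <= y -> rsq y <= rsq x.
Proof.
move=> x0 xy; have y0 : 0 < y by exact: lt_le_trans xy.
by rewrite /rsq lef_pV2 ?posrE ?sqrtr_gt0// ler_sqrt// ltW.
Qed.
Lemma contRsq {T : topologicalType} (u : T -> R) t : 0 < u t ->
  {for t, continuous u} -> {for t, continuous (fun y => rsq (u y))}.
Proof.
move=> u0 cu; apply: contV; last exact: contSqrt.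
by rewrite gt_eqF// sqrtr_gt0.
Qed.
Lemma measurable_rsq : measurable_fun [set: R] rsq.
Proof.
have -> : rsq = rsq \_ (`]0, +oo[ : set R).
  apply/funext => x; rewrite patchE; case: ifPn => //.
  rewrite notin_setE/= in_itv/= andbT => /negP; rewrite -leNgt; exact: rsq_le0.
apply/measurable_restrict => //; rewrite setTI.
apply: open_continuous_measurable_fun => // x.
rewrite inE/= in_itv/= andbT => x0; apply: contRsq => //; exact: contI.
Qed.
End Calculus.

Ltac der1 := lazymatch goal with
 | |- is_derive _ _ (fun _ => ?c) _ => notypeclasses refine (derC c _)
 | |- is_derive _ _ (fun y => y) _ => notypeclasses refine (derI _)
 | |- is_derive _ _ (fun y => @?f y + @?g y) _ => notypeclasses refine (@derD _ f g _ _ _ _ _)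
 | |- is_derive _ _ (fun y => - @?f y) _ => notypeclasses refine (@derN _ f _ _ _)
 | |- is_derive _ _ (fun y => @?f y * @?g y) _ => notypeclasses refine (@derM _ f g _ _ _ _ _)
 | |- is_derive _ _ (fun y => @?f y ^+ ?n) _ => notypeclasses refine (@derX _ f n _ _ _)
 | |- is_derive _ _ (fun y => (@?f y)^-1) _ => notypeclasses refine (@derV _ f _ _ _ _)
 | |- is_derive _ _ (fun y => Num.sqrt (@?f y)) _ => notypeclasses refine (@derSqrt _ f _ _ _ _)
 | |- is_derive _ _ (fun y => atan (@?f y)) _ => notypeclasses refine (@derAtan _ f _ _ _)
 | |- is_derive _ _ (fun y => sin (@?f y)) _ => notypeclasses refine (@derSin _ f _ _ _)
 | |- is_derive _ _ (fun y => cos (@?f y)) _ => notypeclasses refine (@derCos _ f _ _ _)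
end.
Ltac der := repeat der1.
Tactic Notation "dereq" := notypeclasses refine (@derE _ _ _ _ _ _ _).
Ltac cont1 := lazymatch goal with
 | |- continuous_at ?t ?f => change {for t, continuous f}
 | |- {for _, continuous (fun _ => ?c)} => exact: contC
 | |- {for _, continuous (fun y => y)} => exact: contI
 | |- {for _, continuous (fun y => @?f y + @?g y)} => apply: (@contD _ _ f g)
 | |- {for _, continuous (fun y => - @?f y)} => apply: (@contN _ _ f)
 | |- {for _, continuous (fun y => @?f y * @?g y)} => apply: (@contM _ _ f g)
 | |- {for _, continuous (fun y => @?f y ^+ ?n)} => apply: (@contX _ _ f n)
 | |- {for _, continuous (fun y => (@?f y)^-1)} => apply: (@contV _ _ f)
 | |- {for _, continuous (fun y => rsq (@?f y))} => apply: (@contRsq _ _ f)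
 | |- {for _, continuous (fun y => Num.sqrt (@?f y))} => apply: (@contSqrt _ _ f)
 | |- {for _, continuous (fun y => atan (@?f y))} => apply: (@contAtan _ _ f)
 | |- {for _, continuous (fun y => sin (@?f y))} => apply: (@contSin _ _ f)
 | |- {for _, continuous (fun y => cos (@?f y))} => apply: (@contCos _ _ f)
end.
Ltac cont := repeat cont1.

Section Asn.
Context {R : realType}.
Implicit Types (x v z w : R).

(** The arcsine, by the half-angle formula: continuous on the whole line and
    differentiable inside ]-1, 1[, so that antiderivatives built on it are
    continuous up to the end points. *)
Definition asn v : R := 2 * atan (v / (1 + Num.sqrt (1 - v ^+ 2))).

Lemma asn_cont {T : topologicalType} (u : T -> R) t :
  {for t, continuous u} -> {for t, continuous (fun y => asn (u y))}.
Proof.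
move=> cu; rewrite /asn; cont => //.
Qed.

Lemma der_asn (g : R -> R) b x : -1 < g x < 1 -> is_derive x 1 g b ->
  is_derive x 1 (fun y => asn (g y)) (b * rsq (1 - g x ^+ 2)).
Proof.
move=> /andP[v1 v2] dg.
suff D : is_derive (g x) 1 asn (rsq (1 - g x ^+ 2)) by exact: (der_comp asn g _ _ _ D dg).
have v0 : 0 < 1 - g x ^+ 2 by rewrite subr_gt0 expr2; nra.
have s0 : 0 < Num.sqrt (1 - g x ^+ 2) by rewrite sqrtr_gt0.
have ss : Num.sqrt (1 - g x ^+ 2) ^+ 2 = 1 - g x ^+ 2 by rewrite sqr_sqrtr// ltW.
rewrite /asn; dereq; first by der => //; rewrite gt_eqF// addr_gt0.
rewrite /rsq; set s := Num.sqrt _ in s0 ss *; set v := g x in v0 ss v1 v2 *.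
have vs : v ^+ 2 = 1 - s ^+ 2 by lra.
have e1 : 1 + (v / (1 + s)) ^+ 2 = 2 / (1 + s).
  rewrite exprMn vs exprVn; field; lra.
rewrite e1 /=; set w := v ^+ 1.
have -> : w = v by rewrite /w expr1.
rewrite [X in 2 * (X / _)](_ : _ = (1 + s)^-1 + v ^+ 2 / s / (1 + s) ^+ 2); last by field; lra.
rewrite vs; field; lra.
Qed.

Lemma tan_half w : cos w != 0 ->
  sin (w *+ 2) / (1 + cos (w *+ 2)) = tan w :> R.
Proof.
move=> c0; rewrite sin_mulr2n cos_mulr2n /tan !mulr2n addrC subrK.
have -> : cos w ^+ 2 + cos w ^+ 2 = 2 * (cos w * cos w) by ring.
by field.
Qed.

Lemma asn_sin u : - (pi / 2) <= u <= pi / 2 -> asn (sin u) = u.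
Proof.
move=> u12.
have c0 : 0 <= cos u by apply: cos_ge0_pihalf.
rewrite /asn -cos2sin2 sqrtr_sqr ger0_norm//.
have p0 := @pi_gt0 R.
have ch : 0 < cos (u / 2) by apply: cos_gt0_pihalf; lra.
have -> : sin u / (1 + cos u) = tan (u / 2).
  rewrite -tan_half ?gt_eqF//.
  by have -> : u / 2 *+ 2 = u by rewrite mulr2n; lra.
rewrite tanK; first by field.
rewrite in_itv/=; lra.
Qed.

Lemma asn1 : asn 1 = pi / 2.
Proof. by rewrite -[X in asn X]sin_pihalf asn_sin// lexx andbT; have := @pi_gt0 R; lra. Qed.
Lemma asnN v : asn (- v) = - asn v.
Proof. by rewrite /asn sqrrN mulNr atanN mulrN. Qed.
Lemma sin_asn v : -1 <= v <= 1 -> sin (asn v) = v.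
Proof.
move=> v1; rewrite -[in LHS](@asinK _ v) ?in_itv//= asn_sin ?asinK ?in_itv//.
by rewrite asin_geNpi2// asin_lepi2.
Qed.
Lemma asn_cos u : 0 <= u <= pi -> asn (cos u) = pi / 2 - u.
Proof.
move=> u0; have -> : cos u = sin (pi / 2 - u) by rewrite sinB sin_pihalf cos_pihalf; ring.
by rewrite asn_sin//; lra.
Qed.
End Asn.

Ltac dera := repeat (first [ lazymatch goal with
 | |- is_derive _ _ (fun y => asn (@?f y)) _ => notypeclasses refine (@der_asn _ f _ _ _ _)
 end | der1 ]).
Ltac conta := repeat (first [ lazymatch goal with
 | |- {for _, continuous (fun y => asn (@?f y))} => apply: (@asn_cont _ _ f)
 end | cont1 ]).
Ltac dcomp H := notypeclasses refine (@der_comp _ H _ _ _ _ _ _).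

Set Implicit Arguments.
Unset Strict Implicit.
Unset Printing Implicit Defensive.

(** * Elementary integrals with square root singularities *)

Section Integrals.
Context {R : realType}.
Notation mu := (@lebesgue_measure R).
Implicit Types (x y z w a b : R).

Lemma eq_integral_supp (A B : set R) (f : R -> \bar R) :
  A `<=` B -> (forall x, B x -> ~ A x -> f x = 0%E) ->
  (\int[mu]_(x in B) f x = \int[mu]_(x in A) f x)%E.
Proof.
move=> AB f0; rewrite integral_mkcond [RHS]integral_mkcond.
apply: eq_integral => x _; rewrite !patchE.
case: ifPn => [/set_mem Bx|]; case: ifPn => //.
  by move=> /negP; rewrite inE => nA; exact: f0.
by move=> /set_mem /AB Bx; rewrite notin_setE.
Qed.

Lemma rsq_scale (d u v : R) : 0 < d -> u * d ^+ 2 = v -> rsq v = rsq u / d.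
Proof.
move=> d0 <-; rewrite /rsq mulrC sqrtrM ?sqr_ge0// sqrtr_sqr gtr0_norm//.
by rewrite invfM mulrC.
Qed.

Lemma acos_itv (v : R) : -1 <= v <= 1 -> 0 <= acos v <= pi.
Proof. by move=> v1; rewrite acos_ge0// acos_lepi. Qed.

Lemma cos_lt_acos (v phi : R) : -1 <= v <= 1 -> 0 <= phi <= pi ->
  (cos phi < v) = (acos v < phi).
Proof.
move=> v1 p1; rewrite -[X in _ < X](@acosK _ v) ?in_itv//.
by rewrite ltr_cos// in_itv/= acos_itv.
Qed.
Lemma acos_lt_cos (v phi : R) : -1 <= v <= 1 -> 0 <= phi <= pi ->
  (v < cos phi) = (phi < acos v).
Proof.
move=> v1 p1; rewrite -[X in X < _](@acosK _ v) ?in_itv//.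
by rewrite ltr_cos// in_itv/= acos_itv.
Qed.

(** Abel's kernel: with u = cos phi this is the integral of
    du / sqrt ((w - u) (u - z)) between z and w, which does not depend on z, w. *)
Lemma integral_arcsine (al z w : R) : 0 <= al <= pi ->
  -1 <= z -> z < w -> w <= cos al ->
  (\int[mu]_(phi in `]al, pi[)
     (sin phi * rsq (w - cos phi) * rsq (cos phi - z))%:E = pi%:E)%E.
Proof.
move=> al0 z1 zw wal; have c1 := cos_le1 al.
have wI : -1 <= w <= 1 by lra.
have zI : -1 <= z <= 1 by lra.
have ap : al <= acos w by rewrite leNgt -cos_lt_acos// -leNgt.
have /andP[aw0 aw1] := acos_itv wI; have /andP[az0 az1] := acos_itv zI.
have pq : acos w < acos z by rewrite -cos_lt_acos ?az0// acosK ?in_itv//.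
rewrite (@eq_integral_supp `]acos w, acos z[%classic); first last.
- move=> phi /=; rewrite !in_itv/= => /andP[p1 p2] /negP.
  have p0 : 0 <= phi <= pi by lra.
  rewrite negb_and -!leNgt => /orP[h|h].
    rewrite (@rsq_le0 _ (w - cos phi)) ?mulr0 ?mul0r//.
    by rewrite subr_le0 leNgt cos_lt_acos// -leNgt.
  rewrite (@rsq_le0 _ (cos phi - z)) ?mulr0//.
  by rewrite subr_le0 leNgt acos_lt_cos// -leNgt.
- by move=> phi /=; rewrite !in_itv/= => /andP[p1 p2]; lra.
have d0 : 0 < w - z by lra.
have loc phi : acos w < phi < acos z -> [/\ 0 <= phi <= pi, z < cos phi & cos phi < w].
  move=> /andP[p1 p2]; have p0 : 0 <= phi <= pi by lra.
  by split => //; rewrite ?acos_lt_cos// cos_lt_acos.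
pose F phi := - asn ((2 * cos phi - z - w) / (w - z)).
apply: (@ge0_FTC_oo R (fun phi : R => sin phi * rsq (w - cos phi) * rsq (cos phi - z)) F).
- rewrite /F !acosK ?in_itv//=.
  have -> : (2 * z - z - w) / (w - z) = - 1 by field; lra.
  have -> : (2 * w - z - w) / (w - z) = 1 by field; lra.
  by rewrite asnN asn1; field.
- by [].
- move=> phi /loc[p0 c2 c3]; rewrite /F.
  dereq.
    by dera; rewrite ltr_pdivlMr// ltr_pdivrMr//; lra.
  have -> : 1 - ((2 * cos phi - z - w) / (w - z)) ^+ 2 =
      (w - cos phi) * (cos phi - z) * (2 / (w - z)) ^+ 2 by field; lra.
  rewrite (@rsq_scale (2 / (w - z)) ((w - cos phi) * (cos phi - z))) ?divr_gt0//.
  rewrite rsqM; last by lra.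
  by field; lra.
- by move=> phi /loc[p0 c2 c3]; cont; lra.
- move=> phi /loc[p0 c2 c3].
  by rewrite !mulr_ge0 ?rsq_ge0// sin_ge0_pi.
- apply: continuous_subspaceT; rewrite /F => phi.
  by conta.
Qed.

Lemma integral_sin_rsq (al w : R) : 0 <= al <= pi -> -1 < w -> w <= cos al ->
  (\int[mu]_(phi in `]al, pi[) (sin phi * rsq (w - cos phi))%:E
    = (2 * Num.sqrt (1 + w))%:E)%E.
Proof.
move=> al0 w1 wal; have c1 := cos_le1 al.
have wI : -1 <= w <= 1 by lra.
have ap : al <= acos w by rewrite leNgt -cos_lt_acos// -leNgt.
have /andP[aw0 aw1] := acos_itv wI.
have pq : acos w < pi by rewrite acos_ltpi//; lra.
rewrite (@eq_integral_supp `]acos w, pi[%classic); first last.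
- move=> phi /=; rewrite !in_itv/= => /andP[p1 p2] /negP.
  have p0 : 0 <= phi <= pi by lra.
  rewrite p2 andbT -leNgt => h.
  rewrite (@rsq_le0 _ (w - cos phi)) ?mulr0 ?mul0r//.
  by rewrite subr_le0 leNgt cos_lt_acos// -leNgt.
- by move=> phi /=; rewrite !in_itv/= => /andP[p1 p2]; lra.
have loc phi : acos w < phi < pi -> [/\ 0 <= phi <= pi & cos phi < w].
  move=> /andP[p1 p2]; have p0 : 0 <= phi <= pi by lra.
  by split => //; rewrite cos_lt_acos.
pose F phi := 2 * Num.sqrt (w - cos phi).
apply: (@ge0_FTC_oo R (fun phi : R => sin phi * rsq (w - cos phi)) F).
- rewrite /F acosK ?in_itv//= subrr sqrtr0 cospi opprK.
  by rewrite addrC; ring.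
- by [].
- move=> phi /loc[p0 c2]; rewrite /F.
  dereq; first by der; lra.
  rewrite /rsq; field.
  by rewrite gt_eqF// sqrtr_gt0; lra.
- by move=> phi /loc[p0 c2]; cont; lra.
- by move=> phi /loc[p0 c2]; rewrite !mulr_ge0 ?rsq_ge0// sin_ge0_pi.
- by apply: continuous_subspaceT; rewrite /F => phi; cont.
Qed.

Definition quad (p : R * R * R) z := p.1.1 + p.1.2 * z + p.2 * z ^+ 2.

(** An antiderivative of quad p z / sqrt ((1 + z) (xi - z)), the integrand of
    the outer Abel transform. *)
Definition Apot (p : R * R * R) (xi z : R) : R :=
  let ga := - p.2 / 2 in
  let be := 3 / 2 * (xi - 1) * ga - p.1.2 in
  let al := p.1.1 - be * (xi - 1) / 2 - ga * xi in
  al * asn ((2 * z + 1 - xi) / (1 + xi)) + (be + ga * z) * Num.sqrt ((1 + z) * (xi - z)).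

Lemma Apot_ends p xi : -1 < xi ->
  Apot p xi xi - Apot p xi (-1) =
  pi * (p.1.1 + p.1.2 * (xi - 1) / 2 + p.2 * (3 * xi ^+ 2 - 2 * xi + 3) / 8).
Proof.
move=> xi1; rewrite /Apot subrr mulr0 addrN mul0r sqrtr0.
have -> : (2 * xi + 1 - xi) / (1 + xi) = 1 by field; lra.
have -> : (2 * -1 + 1 - xi) / (1 + xi) = -1 by field; lra.
by rewrite asnN asn1; field.
Qed.

Lemma Apot_cont p xi z : {for z, continuous (Apot p xi)}.
Proof.
by rewrite /Apot; conta.
Qed.

Lemma Apot_der p xi z : -1 < z < xi ->
  is_derive z 1 (Apot p xi) (quad p z * rsq (1 + z) * rsq (xi - z)).
Proof.
move=> /andP[z1 z2]; rewrite /Apot.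
have r0 : 0 < (1 + z) * (xi - z) by rewrite mulr_gt0; lra.
dereq.
  by dera; rewrite // ltr_pdivlMr ?ltr_pdivrMr; lra.
have -> : 1 - ((2 * z + 1 - xi) / (1 + xi)) ^+ 2 =
    (1 + z) * (xi - z) * (2 / (1 + xi)) ^+ 2 by field; lra.
rewrite (@rsq_scale (2 / (1 + xi)) ((1 + z) * (xi - z))) ?divr_gt0//; last by lra.
rewrite -[in RHS]mulrA -rsqM; last by lra.
rewrite /rsq; have s0 : 0 < Num.sqrt ((1 + z) * (xi - z)) by rewrite sqrtr_gt0.
have ss : Num.sqrt ((1 + z) * (xi - z)) ^+ 2 = (1 + z) * (xi - z).
  by rewrite sqr_sqrtr// ltW.
set s := Num.sqrt _ in s0 ss *.
apply: (@mulIf _ s); first by rewrite gt_eqF.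
rewrite -[RHS]mulrA mulVf ?gt_eqF// mulr1 /quad.
transitivity (p.1.1 - (3 / 2 * (xi - 1) * (- p.2 / 2) - p.1.2) * (xi - 1) / 2 -
   - p.2 / 2 * xi + (- p.2 / 2) * s ^+ 2 +
   ((3 / 2 * (xi - 1) * (- p.2 / 2) - p.1.2) + - p.2 / 2 * z) * (xi - 1 - 2 * z) / 2).
  by field; lra.
by rewrite ss; field.
Qed.

Lemma integral_pot p xi m : -1 < m -> m <= xi ->
  (forall z, -1 < z < m -> 0 <= quad p z) ->
  (\int[mu]_(z in `](-1)%R, m[) (quad p z * rsq (1 + z) * rsq (xi - z))%:E
   = (Apot p xi m - Apot p xi (-1))%:E)%E.
Proof.
move=> m1 mxi q0; apply: (@ge0_FTC_oo R (fun z : R => quad p z * rsq (1 + z) * rsq (xi - z)) (Apot p xi)).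
- by [].
- by [].
- by move=> z /andP[z1 z2]; apply: Apot_der; lra.
- by move=> z /andP[z1 z2]; rewrite /quad; cont; lra.
- by move=> z /q0 qz; rewrite !mulr_ge0 ?rsq_ge0.
- by apply: continuous_subspaceT => z; exact: Apot_cont.
Qed.

(** With tan t = sqrt ((w - y) / (1 - w)) the integrand becomes quadratic in
    cos (2 t); this is where the arctangents of the density come from. *)
Lemma integral_dens (q : R * R * R) (y x0 : R) : y < x0 -> x0 < 1 ->
  (forall w, y < w < x0 -> 0 <= quad q w) ->
  let ga := - q.2 / 2 in
  let be := 3 / 2 * ga * (1 + y) - q.1.2 in
  let c := q.1.1 + ga * y - be * (1 + y) / 2 in
  (\int[mu]_(w in `]y, x0[) (quad q w * rsq (1 - w) * rsq (w - y))%:E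
   = (2 * c * atan (Num.sqrt ((x0 - y) / (1 - x0)))
      + (be + ga * x0) * (Num.sqrt (1 - x0) * Num.sqrt (x0 - y)))%:E)%E.
Proof.
move=> yx x1 q0 ga be c.
pose B w := 2 * c * atan (Num.sqrt ((w - y) / (1 - w)))
      + (be + ga * w) * (Num.sqrt (1 - w) * Num.sqrt (w - y)).
apply: (@ge0_FTC_oo R (fun w : R => quad q w * rsq (1 - w) * rsq (w - y)) B).
- by rewrite /B subrr mul0r sqrtr0 atan0 !mulr0 addr0 subr0.
- by [].
- move=> w /andP[w1 w2]; rewrite /B.
  have g0 : 0 < (w - y) / (1 - w) by rewrite divr_gt0; lra.
  dereq; first by der; lra.
  rewrite sqr_sqrtr ?(ltW g0)// sqrtrM; last by lra.
  rewrite sqrtrV; last by lra.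
  rewrite /rsq.
  have s0 : 0 < Num.sqrt (1 - w) by rewrite sqrtr_gt0; lra.
  have t0 : 0 < Num.sqrt (w - y) by rewrite sqrtr_gt0; lra.
  have ss : Num.sqrt (1 - w) ^+ 2 = 1 - w by rewrite sqr_sqrtr//; lra.
  have tt : Num.sqrt (w - y) ^+ 2 = w - y by rewrite sqr_sqrtr//; lra.
  set s := Num.sqrt (1 - w) in s0 ss *; set t := Num.sqrt (w - y) in t0 tt *.
  have ew : w = 1 - s ^+ 2 by lra.
  have ey : y = 1 - s ^+ 2 - t ^+ 2 by lra.
  rewrite /quad /c /be /ga ey ew; field.
  have -> : 1 - (1 - s ^+ 2) = s ^+ 2 by ring.
  have -> : s ^+ 2 + (1 - s ^+ 2 - (1 - s ^+ 2 - t ^+ 2)) = s ^+ 2 + t ^+ 2 by ring.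
  by rewrite !gt_eqF// ?addr_gt0// exprn_gt0.
- by move=> w /andP[w1 w2]; rewrite /quad; cont; lra.
- by move=> w wy; rewrite !mulr_ge0 ?rsq_ge0// q0.
- apply: continuous_in_subspaceT => w; rewrite inE/= in_itv/= => /andP[w1 w2].
  by change {for w, continuous B}; rewrite /B; cont; lra.
Qed.

Lemma integral_mass (q : R * R * R) (x0 : R) : -1 < x0 < 1 ->
  (forall w, -1 < w < x0 -> 0 <= quad q w) ->
  let m2 := - q.2 / 3 in
  let m1 := - (q.1.2 + q.2) / 2 in
  let m0 := 2 * m2 - (q.1.1 + q.1.2) in
  (\int[mu]_(w in `](-1)%R, x0[) (quad q w * rsq (1 - w) * Num.sqrt (1 + w))%:E
   = ((q.1.1 - m1) * (asn x0 + pi / 2)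
      + (m0 + m1 * x0 + m2 * x0 ^+ 2) * Num.sqrt (1 - x0 ^+ 2))%:E)%E.
Proof.
move=> /andP[x1 x2] q0 m2 m1 m0.
pose M w := (q.1.1 - m1) * asn w + (m0 + m1 * w + m2 * w ^+ 2) * Num.sqrt (1 - w ^+ 2).
apply: (@ge0_FTC_oo R (fun w : R => quad q w * rsq (1 - w) * Num.sqrt (1 + w)) M).
- rewrite /M sqrrN expr1n subrr sqrtr0 asnN asn1; field.
- by lra.
- by [].
- move=> w /andP[w1 w2]; rewrite /M.
  have r0 : 0 < (1 - w) * (1 + w) by rewrite mulr_gt0; lra.
  have e : 1 - w ^+ 2 = (1 - w) * (1 + w) by ring.
  dereq.
    by dera; rewrite ?e//; lra.
  rewrite /= !e rsqM ?sqrtrM; try lra; rewrite /rsq.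
  have s0 : 0 < Num.sqrt (1 - w) by rewrite sqrtr_gt0; lra.
  have t0 : 0 < Num.sqrt (1 + w) by rewrite sqrtr_gt0; lra.
  have ss : Num.sqrt (1 - w) ^+ 2 = 1 - w by rewrite sqr_sqrtr//; lra.
  have tt : Num.sqrt (1 + w) ^+ 2 = 1 + w by rewrite sqr_sqrtr//; lra.
  set s := Num.sqrt (1 - w) in s0 ss *; set t := Num.sqrt (1 + w) in t0 tt *.
  have st0 : 0 < s * t by rewrite mulr_gt0.
  apply: (@mulIf _ (s * t)); first by rewrite gt_eqF.
  transitivity (quad q w * t ^+ 2); last by field; rewrite gt_eqF.
  transitivity (q.1.1 - m1 + (m1 + 2 * m2 * w) * (s ^+ 2 * t ^+ 2) -
    w * (m0 + m1 * w + m2 * w ^+ 2)); first by field; rewrite !gt_eqF.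
  by rewrite ss tt /quad /m0 /m1 /m2; field.
- by move=> w /andP[w1 w2]; rewrite /quad; cont; lra.
- by move=> w wy; rewrite !mulr_ge0 ?rsq_ge0 ?sqrtr_ge0// q0.
- apply: continuous_subspaceT => w; by rewrite /M; conta.
Qed.

(** The coefficients for which - (sqrt (1 - w) quad p w)' is
    quad (neg_der p) w / sqrt (1 - w). *)
Definition neg_der (p : R * R * R) : R * R * R :=
  (p.1.1 / 2 - p.1.2, 3 / 2 * p.1.2 - 2 * p.2, 5 / 2 * p.2).

Lemma integral_neg_der p z x0 : z < x0 -> x0 <= 1 ->
  (forall w, z < w < x0 -> 0 <= quad (neg_der p) w) ->
  (\int[mu]_(w in `]z, x0[) (quad (neg_der p) w * rsq (1 - w))%:E
   = (Num.sqrt (1 - z) * quad p z - Num.sqrt (1 - x0) * quad p x0)%:E)%E.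
Proof.
move=> zx x1 q0; pose F w := - (Num.sqrt (1 - w) * quad p w).
apply: (@ge0_FTC_oo R (fun w : R => quad (neg_der p) w * rsq (1 - w)) F).
- by rewrite /F; ring.
- by [].
- move=> w /andP[w1 w2]; rewrite /F /quad; dereq; first by der; lra.
  have s0 : 0 < Num.sqrt (1 - w) by rewrite sqrtr_gt0; lra.
  have ss : Num.sqrt (1 - w) ^+ 2 = 1 - w by rewrite sqr_sqrtr//; lra.
  rewrite /rsq; set s := Num.sqrt (1 - w) in s0 ss *.
  apply: (@mulIf _ s); first by rewrite gt_eqF.
  rewrite -[RHS]mulrA mulVf ?gt_eqF// mulr1 /neg_der/=.
  transitivity ((p.1.1 + p.1.2 * w + p.2 * w ^+ 2) / 2 - s ^+ 2 * (p.1.2 + 2 * p.2 * w)).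
    by field; rewrite gt_eqF.
  by rewrite ss; field.
- by move=> w /andP[w1 w2]; rewrite /quad; cont; lra.
- by move=> w /q0 qw; rewrite mulr_ge0 ?rsq_ge0.
- by apply: continuous_subspaceT; rewrite /F /quad => w; cont.
Qed.

End Integrals.

(** * Interaction of two circles of latitude *)

Section Landen.
Context {R : realType}.
Notation mu := (@lebesgue_measure R).
Implicit Types (x y z w a b : R).

Lemma primitive_on (h : R -> R) (N : R) : continuous h -> 0 < N ->
  exists H : R -> R, forall x, -N < x < N -> is_derive x 1 H (h x).
Proof.
move=> ch N0; exists (fun x => \int[mu]_(t in [set` `[-N, x]]) h t)%R => x /andP[x1 x2].
have ih : mu.-integrable `[-N, N] (EFin \o h).
  apply: continuous_compact_integrable; first exact: segment_compact.
  exact: continuous_subspaceT.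
have [dF F'] := continuous_FTC1_closed x2 ih x1 (ch x).
by rewrite -F' derive1E; exact: derivableP.
Qed.

Lemma derive0_cst (F : R -> R) a b : a <= b ->
  (forall x, a <= x <= b -> is_derive x 1 F 0) -> F a = F b.
Proof.
move=> ab dF; have dF' x : x \in `]a, b[%R -> is_derive x 1 F (cst 0 x).
  by rewrite in_itv/= => /andP[/ltW x1 /ltW x2]; apply: dF; rewrite x1.
have cF : {within `[a, b], continuous F}.
  apply: derivable_within_continuous => x; rewrite in_itv/= => xab.
  by have := dF x xab => ?; exact: ex_derive.
have [c _] := @MVT_segment R F (cst 0) a b ab dF' cF.
by rewrite /= mul0r => /eqP; rewrite subr_eq0 => /eqP.
Qed.

Lemma continuous_measurable_itv (h : R -> R) (A : set R) : measurable A ->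
  continuous h -> measurable_fun A (fun x => (h x)%:E).
Proof.
move=> mA ch; apply/measurable_EFinP; apply: measurable_funTS.
exact: continuous_measurable_fun.
Qed.

(** H is required on three half periods to each side because the shift t0
    moves the range of integration inside [- 2 pi, 2 pi]. *)
Lemma integral_period (h H : R -> R) (t0 : R) : continuous h ->
  (forall t, 0 <= h t) -> (forall t, h (- t) = h t) ->
  (forall t, h (t + 2 * pi) = h t) ->
  (forall t, - (3 * pi) < t < 3 * pi -> is_derive t 1 H (h t)) ->
  0 <= t0 <= 2 * pi ->
  (\int[mu]_(t in `[0%R, (2 * pi)%R]) (h (t - t0))%:E = (2 * (H pi - H 0))%:E)%E.
Proof.
move=> ch h0 hN hp dH t01; have p0 := @pi_gt0 R.
have chs : continuous (fun t => h (t - t0)).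
  by move=> t; change {for t, continuous (fun t => h (t - t0))}; apply: cont_comp; [exact: ch|cont].
rewrite integral_itv_bndoo; last exact: continuous_measurable_itv.
have T1 : H (2 * pi - t0) - H (- t0) = H (2 * pi) - H 0.
  pose G t := H (2 * pi + - t) + - H (- t).
  have dG t : 0 <= t <= t0 -> is_derive t 1 G 0.
    move=> tt; rewrite /G; dereq.
      der1; first by dcomp H; [apply: dH; lra|der].
      der1; notypeclasses refine (@der_comp _ H (fun t => - t) _ _ _ _ _); [apply: dH; lra|der].
    by rewrite [2 * pi + _]addrC hp; ring.
  have /andP[t00 _] := t01.
  by have := derive0_cst t00 dG; rewrite /G oppr0 addr0 => ->.
have T2 : H (2 * pi) + H 0 = H pi + H pi.
  pose G t := H (pi + t) + H (pi + - t).
  have dG t : 0 <= t <= pi -> is_derive t 1 G 0.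
    move=> tt; rewrite /G; dereq.
      der1; notypeclasses refine (@der_comp _ H (fun t => pi + _ t) _ _ _ _ _).
      - by apply: dH; lra.
      - by der.
      - by apply: dH; lra.
      - by der.
    rewrite -(hN (pi - t)) -(hp (- (pi - t))).
    have -> : - (pi - t) + 2 * pi = pi + t by ring.
    by ring.
  have := derive0_cst (ltW p0) dG; rewrite /G oppr0 addr0 subrr => ->.
  by congr (H _ + _); ring.
apply: (@ge0_FTC_oo R (fun t => h (t - t0)) (fun t => H (t - t0))).
- by rewrite sub0r T1; lra.
- by rewrite mulr_gt0.
- move=> t tt; dereq; first by dcomp H; [apply: dH; lra|der].
  by ring.
- by move=> t _; exact: chs.
- by [].
- apply: derivable_within_continuous => t; rewrite in_itv/= => tt.
  have D : is_derive t 1 (fun t => H (t - t0)) ((1 + 0) * h (t - t0)).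
    by dcomp H; [apply: dH; lra|der].
  exact: ex_derive.
Qed.

(** The modulus k for which the squared distance between points of the two
    circles is (1 - x) (1 + y) (1 + k^2 - 2 k cos t). *)
Lemma gauss_param (x y : R) : -1 < x -> x < y -> y < 1 ->
  exists k : R, [/\ 0 < k, k < 1,
    y = ((1 + x) - k ^+ 2 * (1 - x)) / ((1 + x) + k ^+ 2 * (1 - x)) &
    Num.sqrt (1 - x ^+ 2) * Num.sqrt (1 - y ^+ 2) = k * ((1 - x) * (1 + y))].
Proof.
move=> x1 xy y1.
pose k2 := ((1 + x) * (1 - y)) / ((1 - x) * (1 + y)).
have k20 : 0 < k2 by rewrite divr_gt0// mulr_gt0; lra.
have k21 : k2 < 1 by rewrite /k2 ltr_pdivrMr ?mulr_gt0 ?mul1r; nra.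
pose k := Num.sqrt k2; have k0 : 0 < k by rewrite sqrtr_gt0.
have kk : k ^+ 2 = k2 by rewrite sqr_sqrtr// ltW.
have k1 : k < 1 by rewrite -(@ltr_pXn2r _ 2) ?nnegrE ?ltW// kk expr1n.
have d0 : 0 < (1 + x) + k ^+ 2 * (1 - x).
  by rewrite addr_gt0 ?mulr_gt0 ?exprn_gt0//; lra.
have yE : y = ((1 + x) - k ^+ 2 * (1 - x)) / ((1 + x) + k ^+ 2 * (1 - x)).
  have h1 : 1 - x != 0 by lra.
  have h2 : 1 + y != 0 by lra.
  apply: (@mulIf _ ((1 + x) + k ^+ 2 * (1 - x))); first by lra.
  rewrite mulfVK ?gt_eqF// kk /k2; field; lra.
have sE : Num.sqrt (1 - x ^+ 2) * Num.sqrt (1 - y ^+ 2) = k * ((1 - x) * (1 + y)).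
  rewrite -sqrtrM; last by nra.
  rewrite -[RHS]ger0_norm; last by rewrite !mulr_ge0 ?ltW//; lra.
  rewrite -sqrtr_sqr; congr Num.sqrt.
  rewrite exprMn kk /k2; field; lra.
by exists k.
Qed.

Lemma asn_bound (v : R) : - pi < asn v < pi.
Proof.
rewrite /asn; set t := _ / _.
by have := atan_gtNpi2 t; have := atan_ltpi2 t; lra.
Qed.

Section Substitution.
Variables (x k : R).
Hypotheses (x1 : -1 < x < 1) (k01 : 0 < k < 1).

(** Gauss's form of Landen's transformation: gauss_s is sin^2 u, and gauss_cos
    is cos t for cos (t / 2) = (1 + k) sin u / (1 + k sin^2 u). *)
Definition gauss_s z := (1 + z) * (1 - x) / ((1 - z) * (1 + x)).
Definition gauss_cos z := -1 + 2 * (1 + k) ^+ 2 * gauss_s z / (1 + k * gauss_s z) ^+ 2.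
Definition gauss_cos_der z :=
  2 * (1 + k) ^+ 2 * (1 - k * gauss_s z) / (1 + k * gauss_s z) ^+ 3
   * (2 * (1 - x) / ((1 + x) * (1 - z) ^+ 2)).

Lemma gauss_s_itv z : -1 < z < x -> 0 < gauss_s z < 1.
Proof.
have [h1 h2] := andP x1; move=> /andP[z1 z2].
have d0 : 0 < (1 - z) * (1 + x) by apply: mulr_gt0; lra.
have n0 : 0 < (1 + z) * (1 - x) by apply: mulr_gt0; lra.
by rewrite /gauss_s divr_gt0//= ltr_pdivrMr// mul1r; nra.
Qed.

Lemma gauss_ks z : -1 < z < x -> 0 < k * gauss_s z < 1.
Proof.
have [k0 k1] := andP k01; move=> /gauss_s_itv/andP[s0 s1].
by rewrite mulr_gt0//= (lt_trans _ k1)// gtr_pMr.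
Qed.

Lemma gauss_cos_itv z : -1 < z < x -> -1 < gauss_cos z < 1.
Proof.
move=> zx; have /andP[s0 s1] := gauss_s_itv zx; have /andP[ks0 ks1] := gauss_ks zx.
have [k0 k1] := andP k01; rewrite /gauss_cos; move: (gauss_s z) s0 s1 ks0 ks1 => s s0 s1 ks0 ks1.
have u0 : 0 < 1 + k * s by lra.
have h1 : 0 < 2 * (1 + k) ^+ 2 * s / (1 + k * s) ^+ 2.
  have v0 : 0 < 1 + k by lra.
  exact: divr_gt0 (mulr_gt0 (mulr_gt0 _ (exprn_gt0 2 v0)) s0) (exprn_gt0 2 u0).
have h2 : 1 - (-1 + 2 * (1 + k) ^+ 2 * s / (1 + k * s) ^+ 2) =
    2 * ((1 - s) * (1 - k * (k * s))) / (1 + k * s) ^+ 2 by field; exact: lt0r_neq0.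
have h3 : 0 < 1 - (-1 + 2 * (1 + k) ^+ 2 * s / (1 + k * s) ^+ 2).
  have w1 : 0 < 1 - s by lra.
  have w2 : 0 < 1 - k * (k * s) by nra.
  rewrite h2; exact: divr_gt0 (mulr_gt0 _ (mulr_gt0 w1 w2)) (exprn_gt0 2 u0).
by lra.
Qed.

Lemma is_derive_gauss_cos z : -1 < z < x -> is_derive z 1 gauss_cos (gauss_cos_der z).
Proof.
have [h1 h2] := andP x1.
move=> zx; have /andP[ks0 ks1] := gauss_ks zx; case/andP: zx => z1 z2.
have e1 : 1 - z != 0 by lra.
have e2 : 1 + x != 0 by lra.
have e3 : 1 + k * gauss_s z != 0 by lra.
have ds : is_derive z 1 gauss_s (2 * (1 - x) / ((1 + x) * (1 - z) ^+ 2)).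
  rewrite /gauss_s; dereq; first by der; exact: mulf_neq0.
  by rewrite /=; field; rewrite e1 e2.
rewrite /gauss_cos_der /gauss_cos; dereq.
  by der; [exact: ds|exact: expf_neq0|exact: ds].
by rewrite /=; move: (gauss_s z) e3 => s e3; field; rewrite e1 e2 e3.
Qed.

Lemma gauss_cos_der_gt0 z : -1 < z < x -> 0 < gauss_cos_der z.
Proof.
have [h1 h2] := andP x1; have [k0 k1] := andP k01.
move=> zx; have /andP[ks0 ks1] := gauss_ks zx; case/andP: zx => z1 z2.
have u0 : 0 < 1 + k by lra.
have u1 : 0 < 1 - k * gauss_s z by lra.
have u2 : 0 < 1 + k * gauss_s z by lra.
have u3 : 0 < 1 - x by lra.
have u4 : 0 < 1 + x by lra.
have u5 : 0 < 1 - z by lra.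
rewrite /gauss_cos_der; apply: mulr_gt0; apply: divr_gt0.
- exact: mulr_gt0 (mulr_gt0 _ (exprn_gt0 2 u0)) u1.
- exact: exprn_gt0.
- exact: mulr_gt0.
- exact: mulr_gt0 u4 (exprn_gt0 2 u5).
Qed.

Lemma cont_gauss_cos z : -1 <= z <= x -> {for z, continuous gauss_cos}.
Proof.
have [h1 h2] := andP x1; have [k0 k1] := andP k01; move=> /andP[z1 z2].
have n1 : 0 < (1 - z) * (1 + x) by apply: mulr_gt0; lra.
have s0 : 0 <= gauss_s z.
  by apply: divr_ge0 (ltW n1); apply: mulr_ge0; lra.
have n2 : (1 + k * gauss_s z) ^+ 2 != 0.
  have ks := mulr_ge0 (ltW k0) s0.
  by apply: expf_neq0; apply: lt0r_neq0; lra.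
have n1' := lt0r_neq0 n1.
have cs : {for z, continuous gauss_s} by rewrite /gauss_s; cont; exact: n1'.
by rewrite /gauss_cos; cont; first [exact: cs|exact: n2].
Qed.

Lemma gauss_cosN1 : gauss_cos (-1) = -1.
Proof. by rewrite /gauss_cos /gauss_s subrr !mul0r !mulr0 mul0r addr0. Qed.

Lemma gauss_cos_x : gauss_cos x = 1.
Proof.
have [h1 h2] := andP x1; have [k0 k1] := andP k01.
rewrite /gauss_cos; have -> : gauss_s x = 1.
  rewrite /gauss_s [X in X / _]mulrC divff// mulf_neq0//; lra.
by field; lra.
Qed.

Variable y : R.
Hypothesis yE : y = ((1 + x) - k ^+ 2 * (1 - x)) / ((1 + x) + k ^+ 2 * (1 - x)).

Let d0 : 0 < (1 + x) + k ^+ 2 * (1 - x).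
Proof.
have [h1 h2] := andP x1; have [k0 k1] := andP k01.
have u1 : 0 < 1 + x by lra.
have u2 : 0 < 1 - x by lra.
exact: addr_gt0 u1 (mulr_gt0 (exprn_gt0 2 k0) u2).
Qed.

Lemma gauss_dist q : 2 - 2 * (x * y + k * ((1 - x) * (1 + y)) * q) =
  (1 - x) * (1 + y) * (1 + k ^+ 2 - 2 * k * q).
Proof. by have n0 := lt0r_neq0 d0; rewrite yE; field. Qed.

(** The substitution carries one elliptic differential into the other: this is
    the square of the equality of dt / distance and dz / sqrt (...). *)
Lemma gauss_elliptic z : -1 < z < x ->
  (1 - z ^+ 2) * (x - z) * (y - z) * gauss_cos_der z ^+ 2 =
  (1 - gauss_cos z ^+ 2) * (2 - 2 * (x * y + k * ((1 - x) * (1 + y)) * gauss_cos z)).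
Proof.
have [h1 h2] := andP x1; have [k0 k1] := andP k01; move=> /andP[z1 z2].
have n0 := lt0r_neq0 d0.
have e1 : 1 - z != 0 by lra.
have e2 : 1 + x != 0 by lra.
rewrite yE /gauss_cos_der /gauss_cos /gauss_s; field.
have u0 : 0 < (1 - z) * (1 + x) by apply: mulr_gt0; lra.
have v0 : 0 < k * ((1 + z) * (1 - x)) by apply: mulr_gt0 => //; apply: mulr_gt0; lra.
by rewrite n0 e1 e2 (lt0r_neq0 (addr_gt0 u0 v0)).
Qed.

End Substitution.

(** H is an antiderivative of the inverse distance as a function of the
    azimuth t, so that the right-hand side is its integral over [0, pi]. *)
Lemma landen (x y : R) (H : R -> R) : -1 < x -> x < y -> y < 1 ->
  (forall t, - (3 * pi) < t < 3 * pi ->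
    is_derive t 1 H
      (rsq (2 - 2 * (x * y + Num.sqrt (1 - x ^+ 2) * Num.sqrt (1 - y ^+ 2) * cos t)))) ->
  (\int[mu]_(z in `](-1)%R, 1%R[) (rsq (1 - z ^+ 2) * rsq (x - z) * rsq (y - z))%:E
   = (H pi - H 0)%:E)%E.
Proof.
move=> x1 xy y1 dH; have p0 := @pi_gt0 R.
rewrite (@eq_integral_supp _ `](-1)%R, x[%classic); first last.
- move=> z /=; rewrite !in_itv/= => /andP[z1 z2] /negP; rewrite z1/= -leNgt => xz.
  by rewrite (@rsq_le0 _ (x - z)) ?mulr0 ?mul0r// subr_le0.
- by move=> z /=; rewrite !in_itv/=; lra.
have [k [k0 k1 yE sE]] := gauss_param x1 xy y1.
have xI : -1 < x < 1 by lra.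
have kI : 0 < k < 1 by rewrite k0.
pose F z := - H (pi / 2 - asn (gauss_cos x k z)).
(* gauss_cos is cos t; t decreases from pi to 0 as z increases, whence the sign in F *)
apply: (@ge0_FTC_oo R (fun z => rsq (1 - z ^+ 2) * rsq (x - z) * rsq (y - z)) F).
- rewrite /F (gauss_cosN1 x) (gauss_cos_x xI kI) asnN asn1 subrr.
  have -> : pi / 2 - - (pi / 2) = pi :> R by field.
  by rewrite opprK addrC.
- by [].
- move=> z zx; have qz := gauss_cos_itv xI kI zx.
  have dz := is_derive_gauss_cos xI kI zx.
  have q'0 := gauss_cos_der_gt0 xI kI zx.
  have ell := gauss_elliptic xI kI yE zx.
  have dist := gauss_dist xI kI yE (gauss_cos x k z).
  have asb := asn_bound (gauss_cos x k z).
  have tI : - (3 * pi) < pi / 2 - asn (gauss_cos x k z) < 3 * pi by clear -p0 asb; lra.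
  have dHz := dH _ tI; rewrite /F; dereq.
    by der1; dcomp H; [exact: dHz|dera; [exact: qz|exact: dz]].
  have -> : cos (pi / 2 - asn (gauss_cos x k z)) = gauss_cos x k z.
    rewrite cosB cos_pihalf sin_pihalf sin_asn; first by rewrite mul0r add0r mul1r.
    by case/andP: qz => /ltW -> /ltW.
  rewrite sE; move: ell dist qz q'0; move: (gauss_cos x k z) (gauss_cos_der x k z) => q q'.
  move=> ell dist qz q'0; case/andP: zx => z1 z2.
  have W0 : 0 <= 1 - z ^+ 2 by clear -x1 z1 z2 xI; nra.
  have X0 : 0 <= x - z by rewrite subr_ge0 ltW.
  rewrite -[RHS]mulrA -[X in _ = _ * X](rsqM _ _ X0) -(rsqM _ _ W0).
  have -> : forall u v : R, - ((0 + - (q' * v)) * u) = (u * v) * q' by move=> u v; ring.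
  rewrite -rsqM; last first.
    rewrite dist; apply: mulr_ge0; first by apply: mulr_ge0; clear -x1 xy y1; lra.
    by clear -qz k0 k1; nra.
  rewrite -[RHS](@mulfVK _ q') ?gt_eqF//; congr (_ * _).
  by apply: rsq_scale => //; rewrite [RHS]mulrC -ell; ring.
- by move=> z /andP[z1 z2]; clear -x1 xy y1 z1 z2; cont; nra.
- by move=> z _; rewrite !mulr_ge0 ?rsq_ge0.
- apply: continuous_in_subspaceT => z; rewrite inE/= in_itv/= => zI.
  change {for z, continuous F}; rewrite /F; apply: contN; apply: cont_comp.
    have bd := asn_bound (gauss_cos x k z).
    have /dH D : - (3 * pi) < pi / 2 - asn (gauss_cos x k z) < 3 * pi by clear -p0 bd; lra.
    by apply: differentiable_continuous; apply/derivable1_diffP; exact: ex_derive.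
  by conta; exact: cont_gauss_cos.
Qed.

Lemma dist_sqr_gt0 (x y t : R) : -1 < x < 1 -> -1 < y < 1 -> x != y ->
  0 < 2 - 2 * (x * y + Num.sqrt (1 - x ^+ 2) * Num.sqrt (1 - y ^+ 2) * cos t).
Proof.
move=> /andP[x1 x2] /andP[y1 y2] xy.
have c1 := cos_le1 t; have s0 : 0 <= Num.sqrt (1 - x ^+ 2) * Num.sqrt (1 - y ^+ 2).
  by rewrite mulr_ge0 ?sqrtr_ge0.
have : Num.sqrt (1 - x ^+ 2) * Num.sqrt (1 - y ^+ 2) < 1 - x * y.
  rewrite -sqrtrM; last by nra.
  rewrite -[ltRHS]ger0_norm; last by nra.
  rewrite -sqrtr_sqr ltr_sqrt; last by rewrite exprn_gt0//; nra.
  have : 0 < (x - y) ^+ 2 by rewrite exprn_even_gt0// subr_eq0.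
  by nra.
by nra.
Qed.

(** The left-hand side is the potential, at a point of height x, of the unit
    circle of latitude at height y; on the right x and y are separated. *)
Lemma circle_integral (x y t0 : R) : -1 < x < 1 -> -1 < y < 1 -> x != y ->
  0 <= t0 <= 2 * pi ->
  (\int[mu]_(t in `[0%R, (2 * pi)%R])
     (rsq (2 - 2 * (x * y + Num.sqrt (1 - x ^+ 2) * Num.sqrt (1 - y ^+ 2) * cos (t - t0))))%:E
   = 2%:E * \int[mu]_(z in `](-1)%R, 1%R[) (rsq (1 - z ^+ 2) * rsq (x - z) * rsq (y - z))%:E)%E.
Proof.
move=> x1 y1 xy t01.
wlog : x y x1 y1 xy / x < y.
  move=> W; have [xy'|yx|xy'] := ltgtP x y; first exact: W.
    have := W y x y1 x1; rewrite eq_sym => /(_ xy yx).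
    rewrite (mulrC y x) (mulrC (Num.sqrt (1 - y ^+ 2))) => ->.
    by congr (_ * _)%E; apply: eq_integral => z _; rewrite -!mulrA [rsq (y - z) * _]mulrC.
  by rewrite xy' eqxx in xy.
move=> {}xy; case/andP: x1 => x1 x2; case/andP: y1 => y1 y2.
pose h t := rsq (2 - 2 * (x * y + Num.sqrt (1 - x ^+ 2) * Num.sqrt (1 - y ^+ 2) * cos t)).
have pos t := @dist_sqr_gt0 x y t ltac:(by rewrite x1) ltac:(by rewrite y1) ltac:(by rewrite lt_eqF).
have ch : continuous h.
  by move=> t; rewrite /h; cont; exact: pos.
have p0 := @pi_gt0 R.
have [H dH] := @primitive_on h (3 * pi) ch ltac:(by rewrite mulr_gt0).
rewrite (@landen x y H)// (@integral_period h H)//.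
- by move=> t; exact: rsq_ge0.
- by move=> t; rewrite /h cosN.
- move=> t; rewrite /h; have -> : 2 * pi = pi *+ 2 :> R by rewrite mulr2n; ring.
  by rewrite cosD2pi.
Qed.

End Landen.

(** * The binomial series of the inverse square root *)

Section BinomialSeries.
Context {R : realType}.
Implicit Types t : R.

(** The binomial coefficients of (1 - t)^(-1/2), that is 'C(2 n, n) / 4^n. *)
Fixpoint rsq_coef (n : nat) : R :=
  if n is m.+1 then rsq_coef m * ((2 * m%:R + 1) / (2 * m%:R + 2)) else 1.

Fixpoint rsq_sum (N : nat) t : R := if N is n.+1 then rsq_sum n t + rsq_coef n * t ^+ n else 0.

Fixpoint rsq_sum_der (N : nat) t : R :=
  if N is n.+1 then rsq_sum_der n t + rsq_coef n * (n%:R * t ^+ n.-1) else 0.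

Lemma rsq_coefS n : rsq_coef n.+1 * (2 * n%:R + 2) = rsq_coef n * (2 * n%:R + 1).
Proof. by rewrite /=; have n0 : 0 <= n%:R :> R by []; field; lra. Qed.

Lemma rsq_coef_gt0 n : 0 < rsq_coef n.
Proof.
elim: n => //= n IH; have n0 : 0 <= n%:R :> R by [].
by rewrite mulr_gt0// divr_gt0//; lra.
Qed.

Lemma rsq_coefS_le n : rsq_coef n.+1 <= rsq_coef n.
Proof.
have := rsq_coefS n; have := rsq_coef_gt0 n; have := rsq_coef_gt0 n.+1.
have n0 : 0 <= n%:R :> R by []; nra.
Qed.

Lemma rsq_coef_le1 n : rsq_coef n <= 1.
Proof. by elim: n => //= n IH; exact: le_trans (rsq_coefS_le n) IH. Qed.

(** This and [rsq_coef_sqr_ge] are Wallis's bounds: the coefficients decrease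
    like n^(-1/2), enough for convergence at t = -1 and for divergence at t = 1. *)
Lemma rsq_coef_sqr_le n : rsq_coef n ^+ 2 * (2 * n%:R + 1) <= 1.
Proof.
elim: n => [|n IH]; first by rewrite /= expr1n mulr0 add0r mulr1.
have n0 : 0 <= n%:R :> R by [].
apply: le_trans IH; rewrite -(@ler_pM2r _ ((2 * n%:R + 2) ^+ 2)); last by rewrite exprn_gt0//; lra.
have -> : rsq_coef n.+1 ^+ 2 * (2 * n.+1%:R + 1) * (2 * n%:R + 2) ^+ 2 =
  rsq_coef n ^+ 2 * ((2 * n%:R + 1) ^+ 2 * (2 * n%:R + 3)).
  rewrite -natr1 -mulrA -[in RHS]mulrA; have := rsq_coefS n.
  by move=> /(congr1 (fun x => x ^+ 2 * (2 * n%:R + 3))) /= e; nra.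
rewrite -[leRHS]mulrA ler_pM2l ?exprn_gt0 ?rsq_coef_gt0//; nra.
Qed.

Lemma rsq_coef_sqr_ge n : 1 <= rsq_coef n.+1 ^+ 2 * (4 * n.+1%:R).
Proof.
elim: n => [|n IH]; first by rewrite /= [leRHS](_ : _ = 1)//; field.
have n0 : 0 <= n%:R :> R by [].
apply: (le_trans IH); rewrite -(@ler_pM2r _ ((2 * n.+1%:R + 2) ^+ 2)); last first.
  by rewrite exprn_gt0// addr_gt0// mulr_gt0.
have -> : rsq_coef n.+2 ^+ 2 * (4 * n.+2%:R) * (2 * n.+1%:R + 2) ^+ 2 =
  rsq_coef n.+1 ^+ 2 * ((2 * n.+1%:R + 1) ^+ 2 * (4 * n.+2%:R)).
  have := rsq_coefS n.+1; set u := rsq_coef n.+2; set v := rsq_coef n.+1 => e.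
  transitivity ((u * (2 * n.+1%:R + 2)) ^+ 2 * (4 * n.+2%:R)); first by ring.
  by rewrite e; ring.
rewrite -mulrA ler_pM2l ?exprn_gt0 ?rsq_coef_gt0// -!natr1; nra.
Qed.

(** The differential equation 2 (1 - t) y' = y of the full series, up to the
    single term that truncation leaves. *)
Lemma rsq_sum_deriv_eq N t :
  2 * (1 - t) * rsq_sum_der N t - rsq_sum N t = - (2 * N%:R * rsq_coef N * t ^+ N.-1).
Proof.
elim: N => [|N IH]; first by rewrite /=; ring.
rewrite [rsq_sum_der _ _]/= [rsq_sum _ _]/= [N.+1.-1]/=.
have -> : 2 * N.+1%:R * rsq_coef N.+1 = rsq_coef N * (2 * N%:R + 1).
  by rewrite -rsq_coefS -natr1; ring.
transitivity (2 * (1 - t) * rsq_sum_der N t - rsq_sum N t + 2 * (1 - t) * (rsq_coef N * (N%:R * t ^+ N.-1))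
  - rsq_coef N * t ^+ N); first by ring.
rewrite IH; case: N {IH} => [|N]; first by rewrite !expr0; ring.
by rewrite /= exprS; ring.
Qed.

Lemma is_derive_rsq_sum N t : is_derive t 1 (rsq_sum N) (rsq_sum_der N t).
Proof.
elim: N => [|N IH]; first exact: derC.
have -> : rsq_sum N.+1 = (fun t => rsq_sum N t + rsq_coef N * t ^+ N) by [].
by dereq; [der; exact: IH|rewrite /=; ring].
Qed.

Lemma rsq_sum_at1 N : rsq_sum N 1 = 2 * N%:R * rsq_coef N.
Proof. by have := rsq_sum_deriv_eq N 1; rewrite subrr mulr0 mul0r expr1n mulr1 sub0r; lra. Qed.

(** Partial sum over limit: its derivative is one explicit term, which gives
    sign and size of the truncation error for every t < 1 at once. *)
Definition rsq_ratio N t := rsq_sum N t * Num.sqrt (1 - t).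

Lemma rsq_ratio_der N t : t < 1 ->
  is_derive t 1 (rsq_ratio N) (- (N%:R * rsq_coef N * t ^+ N.-1 * rsq (1 - t))).
Proof.
move=> t1; rewrite /rsq_ratio; dereq; first by der; [exact: is_derive_rsq_sum|lra].
have s0 : 0 < Num.sqrt (1 - t) by rewrite sqrtr_gt0; lra.
have ss : Num.sqrt (1 - t) ^+ 2 = 1 - t by rewrite sqr_sqrtr//; lra.
rewrite /rsq; have := rsq_sum_deriv_eq N t; set s := Num.sqrt _ in s0 ss *.
rewrite -ss => e; apply: (@mulIf _ (2 * s)); first by rewrite mulf_neq0// gt_eqF.
transitivity (2 * s ^+ 2 * rsq_sum_der N t - rsq_sum N t); first by field; lra.
by rewrite e; field; lra.
Qed.

Lemma rsq_ratio_mvt N t : (0 < N)%N -> t < 1 ->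
  exists u, [/\ 0 <= u * t, `|u| <= `|t|, u < 1 &
    rsq_ratio N t = 1 - N%:R * rsq_coef N * u ^+ N.-1 * rsq (1 - u) * t].
Proof.
move=> N0 t1.
have g0 : rsq_ratio N 0 = 1.
  rewrite /rsq_ratio subr0 sqrtr1 mulr1; case: N N0 => // N _; elim: N => [|N /= IH].
    by rewrite /= add0r mulr1.
  by rewrite /= IH expr0n/= mulr0 addr0.
have cg (a b : R) : b < 1 -> {within `[a, b], continuous (rsq_ratio N)}.
  move=> b1; apply: derivable_within_continuous => x; rewrite in_itv/= => /andP[_ xb].
  by have D := rsq_ratio_der N (le_lt_trans xb b1); exact: ex_derive.
have [t0|t0|->] := ltgtP t 0; last first.
- by exists 0; rewrite mulr0 g0 mulr0 subr0; split.
- have dg x : x \in `]0, t[%R -> is_derive x 1 (rsq_ratio N) (- (N%:R * rsq_coef N * x ^+ N.-1 * rsq (1 - x))).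
    by rewrite in_itv/= => /andP[_ xt]; apply: rsq_ratio_der; lra.
  have [u] := @MVT R _ _ 0 t t0 dg (cg 0 t t1).
  rewrite in_itv/= => /andP[u0 ut] e; exists u; split; rewrite ?mulr_ge0//; try lra.
  by rewrite !ger0_norm; lra.
- have dg x : x \in `]t, 0[%R -> is_derive x 1 (rsq_ratio N) (- (N%:R * rsq_coef N * x ^+ N.-1 * rsq (1 - x))).
    by rewrite in_itv/= => /andP[_ xt]; apply: rsq_ratio_der; lra.
  have [u] := @MVT R _ _ t 0 t0 dg (cg t 0 ltr01).
  rewrite in_itv/= => /andP[u0 ut] e; exists u; split.
  + by nra.
  + by rewrite !ler0_norm; lra.
  + by lra.
  + by lra.
Qed.

(** Even truncations only: the added pairs of terms c t^(2m) + c' t^(2m+1), with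
    c' <= c, are nonnegative on [-1, 1], so that the sequence is monotone for
    negative t as well. *)
Definition rsq_even M t := rsq_sum M.*2 t.

Lemma rsq_mul_sqrt t : t < 1 -> rsq (1 - t) * Num.sqrt (1 - t) = 1.
Proof. by move=> t1; rewrite /rsq mulVf// gt_eqF// sqrtr_gt0; lra. Qed.

Lemma rsq_even_nd M t : `|t| <= 1 -> rsq_even M t <= rsq_even M.+1 t.
Proof.
move=> t1; rewrite /rsq_even doubleS [leRHS]/= -addrA lerDl exprS.
have : 0 <= t ^+ M.*2 by rewrite exprn_even_ge0// odd_double.
have -> : rsq_coef M.*2 * t ^+ M.*2 + rsq_coef M.*2 * ((2 * M.*2%:R + 1) / (2 * M.*2%:R + 2)) * (t * t ^+ M.*2)
  = t ^+ M.*2 * (rsq_coef M.*2 + rsq_coef M.*2.+1 * t) by rewrite /=; ring.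
move=> u0; rewrite mulr_ge0//.
move: t1; rewrite ler_norml => /andP[t1 t2].
have := rsq_coefS_le M.*2; have := rsq_coef_gt0 M.*2.+1; nra.
Qed.

Lemma rsq_even_ge0 M t : `|t| <= 1 -> 0 <= rsq_even M t.
Proof.
by move=> t1; elim: M => [|M IH] //; apply: (le_trans IH); exact: rsq_even_nd.
Qed.

Lemma rsq_even_le M t : t < 1 -> rsq_even M t <= rsq (1 - t).
Proof.
move=> t1; case: M => [|M]; first exact: rsq_ge0.
have [u [ut _ u1 e]] := @rsq_ratio_mvt M.+1.*2 t isT t1.
have s0 : 0 < Num.sqrt (1 - t) by rewrite sqrtr_gt0; lra.
rewrite -(ler_pM2r s0) rsq_mul_sqrt// -/(rsq_ratio _ _) e gerBl doubleS/= exprS.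
have : 0 <= u ^+ M.*2 by rewrite exprn_even_ge0// odd_double.
move: (u ^+ M.*2) => v v0.
have -> : M.*2.+2%:R * (rsq_coef M.*2 * ((2 * M.*2%:R + 1) / (2 * M.*2%:R + 2)) *
  ((2 * M.*2.+1%:R + 1) / (2 * M.*2.+1%:R + 2))) * (u * v) * rsq (1 - u) * t =
  M.*2.+2%:R * rsq_coef M.*2.+2 * v * rsq (1 - u) * (u * t) by rewrite /=; ring.
by rewrite mulr_ge0// !mulr_ge0 ?rsq_ge0 ?(ltW (rsq_coef_gt0 _)).
Qed.

Lemma rsq_even_ge_neg M t : -1 <= t <= 0 -> rsq (1 - t) - rsq_coef M.*2 <= rsq_even M t.
Proof.
move=> /andP[t1 t0].
have [u [ut _ u1 e]] := @rsq_ratio_mvt M.*2.+1 t isT ltac:(lra).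
have s0 : 0 < Num.sqrt (1 - t) by rewrite sqrtr_gt0; lra.
have h : rsq (1 - t) <= rsq_sum M.*2.+1 t.
  rewrite -(ler_pM2r s0) rsq_mul_sqrt; last by lra.
  rewrite -/(rsq_ratio _ _) e lerBrDl gerDr /=.
  have : 0 <= u ^+ M.*2 by rewrite exprn_even_ge0// odd_double.
  by move=> v0; rewrite mulr_ge0_le0// !mulr_ge0 ?rsq_ge0 ?(ltW (rsq_coef_gt0 _)).
move: h => /=; rewrite -/(rsq_even M t).
have h2 : `|t ^+ M.*2| <= 1.
  by rewrite normrX exprn_ile1// ler_norml; lra.
move: h2; rewrite ler_norml => /andP[_ h2].
have := rsq_coef_gt0 M.*2; nra.
Qed.

Lemma bernoulli_ge (h : R) m : 0 <= h -> 1 + m%:R * h <= (1 + h) ^+ m.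
Proof.
move=> h0; elim: m => [|m IH]; first by rewrite mul0r addr0 expr0.
rewrite exprS -natr1; have m0 : 0 <= m%:R :> R by [].
have : (1 + h) * (1 + m%:R * h) <= (1 + h) * (1 + h) ^+ m by rewrite ler_pM2l//; lra.
have : 0 <= m%:R * h * h by rewrite !mulr_ge0.
nra.
Qed.

(** Bernoulli's inequality bounds t^M by the order of 1 / M; as the error
    carries t^(2 M), the defect is O(1 / M). *)
Lemma rsq_even_ge_pos M t : 0 < t < 1 ->
  rsq (1 - t) - 4 * rsq (1 - t) * rsq (1 - t) * (t / (1 - t)) ^+ 2 / M.+1%:R <= rsq_even M.+2 t.
Proof.
move=> /andP[t0 t1].
have [u [ut un u1 e]] := @rsq_ratio_mvt M.+2.*2 t isT t1.
have s0 : 0 < Num.sqrt (1 - t) by rewrite sqrtr_gt0; lra.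
have u0 : 0 <= u by rewrite pmulr_lge0 in ut.
have utl : u <= t by move: un; rewrite !ger0_norm// ltW.
have r0 : 0 < rsq (1 - t) by apply: rsq_gt0; lra.
pose h := (1 - t) / t; have h0 : 0 < h by rewrite divr_gt0//; lra.
have tE : t * (1 + h) = 1 by rewrite /h; field; lra.
have B : t ^+ M.+1 * (M.+1%:R * h) <= 1.
  have := bernoulli_ge M.+1 (ltW h0) => b.
  have p : t ^+ M.+1 * (1 + h) ^+ M.+1 = 1 by rewrite -exprMn tE expr1n.
  by rewrite -[leRHS]p ler_pM2l ?exprn_gt0//; lra.
have Mp : 0 < M.+1%:R :> R by [].
have B2 : (t ^+ M.+1) ^+ 2 * (M.+1%:R * h) ^+ 2 <= 1.
  have p0 : 0 <= t ^+ M.+1 * (M.+1%:R * h).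
    exact: mulr_ge0 (exprn_ge0 _ (ltW t0)) (mulr_ge0 (ltW Mp) (ltW h0)).
  by rewrite -exprMn exprn_ile1.
have uN : u ^+ M.+2.*2.-1 <= (t ^+ M.+1) ^+ 2.
  rewrite doubleS /= exprS -exprM muln2.
  apply: (@le_trans _ _ (u ^+ M.+1.*2)).
    by apply: ler_piMl; [rewrite exprn_ge0|exact: ltW].
  by rewrite lerXn2r ?nnegrE//; lra.
have ru : rsq (1 - u) <= rsq (1 - t) by apply: rsq_anti; lra.
rewrite -(ler_pM2r s0) mulrBl rsq_mul_sqrt// -/(rsq_ratio _ _) e lerD2l lerN2.
apply: (@le_trans _ _ (M.+2.*2%:R * 1 * (t ^+ M.+1) ^+ 2 * rsq (1 - t) * 1)).
  have c0 := ltW (rsq_coef_gt0 M.+2.*2); have c1 := rsq_coef_le1 M.+2.*2.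
  have uN0 : 0 <= u ^+ M.+2.*2.-1 by rewrite exprn_ge0.
  have ru0 := rsq_ge0 (1 - u).
  have t0' := ltW t0; have t1' := ltW t1.
  have N0 : 0 <= M.+2.*2%:R :> R by [].
  apply: ler_pM => //; first exact: mulr_ge0 (mulr_ge0 (mulr_ge0 N0 c0) uN0) ru0.
  apply: ler_pM => //; first exact: mulr_ge0 (mulr_ge0 N0 c0) uN0.
  apply: ler_pM => //; first exact: mulr_ge0 N0 c0.
  by apply: ler_pM.
rewrite !mulr1.
have -> : 4 * rsq (1 - t) * rsq (1 - t) * (t / (1 - t)) ^+ 2 / M.+1%:R * Num.sqrt (1 - t)
  = 4 * rsq (1 - t) / (M.+1%:R * h ^+ 2).
  transitivity (4 * rsq (1 - t) * (rsq (1 - t) * Num.sqrt (1 - t)) * (t / (1 - t)) ^+ 2 / M.+1%:R); first by ring.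
  by rewrite rsq_mul_sqrt// /h; field; lra.
rewrite ler_pdivlMr; last by rewrite mulr_gt0// exprn_gt0.
have M2 : M.+2.*2%:R <= 4 * M.+1%:R :> R.
  have M0 : 0 <= M%:R :> R by [].
  by rewrite -muln2 natrM -!natr1; lra.
have T0 : 0 <= (t ^+ M.+1) ^+ 2 by rewrite exprn_ge0// exprn_ge0// ltW.
apply: (@le_trans _ _ (4 * rsq (1 - t) * ((t ^+ M.+1) ^+ 2 * (M.+1%:R * h) ^+ 2))); last first.
  by rewrite ger_pMr// mulr_gt0.
have -> : M.+2.*2%:R * (t ^+ M.+1) ^+ 2 * rsq (1 - t) * (M.+1%:R * h ^+ 2) =
  M.+2.*2%:R * (M.+1%:R * ((t ^+ M.+1) ^+ 2 * rsq (1 - t) * h ^+ 2)) by ring.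
have -> : 4 * rsq (1 - t) * ((t ^+ M.+1) ^+ 2 * (M.+1%:R * h) ^+ 2) =
  4 * M.+1%:R * (M.+1%:R * ((t ^+ M.+1) ^+ 2 * rsq (1 - t) * h ^+ 2)) by ring.
have X0 : 0 <= M.+1%:R * ((t ^+ M.+1) ^+ 2 * rsq (1 - t) * h ^+ 2).
  exact: mulr_ge0 (ltW Mp) (mulr_ge0 (mulr_ge0 T0 (ltW r0)) (exprn_ge0 2 (ltW h0))).
exact: ler_wpM2r.
Qed.

Lemma rsq_even_cvg t : -1 <= t < 1 -> rsq_even M t @[M --> \oo] --> rsq (1 - t).
Proof.
move=> /andP[t1 t2]; have tn : `|t| <= 1 by rewrite ler_norml; lra.
have up M := rsq_even_le M t2.
have [t0|t0] := leP t 0.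
- have cc : rsq_coef M.*2 @[M --> \oo] --> (0 : R).
    apply/cvgrPdist_lt => e e0; near=> M.
    rewrite sub0r normrN gtr0_norm ?rsq_coef_gt0// ltNge; apply/negP => le.
    have M0 : 0 <= M%:R :> R by [].
    have : (e ^+ 2)^-1 < M%:R by near: M; exact: nbhs_infty_gtr.
    rewrite -[_^-1]div1r ltr_pdivrMr ?exprn_gt0//.
    have := rsq_coef_sqr_le M.*2; rewrite -muln2 natrM.
    have : e ^+ 2 <= rsq_coef (M * 2) ^+ 2.
      by rewrite muln2 lerXn2r ?nnegrE//; [exact: ltW|exact: ltW (rsq_coef_gt0 _)].
    have : 0 < e ^+ 2 by rewrite exprn_gt0.
    nra.
  apply: (@squeeze_cvgr _ _ _ _ (fun M => rsq (1 - t) - rsq_coef M.*2) (fun=> rsq (1 - t))).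
  + by near=> M; rewrite up andbT rsq_even_ge_neg// t1.
  + by rewrite -[X in _ --> X]subr0; apply: cvgB => //; exact: cvg_cst.
  + exact: cvg_cst.
- rewrite -(cvg_shiftn 2)/=; under eq_fun do rewrite addn2.
  set C := 4 * rsq (1 - t) * rsq (1 - t) * (t / (1 - t)) ^+ 2.
  apply: (@squeeze_cvgr _ _ _ _ (fun M => rsq (1 - t) - C / M.+1%:R) (fun=> rsq (1 - t))).
  + by near=> M; rewrite up andbT rsq_even_ge_pos// t0.
  + rewrite -[X in _ --> X]subr0; apply: cvgB => //; first exact: cvg_cst.
    rewrite -(mulr0 C); apply: cvgM; first exact: cvg_cst.
    exact: cvg_harmonic.
  + exact: cvg_cst.
Unshelve. all: by end_near.
Qed.

Lemma rsq_even_cvg1 : (rsq_even M 1)%:E @[M --> \oo] --> (+oo%E : \bar R).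
Proof.
apply/cvgeryP/cvgryPge => A; near=> M.
have M1 : (0 < M)%N by near: M; exists 1%N.
rewrite leNgt; apply/negP; rewrite /rsq_even rsq_sum_at1 => ltA.
have c0 := rsq_coef_gt0 M.*2.
have Mp : 0 < M%:R :> R by rewrite ltr0n.
have : A ^+ 2 < M%:R by near: M; exact: nbhs_infty_gtr.
have : 1 <= rsq_coef M.*2 ^+ 2 * (4 * M.*2%:R).
  by have := rsq_coef_sqr_ge (M.*2.-1); rewrite prednK// double_gt0.
have : (2 * M.*2%:R * rsq_coef M.*2) ^+ 2 < A ^+ 2.
  have h0 : 0 <= 2 * M.*2%:R * rsq_coef M.*2 by rewrite !mulr_ge0// ltW.
  by rewrite ltrXn2r// nnegrE ltW// (le_lt_trans h0).
rewrite -[M.*2]muln2 natrM; set c := rsq_coef _ in c0 *; set m : R := M%:R in Mp *.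
nra.
Unshelve. all: by end_near.
Qed.

End BinomialSeries.

(** * Positive definiteness of the Coulomb kernel on the sphere *)

Section PD.
Context {R : realType}.
Notation X := (R * R * R)%type.
Implicit Types (x y : X) (g : X -> R) (mu nu : probability X R).

Definition dot x y : R := x.1.1 * y.1.1 + x.1.2 * y.1.2 + x.2 * y.2.

Lemma measurable_c1 : measurable_fun setT (fun x : X => x.1.1).
Proof. by apply: measurableT_comp => //; exact: measurable_fst. Qed.
Lemma measurable_c2 : measurable_fun setT (fun x : X => x.1.2).
Proof. by apply: measurableT_comp => //; exact: measurable_fst. Qed.
Lemma measurable_c3 : measurable_fun setT (fun x : X => x.2).
Proof. exact: measurable_snd. Qed.

Lemma enormE x : enorm x = Num.sqrt (dot x x).
Proof. by rewrite /enorm /dot !expr2. Qed.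

Lemma measurable_enorm : measurable_fun setT (@enorm R).
Proof.
have m : measurable_fun setT (fun x : X => x.1.1 ^+ 2 + x.1.2 ^+ 2 + x.2 ^+ 2).
  apply: measurable_funD; first apply: measurable_funD; apply: measurable_funX.
  - exact: measurable_c1.
  - exact: measurable_c2.
  - exact: measurable_c3.
apply: (@measurableT_comp _ _ _ _ _ _ (@Num.sqrt R)) m.
by apply: continuous_measurable_fun; exact: sqrt_continuous.
Qed.

Lemma measurable_sphere : measurable (@sphere R).
Proof.
have -> : @sphere R = setT `&` (@enorm R) @^-1` [set 1] by rewrite setTI.
exact: measurable_enorm.
Qed.

Lemma sphereP x : sphere x <-> dot x x = 1.
Proof.
rewrite /sphere/= enormE; split => [e|->]; last by rewrite sqrtr1.
have d0 : 0 <= dot x x by rewrite /dot; nra.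
by rewrite -(sqr_sqrtr d0) e expr1n.
Qed.

Lemma dot_bound x y : sphere x -> sphere y -> `|dot x y| <= 1.
Proof.
move=> /sphereP; rewrite /dot => hx /sphereP; rewrite /dot => hy.
rewrite ler_norml; move: hx hy.
move: (x.1.1) (x.1.2) (x.2) (y.1.1) (y.1.2) (y.2) => a b c d e f hx hy.
have h1 : 0 <= (a - d) ^+ 2 + (b - e) ^+ 2 + (c - f) ^+ 2 by rewrite !addr_ge0 ?sqr_ge0.
have h2 : 0 <= (a + d) ^+ 2 + (b + e) ^+ 2 + (c + f) ^+ 2 by rewrite !addr_ge0 ?sqr_ge0.
apply/andP; split; nra.
Qed.

Lemma enorm_sub x y : sphere x -> sphere y -> enorm (x - y) = Num.sqrt (2 * (1 - dot x y)).
Proof.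
move=> /sphereP hx /sphereP hy; rewrite enormE; congr Num.sqrt.
transitivity (dot x x + dot y y - 2 * dot x y); last by rewrite hx hy; ring.
by rewrite /dot /=; ring.
Qed.

(** Truncations of 1 / |x - y| = (2 (1 - x.y))^(-1/2). *)
Definition kernel_trunc M x y : R := rsq 2 * rsq_even M (dot x y).

Lemma kernel_trunc_cvg x y : sphere x -> sphere y ->
  (kernel_trunc M x y)%:E @[M --> \oo] --> (((enorm (x - y))%:E)^-1)%E.
Proof.
move=> sx sy; rewrite enorm_sub// inver.
have := dot_bound sx sy; rewrite ler_norml => /andP[d1 d2].
have [d0|d0] := eqVneq (dot x y) 1.
  rewrite d0 subrr mulr0 sqrtr0 eqxx /kernel_trunc d0.
  have r0 : 0 < rsq (2 : R) by exact: rsq_gt0.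
  under eq_fun do rewrite EFinM.
  have r2 : (rsq (2 : R))%:E \is a fin_num by [].
  have := cvgeZl r2 (@rsq_even_cvg1 R).
  by rewrite gt0_muley ?lte_fin.
have dl : dot x y < 1 by rewrite lt_neqAle d0.
have p0 : 0 < 2 * (1 - dot x y) by rewrite mulr_gt0// subr_gt0.
rewrite gt_eqF ?sqrtr_gt0//.
apply: cvg_EFin; first exact: nearW.
rewrite -/(rsq _) rsqM//; apply: cvgM; first exact: cvg_cst.
by apply: rsq_even_cvg; rewrite d1.
Qed.

Lemma kernel_trunc_ge0 M x y : sphere x -> sphere y -> 0 <= kernel_trunc M x y.
Proof. by move=> sx sy; rewrite mulr_ge0 ?rsq_ge0// rsq_even_ge0// dot_bound. Qed.

Lemma kernel_trunc_nd x y : sphere x -> sphere y ->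
  {homo (fun M => (kernel_trunc M x y)%:E) : m n / (m <= n)%N >-> (m <= n)%E}.
Proof.
move=> sx sy; apply/nondecreasing_seqP => n; rewrite lee_fin ler_wpM2l ?rsq_ge0//.
by rewrite rsq_even_nd// dot_bound.
Qed.

(** A kernel of the form sum_g g(x) g(y), visibly positive semidefinite. *)
Definition sumsq (L : seq (X -> R)) x y : R := \sum_(g <- L) g x * g y.

(** All products of n coordinates, one for each word of length n in three
    letters: expanding (x.y)^n gives the sum of g(x) g(y) over these. *)
Fixpoint words n : seq (X -> R) :=
  if n is m.+1 then
    [seq (fun x => x.1.1 * g x) | g <- words m] ++
    [seq (fun x => x.1.2 * g x) | g <- words m] ++
    [seq (fun x => x.2 * g x) | g <- words m]
  else [:: fun=> 1].

Lemma sumsq_words n x y : sumsq (words n) x y = dot x y ^+ n.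
Proof.
rewrite /sumsq; elim: n => [|n IH]; first by rewrite /= big_seq1 mulr1 expr0.
rewrite /= !big_cat !big_map/= exprS -IH /dot !mulrDl !mulr_sumr -addrA.
by congr (_ + (_ + _)); apply: eq_bigr => g _; ring.
Qed.

Fixpoint kwords N : seq (X -> R) :=
  if N is n.+1 then kwords n ++
    [seq (fun x => Num.sqrt (rsq 2 * rsq_coef n) * g x) | g <- words n] else [::].

Lemma sumsq_kwords N x y : sumsq (kwords N) x y = rsq 2 * rsq_sum N (dot x y).
Proof.
elim: N => [|N IH]; first by rewrite /sumsq/= big_nil mulr0.
rewrite /sumsq /= big_cat/= -/(sumsq _ _ _) IH big_map mulrDr; congr (_ + _).
rewrite mulrA -sumsq_words /sumsq mulr_sumr; apply: eq_bigr => g _.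
have c0 : 0 <= rsq 2 * rsq_coef N :> R by rewrite mulr_ge0 ?rsq_ge0 ?(ltW (rsq_coef_gt0 _)).
by rewrite mulrACA -expr2 sqr_sqrtr.
Qed.

(** The class in which every function is integrable over the sphere. *)
Definition sphere_bounded g := measurable_fun setT g /\ exists B : R, forall x, sphere x -> `|g x| <= B.

Lemma coord_bound x : sphere x -> [/\ `|x.1.1| <= 1, `|x.1.2| <= 1 & `|x.2| <= 1].
Proof.
move=> /sphereP; rewrite /dot => h; split; rewrite ler_norml; nra.
Qed.

Lemma sphere_boundedM g1 g2 : sphere_bounded g1 -> sphere_bounded g2 -> sphere_bounded (fun x => g1 x * g2 x).
Proof.
move=> [m1 [B1 b1]] [m2 [B2 b2]]; split; first exact: measurable_funM.
exists (B1 * B2) => x sx; rewrite normrM; apply: ler_pM => //; [exact: b1|exact: b2].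
Qed.

Lemma sphere_bounded_cst (c : R) : sphere_bounded (fun=> c).
Proof. by split; [exact: measurable_cst|exists `|c|]. Qed.
Lemma sphere_bounded_c1 : sphere_bounded (fun x => x.1.1).
Proof. by split; [exact: measurable_c1|exists 1 => x /coord_bound[]]. Qed.
Lemma sphere_bounded_c2 : sphere_bounded (fun x => x.1.2).
Proof. by split; [exact: measurable_c2|exists 1 => x /coord_bound[]]. Qed.
Lemma sphere_bounded_c3 : sphere_bounded (fun x => x.2).
Proof. by split; [exact: measurable_c3|exists 1 => x /coord_bound[]]. Qed.

Lemma sphere_bounded_words n g : List.In g (words n) -> sphere_bounded g.
Proof.
elim: n g => [|n IH] g; first by move=> [<-|[]]; exact: sphere_bounded_cst.
rewrite /= !List.in_app_iff !List.in_map_iff.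
move=> [[h [<- /IH gh]]|[[h [<- /IH gh]]|[h [<- /IH gh]]]].
- exact: sphere_boundedM sphere_bounded_c1 gh.
- exact: sphere_boundedM sphere_bounded_c2 gh.
- exact: sphere_boundedM sphere_bounded_c3 gh.
Qed.

Lemma sphere_bounded_kwords n g : List.In g (kwords n) -> sphere_bounded g.
Proof.
elim: n g => [|n IH] g //=.
rewrite List.in_app_iff List.in_map_iff.
move=> [/IH//|[h [<- /sphere_bounded_words gh]]].
exact: sphere_boundedM (sphere_bounded_cst _) gh.
Qed.

Lemma mono_words i j k :
  List.In (fun x : X => x.1.1 ^+ i * (x.1.2 ^+ j * x.2 ^+ k)) (words (i + (j + k))).
Proof.
elim: i => [|i IH].
  rewrite add0n.
  have -> : (fun x : X => x.1.1 ^+ 0 * (x.1.2 ^+ j * x.2 ^+ k)) = (fun x : X => x.1.2 ^+ j * x.2 ^+ k).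
    by apply/funext => x; rewrite expr0 mul1r.
  elim: j => [|j IH].
    rewrite add0n.
    have -> : (fun x : X => x.1.2 ^+ 0 * x.2 ^+ k) = (fun x : X => x.2 ^+ k).
      by apply/funext => x; rewrite expr0 mul1r.
    elim: k => [|k IH]; first by left; apply/funext => x; rewrite expr0.
    rewrite /= !List.in_app_iff !List.in_map_iff; right; right.
    by exists (fun x : X => x.2 ^+ k); split => //; apply/funext => x; rewrite exprS.
  rewrite addSn /= !List.in_app_iff !List.in_map_iff; right; left.
  eexists; split; last exact: IH.
  by apply/funext => x; rewrite exprS mulrA.
rewrite addSn /= !List.in_app_iff !List.in_map_iff; left.
eexists; split; last exact: IH.
by apply/funext => x; rewrite exprS mulrA.
Qed.

Definition mom mu g : R := (\int[mu]_(x in sphere) g x)%R.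

Lemma sphere_bounded_integrable mu g : sphere_bounded g -> mu.-integrable sphere (EFin \o g).
Proof.
move=> [mg [B bB]]; apply: measurable_bounded_integrable.
- exact: measurable_sphere.
- by rewrite (le_lt_trans (probability_le1 _ _)) ?ltry//; exact: measurable_sphere.
- exact: measurable_funTS.
- exists B; split; first exact: num_real.
  by move=> M BM x sx /=; rewrite (le_trans (bB x sx))// ltW.
Qed.

Lemma momE mu g : sphere_bounded g -> (\int[mu]_(x in sphere) (g x)%:E = (mom mu g)%:E)%E.
Proof.
move=> gg; rewrite /mom /Rintegral fineK//.
by apply: integrable_fin_num; [exact: measurable_sphere|exact: sphere_bounded_integrable].
Qed.

Lemma sphere_bounded_sum (L : seq (X -> R)) (c : (X -> R) -> R) :
  (forall g, List.In g L -> sphere_bounded g) -> sphere_bounded (fun x => \sum_(g <- L) c g * g x).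
Proof.
elim: L => [|h L IH] gL.
  have -> : (fun x : X => \sum_(g <- [::]) c g * g x) = fun=> 0 :> R.
    by apply/funext => x; rewrite big_nil.
  exact: sphere_bounded_cst.
have -> : (fun x : X => \sum_(g <- h :: L) c g * g x) =
   (fun x => c h * h x + \sum_(g <- L) c g * g x).
  by apply/funext => x; rewrite big_cons.
have [m1 [B1 b1]] := sphere_boundedM (sphere_bounded_cst (c h)) (gL h (or_introl erefl)).
have [m2 [B2 b2]] := IH (fun g gi => gL g (or_intror gi)).
split; first exact: measurable_funD.
by exists (B1 + B2) => x sx; rewrite (le_trans (ler_normD _ _))// lerD ?b1 ?b2.
Qed.

Lemma mom_sum mu (L : seq (X -> R)) (c : (X -> R) -> R) :
  (forall g, List.In g L -> sphere_bounded g) ->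
  mom mu (fun x => \sum_(g <- L) c g * g x) = \sum_(g <- L) c g * mom mu g.
Proof.
elim: L => [|h L IH] gL.
  rewrite big_nil /mom; under eq_Rintegral do rewrite big_nil.
  by rewrite /Rintegral integral0.
rewrite big_cons -IH; last by move=> g gi; apply: gL; right.
have gh := gL h (or_introl erefl).
have gs := @sphere_bounded_sum L c (fun g gi => gL g (or_intror gi)).
rewrite /mom; under eq_Rintegral do rewrite big_cons.
rewrite RintegralD.
- rewrite RintegralZl//; [exact: measurable_sphere|exact: sphere_bounded_integrable].
- exact: measurable_sphere.
- exact: (sphere_bounded_integrable mu (sphere_boundedM (sphere_bounded_cst (c h)) gh)).
- exact: sphere_bounded_integrable gs.
Qed.

Lemma bilinear mu nu (L : seq (X -> R)) :
  (forall g, List.In g L -> sphere_bounded g) ->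
  (\int[mu]_(x in sphere) \int[nu]_(y in sphere) (sumsq L x y)%:E =
   (\sum_(g <- L) mom mu g * mom nu g)%:E)%E.
Proof.
move=> gL.
have inner x : (\int[nu]_(y in sphere) (sumsq L x y)%:E = (\sum_(g <- L) mom nu g * g x)%:E)%E.
  rewrite (momE nu (g := fun y => \sum_(g <- L) g x * g y)).
    by rewrite (mom_sum nu (fun g => g x))//; congr EFin; apply: eq_bigr => g _; rewrite mulrC.
  exact: (sphere_bounded_sum (fun g => g x)).
under eq_integral do rewrite inner.
rewrite momE; last exact: (sphere_bounded_sum (fun g => mom nu g)).
rewrite (mom_sum mu (fun g => mom nu g))//.
by congr EFin; apply: eq_bigr => g _; rewrite mulrC.
Qed.

Lemma sum_In (T : Type) (L : seq T) (d : T -> R) (w : T) :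
  (forall g : T, 0 <= d g) -> List.In w L -> d w <= \sum_(g <- L) d g.
Proof.
move=> d0; elim: L => [|h L IH] //=; rewrite big_cons.
move=> [->|/IH le]; first by rewrite lerDl sumr_ge0.
by rewrite (le_trans le)// lerDr.
Qed.

(** The energy of mu is, by definition, the case mu = nu. *)
Definition mutual mu nu : \bar R :=
  (\int[mu]_(x in sphere) \int[nu]_(y in sphere) ((enorm (x - y))%:E)^-1)%E.

Definition mutual_trunc M mu nu : R := \sum_(g <- kwords M.*2) mom mu g * mom nu g.

Lemma mutual_truncE M mu nu :
  (\int[mu]_(x in sphere) \int[nu]_(y in sphere) (kernel_trunc M x y)%:E = (mutual_trunc M mu nu)%:E)%E.
Proof.
rewrite -bilinear; last by move=> g; exact: sphere_bounded_kwords.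
by apply: eq_integral => x _; apply: eq_integral => y _; rewrite sumsq_kwords.
Qed.

Lemma inner_kernel_truncE nu x M : (\int[nu]_(y in sphere) (kernel_trunc M x y)%:E)%E =
  (\sum_(g <- kwords M.*2) mom nu g * g x)%:E.
Proof.
under eq_integral do rewrite /kernel_trunc /rsq_even -sumsq_kwords.
rewrite (momE nu (g := fun y => \sum_(g <- kwords M.*2) g x * g y)).
  rewrite (mom_sum nu (fun g => g x)); last by move=> g; exact: sphere_bounded_kwords.
  by congr EFin; apply: eq_bigr => g _; rewrite mulrC.
by apply: (sphere_bounded_sum (fun g => g x)) => g; exact: sphere_bounded_kwords.
Qed.

Lemma measurable_kernel_trunc x M : measurable_fun (@sphere R) (fun y => (kernel_trunc M x y)%:E).
Proof.
have -> : (fun y => (kernel_trunc M x y)%:E) = (fun y => (\sum_(g <- kwords M.*2) g x * g y)%:E).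
  by apply/funext => y; rewrite /kernel_trunc /rsq_even -sumsq_kwords.
apply/measurable_EFinP; apply: measurable_funTS.
have [] // := @sphere_bounded_sum (kwords M.*2) (fun g => g x) _.
by move=> g; exact: sphere_bounded_kwords.
Qed.

Lemma measurable_inner_kernel_trunc nu M :
  measurable_fun (@sphere R) (fun x => \int[nu]_(y in sphere) (kernel_trunc M x y)%:E)%E.
Proof.
under eq_fun do rewrite inner_kernel_truncE.
apply/measurable_EFinP; apply: measurable_funTS.
have [] // := @sphere_bounded_sum (kwords M.*2) (fun g => mom nu g) _.
by move=> g; exact: sphere_bounded_kwords.
Qed.

Lemma inner_kernel_trunc_ge0 nu M x : sphere x ->
  (0 <= \int[nu]_(y in sphere) (kernel_trunc M x y)%:E)%E.
Proof. by move=> sx; apply: integral_ge0 => y sy; rewrite lee_fin kernel_trunc_ge0. Qed.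

Lemma inner_kernel_trunc_nd nu x : sphere x ->
  {homo (fun M => \int[nu]_(y in sphere) (kernel_trunc M x y)%:E)%E : m n / (m <= n)%N >-> (m <= n)%E}.
Proof.
move=> sx m n mn; apply: ge0_le_integral.
- exact: measurable_sphere.
- by move=> y sy; rewrite lee_fin kernel_trunc_ge0.
- exact: measurable_kernel_trunc.
- exact: measurable_kernel_trunc.
- by move=> y sy; exact: kernel_trunc_nd.
Qed.

Lemma mutual_trunc_cvg mu nu : (mutual_trunc M mu nu)%:E @[M --> \oo] --> mutual mu nu.
Proof.
under eq_fun do rewrite -mutual_truncE.
have mS := measurable_sphere.
have -> : mutual mu nu = (\int[mu]_(x in sphere) limn (fun M => \int[nu]_(y in sphere) (kernel_trunc M x y)%:E))%E.
  apply: eq_integral => x /set_mem sx.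
  rewrite -monotone_convergence//.
  - apply: eq_integral => y /set_mem sy.
    by apply/esym/cvg_lim => //; exact: kernel_trunc_cvg.
  - by move=> M; exact: measurable_kernel_trunc.
  - by move=> M y sy; rewrite lee_fin kernel_trunc_ge0.
  - by move=> y sy; exact: kernel_trunc_nd.
apply: cvg_monotone_convergence => //.
- by move=> M; exact: measurable_inner_kernel_trunc.
- by move=> M x; exact: inner_kernel_trunc_ge0.
- by move=> x sx; exact: inner_kernel_trunc_nd.
Qed.

Lemma mutual_trunc_le M mu nu : ((mutual_trunc M mu nu)%:E <= mutual mu nu)%E.
Proof.
have nd : {homo (fun M => (mutual_trunc M mu nu)%:E) : m n / (m <= n)%N >-> (m <= n)%E}.
  move=> m n mn; rewrite -!mutual_truncE; apply: ge0_le_integral.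
  - exact: measurable_sphere.
  - by move=> x; exact: inner_kernel_trunc_ge0.
  - exact: measurable_inner_kernel_trunc.
  - exact: measurable_inner_kernel_trunc.
  - by move=> x sx; exact: inner_kernel_trunc_nd.
rewrite (cvg_unique _ (@mutual_trunc_cvg mu nu) (ereal_nondecreasing_cvgn nd))//.
by apply: ereal_sup_ubound; exists M.
Qed.

Lemma mutual_ge0 mu nu : (0 <= mutual mu nu)%E.
Proof. by apply: le_trans (mutual_trunc_le 0 mu nu); rewrite lee_fin /mutual_trunc/= big_nil. Qed.

(** Truncating the kernel, I(mu) + I(nu) - 2 I(mu, nu) is a limit of sums of
    squares (mom mu h - mom nu h)^2; the word g contributes to all the later
    sums the same positive multiple of its own square. *)
Lemma mom_eq mu nu n g : List.In g (words n) ->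
  (mutual mu mu < +oo)%E -> (mutual nu nu < +oo)%E ->
  (mutual mu mu + mutual nu nu <= 2%:E * mutual mu nu)%E -> mom mu g = mom nu g.
Proof.
move=> gw fa fb.
pose a := fine (mutual mu mu); have aE : mutual mu mu = a%:E.
  by rewrite fineK// ge0_fin_numE// mutual_ge0.
pose b := fine (mutual nu nu); have bE : mutual nu nu = b%:E.
  by rewrite fineK// ge0_fin_numE// mutual_ge0.
rewrite aE bE => le.
pose dl := rsq 2 * rsq_coef n * (mom mu g - mom nu g) ^+ 2.
suff dl0 : dl <= 0.
  have c0 : 0 < rsq 2 * rsq_coef n :> R by rewrite mulr_gt0 ?rsq_coef_gt0// rsq_gt0.
  move: dl0; rewrite /dl pmulr_rle0// => h; apply/eqP; rewrite -subr_eq0 -sqrf_eq0.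
  by rewrite eq_le h sqr_ge0.
have gg := sphere_bounded_words gw.
have key M : (n < M)%N -> mutual_trunc M mu nu <= (a + b - dl) / 2.
  move=> nM.
  have h1 : mutual_trunc M mu mu <= a by rewrite -lee_fin -aE mutual_trunc_le.
  have h2 : mutual_trunc M nu nu <= b by rewrite -lee_fin -bE mutual_trunc_le.
  have h3 : dl <= mutual_trunc M mu mu + mutual_trunc M nu nu - 2 * mutual_trunc M mu nu.
    have -> : mutual_trunc M mu mu + mutual_trunc M nu nu - 2 * mutual_trunc M mu nu =
        \sum_(h <- kwords M.*2) (mom mu h - mom nu h) ^+ 2.
      rewrite /mutual_trunc mulr_sumr -big_split/= -sumrB; apply: eq_bigr => h _; ring.
    (* the weight of g in the expansion of the kernel, absorbed into g *)
    pose gk := fun x : X => Num.sqrt (rsq 2 * rsq_coef n) * g x.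
    have -> : dl = (mom mu gk - mom nu gk) ^+ 2.
      rewrite /mom /gk !RintegralZl//; try exact: measurable_sphere; try exact: sphere_bounded_integrable.
      by rewrite -mulrBr exprMn sqr_sqrtr// mulr_ge0 ?rsq_ge0// ltW// rsq_coef_gt0.
    apply: (@sum_In _ _ (fun h => (mom mu h - mom nu h) ^+ 2) gk) => [h|]; first exact: sqr_ge0.
    have : (n < M.*2)%N by rewrite (leq_trans nM)// -addnn leq_addr.
    elim: M.*2 => // N IH; rewrite ltnS leq_eqVlt /= List.in_app_iff => /orP[/eqP<-|/IH]; last by left.
    by right; apply/List.in_map_iff; exists g.
  by lra.
have up : (mutual mu nu <= ((a + b - dl) / 2)%:E)%E.
  apply: (cvge_le _ (@mutual_trunc_cvg mu nu)).
  by exists n.+1 => // M /= nM; rewrite lee_fin key.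
have : ((a + b)%:E <= (a + b - dl)%:E)%E.
  have -> : (a + b - dl)%:E = (2%:E * ((a + b - dl) / 2)%:E)%E.
    by rewrite -EFinM; congr EFin; field.
  by rewrite EFinD (le_trans le)// lee_pmul2l.
by rewrite lee_fin; lra.
Qed.

End PD.

(** * Moments determine a measure on the sphere *)

Section StepPoly.
Context {R : realType}.
Implicit Types u : R.

(** Polynomials with values in [0, 1] on [0, 1] that tend to the indicator of
    u < 1/2: with m = n^2 the number 2^(m + n) u^m tends to 0 for u < 1/2, and is
    at least 2^n for u >= 1/2.  They replace the Weierstrass theorem. *)
Definition step_poly n u : R := (1 - u ^+ (n * n)) ^+ (2 ^ (n * n + n)).

Lemma step_poly01 n u : 0 <= u <= 1 -> 0 <= step_poly n u <= 1.
Proof.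
move=> /andP[u0 u1]; have a0 : 0 <= u ^+ (n * n) by rewrite exprn_ge0.
have a1 : u ^+ (n * n) <= 1 by rewrite exprn_ile1.
by rewrite /step_poly exprn_ge0 ?exprn_ile1//; lra.
Qed.

Lemma bernoulli_le (a : R) m : 0 <= a <= 1 -> 1 - m%:R * a <= (1 - a) ^+ m.
Proof.
move=> /andP[a0 a1]; elim: m => [|m IH]; first by rewrite mul0r subr0 expr0.
have [h|h] := leP (1 - m%:R * a) 0.
  apply: (@le_trans _ _ 0); last by rewrite exprn_ge0; lra.
  by rewrite -natr1; lra.
rewrite exprS -natr1; have m0 : 0 <= m%:R :> R by [].
have : (1 - a) * (1 - m%:R * a) <= (1 - a) * (1 - a) ^+ m by rewrite ler_wpM2l//; lra.
have : 0 <= m%:R * a * a by rewrite !mulr_ge0.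
nra.
Qed.

Lemma pow_decay (a : R) m : 0 < a <= 1 -> (1 - a) ^+ m * (m%:R * a) <= 1.
Proof.
move=> /andP[a0 a1]; have b := bernoulli_ge m (ltW a0).
have c0 : 0 <= (1 - a) ^+ m by rewrite exprn_ge0; lra.
apply: (@le_trans _ _ ((1 - a) ^+ m * (1 + a) ^+ m)).
  by rewrite ler_wpM2l//; lra.
rewrite -exprMn exprn_ile1//; nra.
Qed.

Lemma nat_le_pow2 n : n%:R <= 2 ^+ n :> R.
Proof. by rewrite -natrX ler_nat ltnW// ltn_expl. Qed.

Lemma step_poly_cvg0 u : 2^-1 <= u <= 1 -> step_poly n u @[n --> \oo] --> (0 : R).
Proof.
move=> /andP[u0 u1]; have up : 0 < u by lra.
rewrite -(cvg_shiftS) /=.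
apply: (@squeeze_cvgr _ _ _ _ (fun=> 0) (fun n => n.+1%:R^-1)).
- near=> n; have /andP[-> _] := @step_poly01 n.+1 u ltac:(by rewrite (ltW up)).
  set a := u ^+ (n.+1 * n.+1).
  have a0 : 0 < a by rewrite exprn_gt0.
  have a1 : a <= 1 by rewrite exprn_ile1// ltW.
  have := @pow_decay a (2 ^ (n.+1 * n.+1 + n.+1)) ltac:(by rewrite a0).
  have ma : n.+1%:R <= (2 ^ (n.+1 * n.+1 + n.+1))%:R * a.
    rewrite natrX exprD mulrAC -exprMn.
    apply: (le_trans (nat_le_pow2 _)); rewrite ler_peMl ?exprn_ge0// exprn_ege1//; lra.
  rewrite -/(step_poly n.+1 u) => h.
  rewrite -[leRHS]mul1r ler_pdivlMr//; apply: le_trans h.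
  have /andP[q0 _] := @step_poly01 n.+1 u ltac:(by rewrite (ltW up)).
  by rewrite ler_wpM2l.
- exact: cvg_cst.
- exact: cvg_harmonic.
Unshelve. all: by end_near. Qed.

Lemma step_poly_cvg1 u : 0 <= u < 2^-1 -> step_poly n u @[n --> \oo] --> (1 : R).
Proof.
move=> /andP[u0 u1].
have hb n : (2 * (2 * u) ^+ n) ^+ n = (2 ^ (n * n + n))%:R * u ^+ (n * n).
  by rewrite natrX exprD mulrAC -exprMn exprM -exprMn mulrC.
have c : (2 * u) ^+ n @[n --> \oo] --> (0 : R).
  by apply: cvg_expr; rewrite ger0_norm; lra.
apply: (@squeeze_cvgr _ _ _ _ (fun n => 1 - 2^-1 ^+ n) (fun=> 1)).
- near=> n; have u01 : 0 <= u <= 1 by lra.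
  have /andP[_ ->] := step_poly01 n u01; rewrite andbT.
  have a1 : u ^+ (n * n) <= 1 by rewrite exprn_ile1//; lra.
  have := @bernoulli_le (u ^+ (n * n)) (2 ^ (n * n + n)) ltac:(by rewrite exprn_ge0).
  rewrite -/(step_poly n u) -hb; apply: le_trans; rewrite lerD2l lerN2.
  have p0 : 0 <= (2 * u) ^+ n by rewrite exprn_ge0//; lra.
  rewrite lerXn2r ?nnegrE//; last first.
    have : (2 * u) ^+ n < 4^-1.
      by near: n; apply: (cvgr_lt (0 : R)) => //; rewrite invr_gt0.
    by lra.
  by rewrite mulr_ge0.
- rewrite -[X in _ --> X]subr0; apply: cvgB; first exact: cvg_cst.
  by apply: cvg_expr; rewrite ger0_norm; lra.
- exact: cvg_cst.
Unshelve. all: by end_near. Qed.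
End StepPoly.

Section Moments.
Context {R : realType}.
Notation X := (R * R * R)%type.
Implicit Types (x y : X) (g : X -> R) (mu nu : probability X R).

(** Polynomial functions on R^3, generated so that linearity of the moments is
    an induction. *)
Inductive polynomial_fun : (X -> R) -> Prop :=
| polynomial_mono (c : R) i j k : polynomial_fun (fun x => c * (x.1.1 ^+ i * (x.1.2 ^+ j * x.2 ^+ k)))
| polynomial_add f g : polynomial_fun f -> polynomial_fun g -> polynomial_fun (fun x => f x + g x).

Lemma polynomial_mul f g : polynomial_fun f -> polynomial_fun g -> polynomial_fun (fun x => f x * g x).
Proof.
move=> sf; elim: sf g => [c i j k|f1 f2 _ IH1 _ IH2] g sg.
  elim: sg => [c' i' j' k'|g1 g2 _ IH1 _ IH2].
    rewrite (_ : (fun x => _) = fun x : X => c * c' * (x.1.1 ^+ (i + i') * (x.1.2 ^+ (j + j') * x.2 ^+ (k + k')))).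
      exact: polynomial_mono.
    by apply/funext => x; rewrite !exprD; ring.
  rewrite (_ : (fun x => _) = fun x : X => c * (x.1.1 ^+ i * (x.1.2 ^+ j * x.2 ^+ k)) * g1 x +
     c * (x.1.1 ^+ i * (x.1.2 ^+ j * x.2 ^+ k)) * g2 x).
    exact: polynomial_add.
  by apply/funext => x; ring.
rewrite (_ : (fun x => _) = fun x : X => f1 x * g x + f2 x * g x).
  by apply: polynomial_add; [exact: IH1|exact: IH2].
by apply/funext => x; ring.
Qed.

Lemma polynomial_cst (c : R) : polynomial_fun (fun=> c).
Proof.
have := polynomial_mono c 0 0 0; congr polynomial_fun; apply/funext => x.
by rewrite !expr0; ring.
Qed.

Lemma polynomial_exp f n : polynomial_fun f -> polynomial_fun (fun x => f x ^+ n).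
Proof.
move=> sf; elim: n => [|n IH]; first exact: polynomial_cst.
rewrite (_ : (fun x => _) = fun x : X => f x * f x ^+ n); first exact: polynomial_mul.
by apply/funext => x; rewrite exprS.
Qed.

Lemma polynomial_c1 : polynomial_fun (fun x => x.1.1).
Proof. by have := polynomial_mono 1 1 0 0; congr polynomial_fun; apply/funext => x; rewrite !expr0 expr1; ring. Qed.
Lemma polynomial_c2 : polynomial_fun (fun x => x.1.2).
Proof. by have := polynomial_mono 1 0 1 0; congr polynomial_fun; apply/funext => x; rewrite !expr0 expr1; ring. Qed.
Lemma polynomial_c3 : polynomial_fun (fun x => x.2).
Proof. by have := polynomial_mono 1 0 0 1; congr polynomial_fun; apply/funext => x; rewrite !expr0 expr1; ring. Qed.

Lemma polynomial_bounded g : polynomial_fun g -> sphere_bounded g.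
Proof.
elim=> [c i j k|f1 f2 _ [m1 [B1 b1]] _ [m2 [B2 b2]]].
  exact: sphere_boundedM (sphere_bounded_cst c) (sphere_bounded_words (mono_words i j k)).
split; first exact: measurable_funD.
by exists (B1 + B2) => x sx; rewrite (le_trans (ler_normD _ _))// lerD ?b1 ?b2.
Qed.

Lemma polynomial_mom mu nu g : (forall n h, List.In h (words n) -> mom mu h = mom nu h) ->
  polynomial_fun g -> mom mu g = mom nu g.
Proof.
move=> H; elim=> [c i j k|f1 f2 s1 e1 s2 e2].
  have gw := sphere_bounded_words (mono_words (R:=R) i j k).
  rewrite /mom !RintegralZl//; try exact: measurable_sphere; try exact: sphere_bounded_integrable.
  by congr (_ * _); exact: (H _ _ (mono_words i j k)).
rewrite /mom !RintegralD; try exact: measurable_sphere; try (apply: sphere_bounded_integrable; exact: polynomial_bounded).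
by rewrite -/(mom mu f1) -/(mom nu f1) -/(mom mu f2) -/(mom nu f2) e1 e2.
Qed.

(** An affine map sending the threshold s to 1/2 and [-1, 1] into [0, 1]. *)
Definition step_arg (s v : R) : R := 2^-1 + (v - s) / (4 * (1 + `|s|)).

Lemma step_arg_bound s v : `|v| <= 1 -> 0 <= step_arg s v <= 1.
Proof.
move=> v1; have s0 : 0 <= `|s| by [].
have : `|(v - s) / (4 * (1 + `|s|))| <= 4^-1.
  have p : 0 < 4 * (1 + `|s|) by lra.
  rewrite normrM normfV [X in _ / X]gtr0_norm// ler_pdivrMr//.
  by apply: (le_trans (ler_normB _ _)); lra.
by rewrite /step_arg ler_norml; lra.
Qed.

Lemma step_arg_lt s v : (step_arg s v < 2^-1) = (v < s).
Proof.
have s0 : 0 <= `|s| by [].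
have p : 0 < 4 * (1 + `|s|) by lra.
by rewrite /step_arg gtrDl ltr_pdivrMr// mul0r subr_lt0.
Qed.

Lemma step_poly_uaff_cvg s v : `|v| <= 1 ->
  step_poly n (step_arg s v) @[n --> \oo] --> ((v < s)%R%:R : R).
Proof.
move=> v1; have /andP[u0 u1] := step_arg_bound s v1.
have [vs|vs] := ltP v s.
  by apply: step_poly_cvg1; rewrite u0 step_arg_lt.
by apply: step_poly_cvg0; rewrite u1 andbT leNgt step_arg_lt -leNgt.
Qed.

Definition box (s t r : R) : set X := [set x | [/\ x.1.1 < s, x.1.2 < t & x.2 < r]].

Lemma measurable_box s t r : measurable (box s t r).
Proof.
have -> : box s t r = (setT `&` (fun x : X => x.1.1) @^-1` `]-oo, s[) `&`
  ((setT `&` (fun x : X => x.1.2) @^-1` `]-oo, t[) `&`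
  (setT `&` (fun x : X => x.2) @^-1` `]-oo, r[)).
  apply/seteqP; split => x; rewrite /box/= !in_itv/=.
    by move=> [].
  by move=> [[_ ?] [[_ ?] [_ ?]]].
apply: measurableI; first by apply: measurable_c1 => //; exact: measurable_itv.
apply: measurableI; first by apply: measurable_c2 => //; exact: measurable_itv.
by apply: measurable_c3 => //; exact: measurable_itv.
Qed.

Lemma probability_sphereI mu (A : set X) : measurable A -> on_sphere mu ->
  mu A = mu (A `&` sphere).
Proof.
move=> mA mS; have ms := @measurable_sphere R.
have z : mu (~` sphere) = 0%E.
  by rewrite probability_setC// mS subee.
have -> : mu A = mu ((A `&` sphere) `|` (A `&` ~` sphere)).
  by rewrite -setIUr setUv setIT.
rewrite measureU; first last.
- by rewrite -setIIr setICr setI0.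
- by apply: measurableI => //; exact: measurableC.
- exact: measurableI.
rewrite [X in (_ + X)%E](_ : _ = 0%E) ?adde0//.
apply: (@subset_measure0 _ _ _ mu _ (~` sphere)) => //.
- by apply: measurableI => //; exact: measurableC.
- exact: measurableC.
Qed.

(** The indicator of a box is, on the sphere, a bounded limit of products of
    step polynomials of the coordinates. *)
Lemma box_eq mu nu s t r : on_sphere mu -> on_sphere nu ->
  (forall n h, List.In h (words n) -> mom mu h = mom nu h) ->
  mu (box s t r) = nu (box s t r).
Proof.
move=> smu snu H; have ms := @measurable_sphere R; have mb := measurable_box s t r.
pose G n (x : X) := step_poly n (step_arg s x.1.1) * (step_poly n (step_arg t x.1.2) * step_poly n (step_arg r x.2)).
have sG n : polynomial_fun (G n).
  have sp (v : R) (f : X -> R) : polynomial_fun f -> polynomial_fun (fun x => step_poly n (step_arg v (f x))).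
    move=> sf; rewrite /step_poly; apply: polynomial_exp; apply: polynomial_add; first exact: polynomial_cst.
    rewrite (_ : (fun x => _) = fun x : X => -1 * step_arg v (f x) ^+ (n * n)).
      apply: polynomial_mul; first exact: polynomial_cst.
      apply: polynomial_exp; rewrite /step_arg; apply: polynomial_add; first exact: polynomial_cst.
      apply: polynomial_mul; last exact: polynomial_cst.
      by apply: polynomial_add => //; exact: polynomial_cst.
    by apply/funext => x; rewrite mulN1r.
  apply: polynomial_mul; first exact: sp polynomial_c1.
  by apply: polynomial_mul; [exact: sp polynomial_c2|exact: sp polynomial_c3].
have cvg rho : on_sphere rho -> (mom rho (G n))%:E @[n --> \oo] --> rho (box s t r).
  move=> srho.
  have -> : rho (box s t r) = (\int[rho]_(x in sphere) (\1_(box s t r) x)%:E)%E.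
    by rewrite integral_indic// (probability_sphereI mb srho).
  rewrite (_ : (fun n => _) = (fun n => \int[rho]_(x in sphere) (G n x)%:E)%E); last first.
    by apply/funext => n; rewrite momE//; exact: polynomial_bounded.
  apply: (@dominated_cvg _ _ _ rho sphere ms _ _ (cst 1%E)).
  - move=> n; apply/measurable_EFinP; apply: measurable_funTS.
    by have [] := polynomial_bounded (sG n).
  - move=> x sx; have [b1 b2 b3] := coord_bound sx.
    apply: cvg_EFin; first exact: nearW.
    have -> : \1_(box s t r) x = (x.1.1 < s)%R%:R * ((x.1.2 < t)%R%:R * (x.2 < r)%R%:R) :> R.
      rewrite indicE -!natrM; congr _%:R.
      rewrite (_ : (x \in box s t r) = [&& x.1.1 < s, x.1.2 < t & x.2 < r]%R).
        by case: (x.1.1 < s)%R; case: (x.1.2 < t)%R; case: (x.2 < r)%R.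
      apply/idP/idP; first by rewrite inE => -[-> -> ->].
      by move=> /and3P[? ? ?]; rewrite inE.
    apply: cvgM; first exact: step_poly_uaff_cvg.
    by apply: cvgM; exact: step_poly_uaff_cvg.
  - by [].
  - by apply: (sphere_bounded_integrable rho (sphere_bounded_cst 1)).
  - move=> n x sx; have [b1 b2 b3] := coord_bound sx.
    have /andP[p1 q1] := step_poly01 n (step_arg_bound s b1).
    have /andP[p2 q2] := step_poly01 n (step_arg_bound t b2).
    have /andP[p3 q3] := step_poly01 n (step_arg_bound r b3).
    rewrite /= lee_fin ger0_norm ?mulr_ge0//.
    by rewrite /G mulr_ile1 ?mulr_ge0// mulr_ile1.
apply: (cvg_unique _ (cvg mu smu)) => //.
rewrite (_ : (fun n => _) = (fun n => (mom nu (G n))%:E)); last first.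
  by apply/funext => n; rewrite (polynomial_mom H (sG n)).
exact: cvg.
Qed.

(** The product of the Borel sigma-algebras of the three factors is generated
    by the open quadrants, which form a pi-system. *)
Lemma box_generate : @measurable _ X = <<s [set A | exists s t r, A = box s t r] >>.
Proof.
set G := [set A | _].
apply/seteqP; split; last first.
  apply: smallest_sub; first exact: sigma_algebra_measurable.
  by move=> _ [s [t [r ->]]]; exact: measurable_box.
pose T := g_sigma_algebraType G.
have mG s t r : measurable (box s t r : set T).
  by apply: sub_sigma_algebra; exists s, t, r.
have bigN (v : R) : exists n : nat, v < n%:R.
  by have [n _ nv] := nbhs_infty_gtr v; exists n; exact: nv (leqnn n).
have c1 : measurable_fun setT (fun x : T => x.1.1 : R).
  apply: (measurability _ (RGenInftyO.measurableE R)) => _ [_ [s ->] <-].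
  rewrite setTI (_ : _ @^-1` _ = \bigcup_n (box s n%:R n%:R)).
    by apply: bigcupT_measurable => n; exact: mG.
  apply/seteqP; split => x /=; rewrite in_itv/=; last by move=> [n _ []].
  move=> xs; have [n /= h] := bigN (Num.max x.1.2 x.2).
  by exists n => //; move: h; rewrite gt_max => /andP[].
have c2 : measurable_fun setT (fun x : T => x.1.2 : R).
  apply: (measurability _ (RGenInftyO.measurableE R)) => _ [_ [s ->] <-].
  rewrite setTI (_ : _ @^-1` _ = \bigcup_n (box n%:R s n%:R)).
    by apply: bigcupT_measurable => n; exact: mG.
  apply/seteqP; split => x /=; rewrite in_itv/=; last by move=> [n _ []].
  move=> xs; have [n /= h] := bigN (Num.max x.1.1 x.2).
  by exists n => //; move: h; rewrite gt_max => /andP[].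
have c3 : measurable_fun setT (fun x : T => x.2 : R).
  apply: (measurability _ (RGenInftyO.measurableE R)) => _ [_ [s ->] <-].
  rewrite setTI (_ : _ @^-1` _ = \bigcup_n (box n%:R n%:R s)).
    by apply: bigcupT_measurable => n; exact: mG.
  apply/seteqP; split => x /=; rewrite in_itv/=; last by move=> [n _ []].
  move=> xs; have [n /= h] := bigN (Num.max x.1.1 x.1.2).
  by exists n => //; move: h; rewrite gt_max => /andP[].
have mid : measurable_fun setT (fun x : T => ((x.1.1, x.1.2), x.2) : X).
  by apply: measurable_fun_pair => //; exact: measurable_fun_pair.
move=> A mA; have := mid measurableT A mA; rewrite setTI.
by rewrite (_ : _ @^-1` A = A)//; apply/seteqP; split => -[[? ?] ?].
Qed.

Lemma measure_moments mu nu : on_sphere mu -> on_sphere nu ->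
  (forall n h, List.In h (words n) -> mom mu h = mom nu h) ->
  forall A, measurable A -> mu A = nu A.
Proof.
move=> smu snu H.
apply: (measure_unique [set A | exists s t r, A = box s t r]
  (fun n => box n%:R n%:R n%:R)).
- exact: box_generate.
- move=> _ _ [s [t [r ->]]] [s' [t' [r' ->]]].
  exists (Num.min s s'), (Num.min t t'), (Num.min r r').
  apply/seteqP; split => x; rewrite /box/= !lt_min.
    by move=> [[-> -> ->] [-> -> ->]].
  by move=> [/andP[? ?] /andP[? ?] /andP[? ?]].
- by move=> n; exists n%:R, n%:R, n%:R.
- apply/seteqP; split => // x _.
  have [n _ /(_ n (leqnn n))] := nbhs_infty_gtr (Num.max (Num.max x.1.1 x.1.2) x.2).
  by rewrite /= !gt_max => /andP[/andP[? ?] ?]; exists n.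
- by move=> _ [s [t [r ->]]]; exact: box_eq.
- by move=> n; rewrite (le_lt_trans (probability_le1 _ _)) ?ltry//; exact: measurable_box.
Qed.

End Moments.

(** * The measure with a given density on the cap *)

Section DensityImage.
Local Open Scope ereal_scope.
Context d d' (T : measurableType d) (T' : measurableType d') (R : realType).
Variables (m : {measure set T -> \bar R}) (w : T -> R) (h : T -> T').
Hypotheses (mw : measurable_fun setT w) (w0 : forall x, (0 <= w x)%R)
  (mh : measurable_fun setT h).

(** The image under h of the measure of density w; the proofs are arguments so
    that the measure structure can be attached to the term. *)
Definition image_density of measurable_fun setT w & (forall x, (0 <= w x)%R) &
    measurable_fun setT h := fun A : set T' => \int[m]_(x in h @^-1` A) (w x)%:E.

Local Notation nu := (image_density mw w0 mh).

Let mpre A : measurable A -> measurable (h @^-1` A).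
Proof. by move=> mA; rewrite -[_ @^-1` _]setTI; exact: mh. Qed.

Let nu0 : nu set0 = 0.
Proof. by rewrite /image_density preimage_set0 integral_set0. Qed.

Let nu_ge0 A : 0 <= nu A.
Proof. by apply: integral_ge0 => x _; rewrite lee_fin. Qed.

Let mwE : measurable_fun setT (fun x => (w x)%:E).
Proof. exact/measurable_EFinP. Qed.

Let nu_sigma_additive : semi_sigma_additive nu.
Proof.
move=> /= F mF tF mUF; rewrite /image_density; apply: cvg_toP.
  apply: ereal_nondecreasing_is_cvgn => k n kn.
  by apply: lee_sum_nneg_natr => // i _ _; apply: integral_ge0 => x _; rewrite lee_fin.
rewrite preimage_bigcup ge0_integral_bigcup//.
- by move=> k; exact: mpre.
- exact: measurable_funTS.
- by move=> x _; rewrite lee_fin.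
- move=> i j _ _ [x [Fi Fj]]; apply: (tF i j) => //.
  by exists (h x).
Qed.

HB.instance Definition _ := isMeasure.Build _ _ _ nu nu0 nu_ge0 nu_sigma_additive.

Import HBNNSimple.

Lemma ge0_integral_image_density (g : T' -> \bar R) :
  measurable_fun setT g -> (forall x, 0 <= g x) ->
  \int[nu]_x g x = \int[m]_x (g (h x) * (w x)%:E).
Proof.
move=> mg g0; pose k := nnsfun_approx measurableT mg.
have gE x : g x = lim ((EFin \o k n) x @[n --> \oo]).
  by apply/esym/cvg_lim => //; exact: cvg_nnsfun_approx.
have -> : \int[nu]_x g x = lim (\int[nu]_x (EFin \o k n) x @[n --> \oo]).
  rewrite -monotone_convergence//.
  - by apply: eq_integral => x _.
  - by move=> n; apply/measurable_EFinP.
  - by move=> n x _; rewrite lee_fin.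
  - by move=> x _ a b ab; rewrite lee_fin; exact/lefP/nd_nnsfun_approx.
have mkh n : measurable_fun setT (fun x => (k n (h x))%:E).
  by apply/measurable_EFinP; apply: measurableT_comp.
have -> : \int[m]_x (g (h x) * (w x)%:E) = lim (\int[m]_x ((k n (h x))%:E * (w x)%:E) @[n --> \oo]).
  rewrite -monotone_convergence//.
  - apply: eq_integral => x _; apply/esym/cvg_lim => //.
    rewrite gE; have c := @cvg_nnsfun_approx _ _ _ _ measurableT _ mg (fun x _ => g0 x) (h x) I.
    by apply: cvgeZr => //; rewrite -gE; exact: c.
  - by move=> n; exact: emeasurable_funM.
  - by move=> n x _; rewrite mule_ge0// lee_fin.
  - move=> x _ a b ab; apply: lee_wpmul2r; rewrite lee_fin//; exact/lefP/nd_nnsfun_approx.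
suff suf n : \int[nu]_x (EFin \o k n) x = \int[m]_x ((k n (h x))%:E * (w x)%:E).
  by under eq_fun do rewrite suf.
transitivity (\int[nu]_x (\sum_(y \in range (k n)) (y * \1_(k n @^-1` [set y]) x)%:E)).
  by apply: eq_integral => t tE; rewrite /= fimfunE -fsumEFin.
have mk1 r : measurable (k n @^-1` [set r]) by rewrite -[_ @^-1` _]setTI; exact: measurable_funP.
rewrite ge0_integral_fsum//; last 2 first.
- by move=> y; apply/measurable_EFinP; apply: measurable_funM => //; exact: measurable_indic.
- by move=> y x _; exact: nnfun_muleindic_ge0.
transitivity (\int[m]_x ((\sum_(y \in range (k n)) (y * \1_(k n @^-1` [set y]) (h x))%:E) * (w x)%:E)); last first.
  by apply: eq_integral => t tE; rewrite fimfunE -fsumEFin.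
under [RHS]eq_integral => x xE.
  rewrite ge0_mule_fsuml; last by move=> y; exact: nnfun_muleindic_ge0.
  over.
rewrite ge0_integral_fsum//; last 2 first.
- move=> y; apply: emeasurable_funM => //; apply/measurable_EFinP; apply: measurable_funM => //.
  by apply: measurableT_comp => //; exact: measurable_indic.
- by move=> y x _; apply: mule_ge0; [exact: nnfun_muleindic_ge0|rewrite lee_fin].
apply: eq_fsbigr => r; rewrite inE => -[t _ rE].
have r0 : (0 <= r)%R by rewrite -rE.
under eq_integral do rewrite EFinM.
rewrite ge0_integralZl//; last first.
  by apply/measurable_EFinP; exact: measurable_indic.
rewrite integral_indic// setIT.
under [RHS]eq_integral do rewrite EFinM -muleA.
rewrite ge0_integralZl//; first last.
- by move=> x _; rewrite mule_ge0 ?lee_fin.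
- apply: emeasurable_funM => //; apply/measurable_EFinP.
  by apply: measurableT_comp => //; exact: measurable_indic.
congr (_ * _).
transitivity (\int[m]_(x in h @^-1` (k n @^-1` [set r])) (w x)%:E) => //.
by rewrite integral_mkcond; apply: eq_integral => x _; rewrite epatch_indic muleC.
Qed.

End DensityImage.

Section Tonelli.
Context {R : realType}.
Notation mu := (@lebesgue_measure R).
Implicit Types (A B : set R) (k : R -> R -> R).

Lemma restrict2E A B k x y :
  ((\1_A x * \1_B y * k x y)%:E = (if x \in A then (if y \in B then (k x y)%:E else 0) else 0))%E.
Proof.
by rewrite !indicE; case: (x \in A); case: (y \in B); rewrite ?mul1r ?mul0r.
Qed.

Lemma measurable_restrict2 A B k : measurable A -> measurable B ->
  measurable_fun setT (fun z : R * R => k z.1 z.2) ->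
  measurable_fun setT (fun z : R * R => (\1_A z.1 * \1_B z.2 * k z.1 z.2)%:E).
Proof.
move=> mA mB mk; apply/measurable_EFinP; apply: measurable_funM => //.
apply: measurable_funM.
  by apply: (measurableT_comp (measurable_indic mA)); exact: measurable_fst.
by apply: (measurableT_comp (measurable_indic mB)); exact: measurable_snd.
Qed.

Lemma integral_restrict2 A B k x :
  (\int[mu]_y (\1_A x * \1_B y * k x y)%:E = (if x \in A then \int[mu]_(y in B) (k x y)%:E else 0))%E.
Proof.
under eq_integral do rewrite restrict2E.
case: (x \in A); last by rewrite integral0.
by rewrite [RHS]integral_mkcond; apply: eq_integral => y _; rewrite patchE.
Qed.

Lemma restrict2_ge0 A B k (z : R * R) : (forall x y, A x -> B y -> 0 <= k x y) ->
  (0 <= (\1_A z.1 * \1_B z.2 * k z.1 z.2)%:E)%E.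
Proof.
move=> k0; rewrite restrict2E; case: ifPn => // /set_mem Az.
by case: ifPn => // /set_mem Bz; rewrite lee_fin k0.
Qed.

Lemma measurable_integral2 A B k : measurable A -> measurable B ->
  measurable_fun setT (fun z : R * R => k z.1 z.2) ->
  (forall x y, A x -> B y -> 0 <= k x y) ->
  measurable_fun A (fun x => \int[mu]_(y in B) (k x y)%:E)%E.
Proof.
move=> mA mB mk k0.
have := @measurable_fun_fubini_tonelli_F _ _ _ _ R mu _
  (measurable_restrict2 mA mB mk) (fun z => restrict2_ge0 z k0).
move=> /measurable_funTS -/(_ A); apply: eq_measurable_fun => x xA.
by rewrite /fubini_F/= integral_restrict2// xA.
Qed.

Lemma tonelli_set A B k : measurable A -> measurable B ->
  measurable_fun setT (fun z : R * R => k z.1 z.2) ->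
  (forall x y, A x -> B y -> 0 <= k x y) ->
  (\int[mu]_(x in A) \int[mu]_(y in B) (k x y)%:E =
   \int[mu]_(y in B) \int[mu]_(x in A) (k x y)%:E)%E.
Proof.
move=> mA mB mk k0.
have := @fubini_tonelli _ _ _ _ R mu mu _ (measurable_restrict2 mA mB mk)
  (fun z => restrict2_ge0 z k0).
rewrite /= => e; rewrite integral_mkcond [RHS]integral_mkcond.
transitivity (\int[mu]_x \int[mu]_y (\1_A x * \1_B y * k x y)%:E)%E.
  by apply: eq_integral => x _; rewrite patchE integral_restrict2.
rewrite e; apply: eq_integral => y _; rewrite patchE.
under eq_integral do rewrite [\1_A _ * _]mulrC.
by rewrite (@integral_restrict2 B A (fun y x => k x y)).
Qed.

End Tonelli.

Section CapMeasure.
Context {R : realType} (al : R) (f : R -> R).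
Notation X := (R * R * R)%type.
Notation mu := (@lebesgue_measure R).

Definition sphp (z : R * R) : X := sph_point z.2 z.1.

Lemma measurable_sphp : measurable_fun setT sphp.
Proof.
have ms : measurable_fun setT (@sin R) by apply: continuous_measurable_fun; exact: continuous_sin.
have mc : measurable_fun setT (@cos R) by apply: continuous_measurable_fun; exact: continuous_cos.
have m1 (h : R -> R) : measurable_fun setT h -> measurable_fun setT (fun z : R * R => h z.1).
  by move=> mh; apply: measurableT_comp mh _; exact: measurable_fst.
have m2 (h : R -> R) : measurable_fun setT h -> measurable_fun setT (fun z : R * R => h z.2).
  by move=> mh; apply: measurableT_comp mh _; exact: measurable_snd.
apply: measurable_fun_pair; last exact: m1.
by apply: measurable_fun_pair; apply: measurable_funM; (exact: m1 || exact: m2).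
Qed.

(** The density in the coordinates (phi, theta), cut off outside the
    coordinate rectangle. *)
Definition capw (z : R * R) : R :=
  ((fun phi => f phi * sin phi) \_ (`]al, pi[ : set R)) z.1 * \1_(`[0, 2 * pi] : set R) z.2.

Hypotheses (al0 : 0 <= al) (mf : measurable_fun `]al, pi[ f)
  (f0 : forall phi, al < phi < pi -> 0 <= f phi).

Lemma capw_ge0 z : 0 <= capw z.
Proof.
rewrite /capw patchE mulr_ge0//; case: ifPn => // /set_mem; rewrite /= in_itv/= => /andP[h1 h2].
by apply: mulr_ge0; [apply: f0; rewrite h1|apply: sin_ge0_pi; rewrite (le_trans al0 (ltW h1)) (ltW h2)].
Qed.

Lemma measurable_capw : measurable_fun setT capw.
Proof.
have ms : measurable_fun setT (@sin R) by apply: continuous_measurable_fun; exact: continuous_sin.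
apply: measurable_funM.
  apply: (measurableT_comp (f := (fun phi => f phi * sin phi) \_ _)); last exact: measurable_fst.
  apply/measurable_restrict => //; rewrite setTI; apply: measurable_funM => //.
  exact: measurable_funTS.
by apply: (measurableT_comp (measurable_indic _)); [exact: measurable_itv|exact: measurable_snd].
Qed.

Definition capmu : set X -> \bar R :=
  image_density (mu \x mu)%E measurable_capw capw_ge0 measurable_sphp.

HB.instance Definition _ := Measure.on capmu.

Lemma integral_capmu (G : X -> \bar R) : measurable_fun setT G -> (forall x, 0 <= G x)%E ->
  (\int[capmu]_x G x = \int[mu]_(phi in `]al, pi[) \int[mu]_(theta in `[0%R, (2 * pi)%R])
     ((f phi * sin phi)%:E * G (sph_point theta phi)))%E.
Proof.
move=> mG G0; rewrite ge0_integral_image_density//.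
pose H z := (G (sphp z) * (capw z)%:E)%E.
have H0 z : (0 <= H z)%E by rewrite mule_ge0// lee_fin capw_ge0.
have mH : measurable_fun setT H.
  apply: emeasurable_funM; first by apply: measurableT_comp => //; exact: measurable_sphp.
  by apply/measurable_EFinP; exact: measurable_capw.
rewrite (@fubini_tonelli1 _ _ _ _ R mu mu H mH H0).
rewrite [RHS]integral_mkcond; apply: eq_integral => phi _.
rewrite /fubini_F /H /capw /= !patchE; case: ifPn => phin.
  rewrite [RHS]integral_mkcond; apply: eq_integral => th _.
  rewrite patchE indicE /sphp/=; case: ifPn => _; first by rewrite mulr1 muleC.
  by rewrite mulr0 mule0.
by under eq_integral do rewrite mul0r mule0; rewrite integral0.
Qed.

Hypothesis mass : (\int[mu]_(phi in `]al, pi[) (f phi * sin phi)%:E = ((2 * pi)^-1)%:E)%E.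

(** The same measure, with the normalization as a phantom argument that lets
    it carry the structure of a probability. *)
Definition capmuP of (\int[mu]_(phi in `]al, pi[) (f phi * sin phi)%:E = ((2 * pi)^-1)%:E)%E := capmu.

Local Notation capmu' := (capmuP mass).

HB.instance Definition _ := Measure.on capmu'.

Let capmu_setT : capmu' setT = 1%E.
Proof.
have p0 := @pi_gt0 R; have p2 : 0 < 2 * pi :> R by rewrite mulr_gt0.
transitivity (\int[capmu']_x (cst 1%E x))%E; first by rewrite integral_cst// mul1e.
rewrite integral_capmu//.
have inner phi : (\int[mu]_(theta in `[0%R, (2 * pi)%R])
    ((f phi * sin phi)%:E * cst 1 (sph_point theta phi)) = (2 * pi)%:E * (f phi * sin phi)%:E)%E.
  transitivity (\int[mu]_(theta in `[0%R, (2 * pi)%R]) cst (f phi * sin phi)%:E theta)%E.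
    by apply: eq_integral => theta _; rewrite /= mule1.
  by rewrite integral_cst//= lebesgue_measure_itv/= lte_fin p2 -EFinB subr0 muleC.
under eq_integral do rewrite inner.
have ms : measurable_fun setT (@sin R) by apply: continuous_measurable_fun; exact: continuous_sin.
rewrite ge0_integralZl//.
- by rewrite mass -EFinM divff// gt_eqF.
- by apply/measurable_EFinP; apply: measurable_funM => //; exact: measurable_funTS.
- move=> phi; rewrite /= in_itv/= => /andP[h1 h2]; rewrite lee_fin.
  by apply: mulr_ge0; [apply: f0; rewrite h1|apply: sin_ge0_pi; rewrite (le_trans al0 (ltW h1)) (ltW h2)].
- by rewrite lee_fin ltW.
Qed.

HB.instance Definition _ := @Measure_isProbability.Build _ _ R capmu' capmu_setT.

Lemma cap_probability : exists nu : probability X R,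
  forall G : X -> \bar R, measurable_fun setT G -> (forall x, 0 <= G x)%E ->
  (\int[nu]_x G x = \int[mu]_(phi in `]al, pi[) \int[mu]_(theta in `[0%R, (2 * pi)%R])
     ((f phi * sin phi)%:E * G (sph_point theta phi)))%E.
Proof. by exists capmu' => G mG G0; exact: integral_capmu. Qed.

End CapMeasure.

(** * Potential of an Abel-inverted density *)

Section Potential.
Context {R : realType}.
Notation X := (R * R * R)%type.
Notation mu := (@lebesgue_measure R).
Variables (al : R) (p : R * R * R) (f : R -> R).
Notation x0 := (cos al).
Hypotheses (al01 : 0 < al < pi) (px0 : quad p x0 = 0)
  (q0 : forall w, -1 < w < x0 -> 0 <= quad (neg_der p) w)
  (mf : measurable_fun `]al, pi[ f)
  (f0 : forall phi, al < phi < pi -> 0 <= f phi)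
  (fE : forall phi, al < phi < pi ->
    (f phi)%:E = ((pi^-1)%:E * \int[mu]_(w in `](-1)%R, x0[)
       (quad (neg_der p) w * rsq (1 - w) * rsq (w - cos phi))%:E)%E).

Let x01 : -1 < x0 < 1.
Proof.
have /andP[a0 a1] := al01; have ap : al \in `[0, pi] by rewrite in_itv/= !ltW.
have p0 : 0 <= pi :> R by rewrite ltW// pi_gt0.
have z0 : (0 : R) \in `[0, pi] by rewrite in_itv/= lexx.
have pp : (pi : R) \in `[0, pi] by rewrite in_itv/= lexx p0.
by rewrite -cospi -(@cos0 R) !ltr_cos// a0 a1.
Qed.

Let cos_cap phi : al < phi < pi -> [/\ -1 < cos phi, cos phi < x0 & 0 <= sin phi].
Proof.
move=> /andP[h1 h2]; have /andP[a0 a1] := al01.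
have p0 : 0 <= pi :> R by rewrite ltW// pi_gt0.
split; last by apply: sin_ge0_pi; lra.
- by rewrite -cospi ltr_cos// in_itv/=; lra.
- by rewrite ltr_cos// in_itv/=; lra.
Qed.

Let mcos (d : measure_display) (T : measurableType d) (h : T -> R) :
  measurable_fun setT h -> measurable_fun setT (fun t => cos (h t)).
Proof. by move=> mh; apply: measurableT_comp mh => //; apply: continuous_measurable_fun; exact: continuous_cos. Qed.
Let msin (d : measure_display) (T : measurableType d) (h : T -> R) :
  measurable_fun setT h -> measurable_fun setT (fun t => sin (h t)).
Proof. by move=> mh; apply: measurableT_comp mh => //; apply: continuous_measurable_fun; exact: continuous_sin. Qed.
Let mrsq (d : measure_display) (T : measurableType d) (h : T -> R) :
  measurable_fun setT h -> measurable_fun setT (fun t => rsq (h t)).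
Proof. by move=> mh; apply: measurableT_comp mh => //; exact: measurable_rsq. Qed.
Let mquad (d : measure_display) (T : measurableType d) (h : T -> R) (r : R * R * R) :
  measurable_fun setT h -> measurable_fun setT (fun t => quad r (h t)).
Proof.
move=> mh; rewrite /quad; apply: measurable_funD; first apply: measurable_funD => //.
  by apply: measurable_funM.
by apply: measurable_funM => //; exact: measurable_funX.
Qed.
Let mfst : measurable_fun setT (fun z : R * R => z.1). Proof. exact: measurable_fst. Qed.
Let msnd : measurable_fun setT (fun z : R * R => z.2). Proof. exact: measurable_snd. Qed.

Let sg w : R := quad (neg_der p) w * rsq (1 - w).
Let sg_ge0 w : -1 < w < x0 -> 0 <= sg w.
Proof. by move=> w1; rewrite mulr_ge0 ?q0 ?rsq_ge0. Qed.
Let msg (d : measure_display) (T : measurableType d) (h : T -> R) :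
  measurable_fun setT h -> measurable_fun setT (fun t => sg (h t)).
Proof.
move=> mh; rewrite /sg; apply: measurable_funM; first exact: mquad.
by apply: mrsq; exact: measurable_funB.
Qed.

(** By the hypothesis fE the density is a superposition over w of the elementary
    densities rsq (w - cos phi), which reduces its integrals to theirs. *)
Let superpose (k : R -> R) : measurable_fun setT k -> (forall phi, al < phi < pi -> 0 <= k phi) ->
  (\int[mu]_(phi in `]al, pi[) (f phi * sin phi * k phi)%:E
   = (pi^-1)%:E * \int[mu]_(w in `](-1)%R, x0[) ((sg w)%:E *
        \int[mu]_(phi in `]al, pi[) (sin phi * rsq (w - cos phi) * k phi)%:E))%E.
Proof.
move=> mk k0; have p0 := @pi_gt0 R.
have mK : measurable_fun setT (fun z : R * R =>
    sg z.2 * (sin z.1 * rsq (z.2 - cos z.1) * k z.1)).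
  apply: measurable_funM; first exact: msg.
  apply: measurable_funM; last by apply: measurableT_comp mk mfst.
  apply: measurable_funM; first exact: msin.
  by apply: mrsq; apply: measurable_funB => //; exact: mcos.
have K0 (phi w : R) : `]al, pi[%classic phi -> `](-1)%R, x0[%classic w ->
    0 <= sg w * (sin phi * rsq (w - cos phi) * k phi).
  rewrite /= !in_itv/= => hp hw; have [_ _ s0] := cos_cap hp.
  by rewrite mulr_ge0 ?sg_ge0// mulr_ge0 ?k0// mulr_ge0 ?rsq_ge0.
transitivity (\int[mu]_(phi in `]al, pi[) ((pi^-1)%:E * \int[mu]_(w in `](-1)%R, x0[)
    (sg w * (sin phi * rsq (w - cos phi) * k phi))%:E))%E.
  apply: eq_integral => phi; rewrite inE/= in_itv/= => hp; have [_ _ s0] := cos_cap hp.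
  have -> : (f phi * sin phi * k phi)%:E = ((f phi)%:E * (sin phi * k phi)%:E)%E.
    by rewrite -EFinM mulrA.
  rewrite fE// -muleA; congr (_ * _)%E; rewrite muleC -ge0_integralZl//.
  - by apply: eq_integral => w _; rewrite -EFinM; congr EFin; rewrite /sg; ring.
  - apply/measurable_EFinP; apply: measurable_funTS.
    apply: measurable_funM; first exact: msg.
    by apply: mrsq; exact: measurable_funB.
  - by move=> w; rewrite /= in_itv/= => hw; rewrite lee_fin mulr_ge0 ?rsq_ge0 ?sg_ge0.
  - by rewrite lee_fin mulr_ge0 ?k0.
rewrite ge0_integralZl//; last 3 first.
- apply: (@measurable_integral2 R _ _ (fun phi w => sg w * (sin phi * rsq (w - cos phi) * k phi))) => //; exact: measurable_itv.
- move=> phi hp; apply: integral_ge0 => w hw; rewrite lee_fin; exact: K0.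
- by rewrite lee_fin invr_ge0 ltW.
congr (_ * _)%E.
rewrite (@tonelli_set R _ _ (fun phi w => sg w * (sin phi * rsq (w - cos phi) * k phi)))//; try exact: measurable_itv.
apply: eq_integral => w; rewrite inE/= in_itv/= => hw.
under eq_integral do rewrite EFinM.
rewrite ge0_integralZl//.
- apply/measurable_EFinP; apply: measurable_funTS; apply: measurable_funM => //.
  apply: measurable_funM; first exact: msin.
  by apply: mrsq; apply: measurable_funB => //; exact: mcos.
- move=> phi; rewrite /= in_itv/= => hp; have [_ _ s0] := cos_cap hp.
  by rewrite lee_fin mulr_ge0 ?k0// mulr_ge0 ?rsq_ge0.
- by rewrite lee_fin sg_ge0.
Qed.

(** The density solves Abel's equation: since the elementary transforms of
    [integral_arcsine] are constant, only the integral of - S' from z to x0 is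
    left, and S(x0) = 0. *)
Lemma dens_abel z : -1 <= z -> z < 1 ->
  (\int[mu]_(phi in `]al, pi[) (f phi * sin phi * rsq (cos phi - z))%:E
   = (if (z < x0)%R then Num.sqrt (1 - z) * quad p z else 0)%:E)%E.
Proof.
move=> z1 z2; have p0 := @pi_gt0 R; have /andP[x1 x2] := x01.
have /andP[a0 a1] := al01.
have [zx|zx] := ltP z x0; last first.
  apply: integral0_eq => phi; rewrite /= in_itv/= => hp; have [_ c2 _] := cos_cap hp.
  by rewrite (@rsq_le0 _ (cos phi - z)) ?mulr0//; lra.
rewrite (@superpose (fun phi => rsq (cos phi - z))); last 2 first.
- by apply: mrsq; apply: measurable_funB => //; exact: mcos.
- by move=> *; exact: rsq_ge0.
have sub : (`]z, x0[ : set R) `<=` `](-1)%R, x0[.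
  by move=> w; rewrite /= !in_itv/=; lra.
rewrite (@eq_integral_supp _ `]z, x0[%classic); first last.
- move=> w; rewrite /= !in_itv/= => /andP[w1 w2] /negP; rewrite w2 andbT -leNgt => wz.
  rewrite integral0_eq ?mule0// => phi _.
  have [c|c] := leP w (cos phi).
    by rewrite (@rsq_le0 _ (w - cos phi)) ?mulr0 ?mul0r//; lra.
  by rewrite (@rsq_le0 _ (cos phi - z)) ?mulr0//; lra.
- exact: sub.
transitivity ((pi^-1)%:E * \int[mu]_(w in `]z, x0[) (pi%:E * (sg w)%:E))%E.
  congr (_ * _)%E; apply: eq_integral => w; rewrite inE/= in_itv/= => /andP[w1 w2].
  by rewrite integral_arcsine 1?muleC//; lra.
rewrite ge0_integralZl//; first last.
- by rewrite lee_fin ltW.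
- by move=> w /sub; rewrite /= in_itv/= => hw; rewrite lee_fin sg_ge0.
- by apply/measurable_EFinP; apply: measurable_funTS; exact: (msg (h := id)).
rewrite muleA -EFinM mulVf ?gt_eqF// mul1e integral_neg_der//.
- by rewrite px0 mulr0 subr0.
- by move=> w hw; apply: q0; lra.
Qed.

Lemma dens_mass :
  let q := neg_der p in
  let m2 := - q.2 / 3 in
  let m1 := - (q.1.2 + q.2) / 2 in
  let m0 := 2 * m2 - (q.1.1 + q.1.2) in
  (\int[mu]_(phi in `]al, pi[) (f phi * sin phi)%:E
   = (2 / pi * ((q.1.1 - m1) * (asn x0 + pi / 2)
      + (m0 + m1 * x0 + m2 * x0 ^+ 2) * Num.sqrt (1 - x0 ^+ 2)))%:E)%E.
Proof.
move=> q m2 m1 m0; have p0 := @pi_gt0 R; have /andP[a0 a1] := al01.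
have /andP[x1 x2] := x01.
transitivity (\int[mu]_(phi in `]al, pi[) (f phi * sin phi * 1)%:E)%E.
  by apply: eq_integral => phi _; rewrite mulr1.
rewrite (@superpose (fun=> 1))//.
transitivity ((pi^-1)%:E * \int[mu]_(w in `](-1)%R, x0[) (2%:E * (sg w * Num.sqrt (1 + w))%:E))%E.
  congr (_ * _)%E; apply: eq_integral => w; rewrite inE/= in_itv/= => /andP[w1 w2].
  under eq_integral do rewrite mulr1.
  by rewrite integral_sin_rsq -?EFinM; [congr EFin; ring| | |]; lra.
rewrite ge0_integralZl//; first last.
- by move=> w; rewrite /= in_itv/= => hw; rewrite lee_fin mulr_ge0 ?sg_ge0 ?sqrtr_ge0.
- apply/measurable_EFinP; apply: measurable_funTS; apply: measurable_funM; first exact: (msg (h := id)).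
  apply: (measurableT_comp (f := @Num.sqrt R)); last exact: measurable_funD.
  by apply: continuous_measurable_fun; exact: sqrt_continuous.
rewrite integral_mass//.
by rewrite -!EFinM; congr EFin; rewrite mulrA [pi^-1 * 2]mulrC.
Qed.

Definition cap_potential (t0 phi0 : R) : \bar R :=
  (\int[mu]_(phi in `]al, pi[) \int[mu]_(theta in `[0%R, (2 * pi)%R])
     ((f phi * sin phi)%:E *
      ((enorm (sph_point t0 phi0 - sph_point theta phi))%:E)^-1))%E.

Lemma sph_sphere (t phi : R) : sphere (sph_point t phi).
Proof.
apply/sphereP; rewrite /dot/=.
transitivity (sin phi ^+ 2 * (cos t ^+ 2 + sin t ^+ 2) + cos phi ^+ 2); first by ring.
by rewrite cos2Dsin2 mulr1 addrC cos2Dsin2.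
Qed.

Lemma dot_sph (t phi t' phi' : R) : dot (sph_point t phi) (sph_point t' phi') =
  cos phi * cos phi' + sin phi * sin phi' * cos (t' - t).
Proof. by rewrite /dot/= cosB; ring. Qed.

Lemma sin_sqrt phi : 0 <= phi <= pi -> sin phi = Num.sqrt (1 - cos phi ^+ 2) :> R.
Proof. by move=> hp; rewrite -sin2cos2 sqrtr_sqr ger0_norm// sin_ge0_pi. Qed.

Let cos_itv (a : R) : 0 < a < pi -> -1 < cos a < 1.
Proof.
move=> /andP[a0 a1]; have q1 := @pi_gt0 R.
have z0 : (0 : R) \in `[0, pi] by rewrite in_itv/= lexx ltW.
have pp : (pi : R) \in `[0, pi] by rewrite in_itv/= lexx ltW.
have aa : a \in `[0, pi] by rewrite in_itv/= !ltW.
by rewrite -cospi -(@cos0 R) !ltr_cos// a0 a1.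
Qed.

(** The two circles are disjoint, so the inverse in the extended reals is the
    real one. *)
Lemma ring_kernel (t0 phi0 phi th : R) : 0 < phi0 < pi -> 0 < phi < pi -> phi != phi0 ->
  ((enorm (sph_point t0 phi0 - sph_point th phi))%:E^-1)%E =
  (rsq (2 - 2 * (cos phi0 * cos phi + Num.sqrt (1 - cos phi0 ^+ 2) * Num.sqrt (1 - cos phi ^+ 2)
     * cos (th - t0))))%:E /\ cos phi0 != cos phi.
Proof.
move=> p01 p1 ne.
have ne' : cos phi0 != cos phi.
  apply: contra ne => /eqP e; apply/eqP.
  by apply: cos_inj; rewrite ?in_itv/=; lra.
split=> //.
have e : enorm (sph_point t0 phi0 - sph_point th phi) =
  Num.sqrt (2 - 2 * (cos phi0 * cos phi + Num.sqrt (1 - cos phi0 ^+ 2) * Num.sqrt (1 - cos phi ^+ 2) * cos (th - t0))).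
  rewrite enorm_sub ?dot_sph; try exact: sph_sphere.
  by rewrite -!sin_sqrt; [congr Num.sqrt; ring|lra|lra].
rewrite e inver ifF//; apply/negbTE; rewrite gt_eqF// sqrtr_gt0.
by apply: dist_sqr_gt0 => //; exact: cos_itv.
Qed.

Lemma ring_potential (t0 phi0 phi : R) : 0 <= t0 <= 2 * pi -> 0 < phi0 < pi -> 0 < phi < pi ->
  phi != phi0 ->
  (\int[mu]_(theta in `[0%R, (2 * pi)%R]) ((enorm (sph_point t0 phi0 - sph_point theta phi))%:E)^-1
   = 2%:E * \int[mu]_(z in `](-1)%R, 1%R[)
       (rsq (1 - z ^+ 2) * rsq (cos phi0 - z) * rsq (cos phi - z))%:E)%E.
Proof.
move=> t01 p01 p1 ne; have [_ ne'] := ring_kernel t0 0 p01 p1 ne.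
rewrite -(@circle_integral R (cos phi0) (cos phi) t0)//; try exact: cos_itv.
by apply: eq_integral => th _; have [] := ring_kernel t0 th p01 p1 ne.
Qed.

(* p is nonnegative below x0, as its Abel transform is that of a density *)
Let p_ge0 z : -1 < z < x0 -> 0 <= quad p z.
Proof.
move=> /andP[z1 z2]; have /andP[x1 x2] := x01.
have := @dens_abel z (ltW z1) (lt_trans z2 x2); rewrite z2 => e.
have : (0 <= (Num.sqrt (1 - z) * quad p z)%:E)%E.
  rewrite -e; apply: integral_ge0 => phi; rewrite /= in_itv/= => hp.
  by have [_ _ s0] := cos_cap hp; rewrite lee_fin mulr_ge0 ?rsq_ge0// mulr_ge0 ?f0.
by rewrite lee_fin pmulr_rge0// sqrtr_gt0 subr_gt0 (lt_trans z2).
Qed.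

(** The circles of latitude of the cap act through [circle_integral].  After
    the exchange of the integrals over phi and z, the inner one is
    [dens_abel]; its result vanishes above x0, and the factor sqrt (1 - z)
    turns 1 / sqrt (1 - z^2) into 1 / sqrt (1 + z). *)
Lemma cap_potentialE (t0 phi0 : R) : 0 <= t0 <= 2 * pi -> 0 < phi0 < pi ->
  cap_potential t0 phi0 =
  (2 * (Apot p (cos phi0) (Num.min x0 (cos phi0)) - Apot p (cos phi0) (-1)))%:E.
Proof.
move=> t01 p01; have /andP[a0 a1] := al01; have /andP[x1 x2] := x01.
have /andP[c1 c2] := cos_itv p01; set xi := cos phi0 in c1 c2 *.
pose ff := f \_ `]al, pi[.
have ffE phi : al < phi < pi -> ff phi = f phi.
  by move=> hp; rewrite /ff patchE ifT// inE/= in_itv/=.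
have mff : measurable_fun setT ff.
  by apply/(measurable_restrictT _ _).1 => //; exact: measurable_itv.
pose k phi z := 2 * (rsq (1 - z ^+ 2) * rsq (xi - z)) * (ff phi * sin phi * rsq (cos phi - z)).
have mk : measurable_fun setT (fun z : R * R => k z.1 z.2).
  rewrite /k; apply: measurable_funM.
    apply: measurable_funM => //; apply: measurable_funM.
      by apply: mrsq; apply: measurable_funB => //; exact: measurable_funX.
    by apply: mrsq; exact: measurable_funB.
  apply: measurable_funM.
    by apply: measurable_funM; [apply: measurableT_comp mff mfst|exact: msin].
  by apply: mrsq; apply: measurable_funB => //; exact: mcos.
have k0 (phi z : R) : `]al, pi[%classic phi -> `](-1)%R, 1%R[%classic z -> 0 <= k phi z.
  rewrite /= !in_itv/= => hp hz; have [_ _ s0] := cos_cap hp.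
  rewrite /k ffE//; apply: mulr_ge0; first by rewrite !mulr_ge0 ?rsq_ge0.
  by rewrite mulr_ge0 ?rsq_ge0// mulr_ge0 ?f0.
have mD : measurable (`]al, pi[ : set R) by exact: measurable_itv.
have mE : measurable (`](-1)%R, 1%R[ : set R) by exact: measurable_itv.
have mg := measurable_integral2 mD mE mk k0.
pose g phi := (\int[mu]_(z in `](-1)%R, 1%R[) (k phi z)%:E)%E.
have mD1 : measurable (`]al, pi[ `\ phi0) by apply: measurableD.
have eg phi : phi \in (`]al, pi[ `\ phi0) ->
   (\int[mu]_(theta in `[0%R, (2 * pi)%R]) ((f phi * sin phi)%:E *
      ((enorm (sph_point t0 phi0 - sph_point theta phi))%:E)^-1) = g phi)%E.
  rewrite inE => -[/=]; rewrite in_itv/= => hp /eqP ne.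
  have [_ _ s0] := cos_cap hp.
  have p1 : 0 < phi < pi by lra.
  rewrite ge0_integralZl//; first last.
  - by rewrite lee_fin mulr_ge0 ?f0.
  - by move=> th _; have [-> _] := ring_kernel t0 th p01 p1 ne; rewrite lee_fin rsq_ge0.
  - rewrite (_ : (fun th => _) = fun th => (rsq (2 - 2 * (cos phi0 * cos phi +
        Num.sqrt (1 - cos phi0 ^+ 2) * Num.sqrt (1 - cos phi ^+ 2) * cos (th - t0))))%:E); last first.
      by apply/funext => th; have [-> _] := ring_kernel t0 th p01 p1 ne.
    apply/measurable_EFinP; apply: measurable_funTS; apply: mrsq.
    apply: measurable_funB => //; apply: measurable_funM => //.
    apply: measurable_funD => //; apply: measurable_funM => //; apply: mcos.
    exact: measurable_funB.
  rewrite ring_potential// muleA -EFinM -ge0_integralZl//.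
  - apply: eq_integral => z _; rewrite -EFinM /k ffE// -/xi; congr EFin; ring.
  - apply/measurable_EFinP; apply: measurable_funTS; apply: measurable_funM.
      by apply: measurable_funM; apply: mrsq; apply: measurable_funB => //; exact: measurable_funX.
    by apply: mrsq; exact: measurable_funB.
  - by move=> z _; rewrite lee_fin !mulr_ge0 ?rsq_ge0.
  - by rewrite lee_fin mulr_ge0// mulr_ge0 ?f0.
(* the circle through the point itself is one value of phi, left out *)
rewrite /cap_potential -(@integral_setD1 R _ phi0)//; last first.
  apply: (eq_measurable_fun g); first by move=> phi /eg ->.
  by apply: measurable_funS mg => //; exact: subDsetl.
under eq_integral do rewrite eg//.
rewrite integral_setD1//; last by apply: measurable_funS mg => //; exact: subDsetl.
rewrite /g tonelli_set//.
pose h z : R := if z < x0 then Num.sqrt (1 - z) * quad p z else 0.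
transitivity (\int[mu]_(z in `](-1)%R, 1%R[) (2 * (rsq (1 - z ^+ 2) * rsq (xi - z)) * h z)%:E)%E.
  apply: eq_integral => z; rewrite inE/= in_itv/= => /andP[z1 z2].
  under eq_integral do rewrite /k EFinM.
  rewrite ge0_integralZl//; first last.
  - by rewrite lee_fin !mulr_ge0 ?rsq_ge0.
  - move=> phi; rewrite /= in_itv/= => hp; have [_ _ s0] := cos_cap hp.
    by rewrite ffE// lee_fin mulr_ge0 ?rsq_ge0// mulr_ge0 ?f0.
  - apply/measurable_EFinP; apply: measurable_funTS; apply: measurable_funM.
      by apply: measurable_funM => //; exact: (msin (h := id)).
    by apply: mrsq; apply: measurable_funB => //; exact: (mcos (h := id)).
  rewrite (EFinM _ (h z)); congr (_ * _)%E; rewrite /h -(dens_abel (ltW z1) z2).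
  by apply: eq_integral => phi; rewrite inE/= in_itv/= => hp; rewrite ffE.
set m := Num.min x0 xi.
have m1 : -1 < m by rewrite lt_min x1.
have mx : m <= x0 by rewrite ge_min lexx.
have mxi : m <= xi by rewrite ge_min lexx orbT.
rewrite (@eq_integral_supp _ `](-1)%R, m[%classic); first last.
- move=> z; rewrite /= !in_itv/= => /andP[z1 z2] /negP; rewrite z1/= -leNgt ge_min => /orP[le|le].
    by rewrite /h ltNge le/= mulr0.
  by rewrite (@rsq_le0 _ (xi - z)) ?mulr0 ?mul0r// subr_le0.
- by move=> z; rewrite /= !in_itv/= => /andP[-> zm]; rewrite (lt_trans zm)// (le_lt_trans mx).
have q1 z : -1 < z < m -> 0 <= quad p z.
  by move=> /andP[z1 z2]; apply: p_ge0; rewrite z1 (lt_le_trans z2).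
rewrite [RHS]EFinM -(integral_pot m1 mxi q1) -ge0_integralZl//.
- apply: eq_integral => z; rewrite inE/= in_itv/= => /andP[z1 z2].
  have zx : z < x0 by exact: lt_le_trans mx.
  rewrite -EFinM; congr EFin; rewrite /h zx.
  have -> : 1 - z ^+ 2 = (1 - z) * (1 + z) by ring.
  have z3 : 0 < 1 - z by lra.
  rewrite rsqM ?(ltW z3)//.
  have e : rsq (1 - z) * Num.sqrt (1 - z) = 1 by rewrite /rsq mulVf// gt_eqF// sqrtr_gt0.
  transitivity (2 * (rsq (1 + z) * rsq (xi - z)) * (rsq (1 - z) * Num.sqrt (1 - z)) * quad p z).
    by ring.
  by rewrite e; ring.
- apply/measurable_EFinP; apply: measurable_funTS; apply: measurable_funM.
    apply: measurable_funM; first exact: (mquad (h := id)).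
    by apply: mrsq; exact: measurable_funD.
  by apply: mrsq; exact: measurable_funB.
- by move=> z; rewrite /= in_itv/= => hz; rewrite lee_fin !mulr_ge0 ?rsq_ge0 ?q1.
Qed.

End Potential.

(** * The quadratic polynomial attached to the external field *)

Section Coefficients.
Context {R : realType}.
Notation mu := (@lebesgue_measure R).
Variables (a b c al : R).
Hypotheses (a_gt0 : 0 < a) (b_gt0 : 0 < b) (hab : 4 * a ^+ 2 < b ^+ 2)
  (al01 : 0 < al < pi) (sol : transcendental_eq a b al).
Notation x0 := (cos al).
Notation F := (F_const a b c al).
Notation f := (density a b c al).

(** The polynomial P for which 2 int P(z) / sqrt ((1 + z) (xi - z)) dz, from -1
    to xi, is F - a xi^2 - b xi - c. *)
Definition pcoef : R * R * R :=
  ((F - c + a / 3 - b) / (2 * pi), - (4 / 3 * a + 2 * b) / (2 * pi), - (8 / 3 * a) / (2 * pi)).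

Let p0 : 0 < pi :> R. Proof. exact: pi_gt0. Qed.
Let s0 : 0 < sin al. Proof. by apply: sin_gt0_pi. Qed.
Let s2 : sin al ^+ 2 = 1 - x0 ^+ 2. Proof. exact: sin2cos2. Qed.
Let x01 : -1 < x0 < 1.
Proof. by have h := s0; have e := s2; apply/andP; split; nra. Qed.
Let b2a : 2 * a < b.
Proof. by have := a_gt0; have := b_gt0; have := hab; nra. Qed.
Ltac hyps := have h_p0 := p0; have h_s0 := s0; have h_al := al01; have h_x := x01;
  have h_a := a_gt0; have h_b := b_gt0; have h_ba := b2a.

Lemma tan_half_polar : tan (al / 2) = (1 - x0) / sin al.
Proof.
hyps.
have e : al = al / 2 + al / 2 by field.
have h0 : 0 < al / 2 < pi / 2 by lra.
have sh : 0 < sin (al / 2) by apply: sin_gt0_pi; lra.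
have ch : 0 < cos (al / 2) by apply: cos_gt0_pihalf; lra.
have h2 := cos2Dsin2 (al / 2).
have -> : sin al = 2 * sin (al / 2) * cos (al / 2) by rewrite {1}e sinD; ring.
have -> : x0 = 1 - 2 * sin (al / 2) ^+ 2 by rewrite {1}e cosD -!expr2; lra.
by rewrite /tan; field; lra.
Qed.

(* the cubic that multiplies tan (al / 2) in F_const has the factor 1 + x0, and
   (1 - x0) (1 + x0) = sin^2 al *)
Let FE : F * (36 * (pi - al + sin al)) =
  sin al * (32 * a * x0 ^+ 2 + (36 * b - 24 * a) * x0 + 36 * c + 4 * a - 36 * b)
  + 12 * (a + 3 * c) * (pi - al) + 36 * pi.
Proof.
hyps.
rewrite /F_const mulrC mulVKf; last by lra.
congr (_ + _ + _); rewrite tan_half_polar.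
apply: (@mulfI _ (sin al * (1 + x0))); first by rewrite mulf_neq0//; lra.
transitivity ((1 - x0 ^+ 2) * (1 + x0) * (32 * a * x0 ^+ 2 + (36 * b - 24 * a) * x0 + 36 * c + 4 * a - 36 * b)).
  by field; lra.
by rewrite -s2; ring.
Qed.

(* P(x0) = 0 solved for F: (x0 - 1) times the difference of the two formulas
   for F is a multiple of the difference of the sides of the transcendental
   equation *)
Let FP : F = 8 / 3 * a * x0 ^+ 2 + (4 / 3 * a + 2 * b) * x0 + c - a / 3 + b.
Proof.
hyps.
have T0 : 36 * (pi - al + sin al) != 0 by lra.
apply: (mulIf T0); rewrite FE; apply: (@mulfI _ (x0 - 1)); first by lra.
move: sol; rewrite /transcendental_eq.
have -> : sin (2 * al) = 2 * sin al * x0 by rewrite mulr_natl mulr2n sinD; ring.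
move=> H.
move: (cos al) (sin al) H => x s H.
apply/eqP; rewrite -subr_eq0; apply/eqP.
transitivity (4 * (9 * x * (pi + (2 * a + b) * (pi - al)) - 2 * s * (2 * a - 9 * b)) -
  4 * (9 * x * (pi + (2 * a + b) * (pi - al)) - 2 * s * (2 * a - 9 * b))); last by ring.
by rewrite -{2}H; field.
Qed.

Lemma pcoef_root : quad pcoef x0 = 0.
Proof.
hyps. by rewrite /quad /pcoef/= FP; field; lra. Qed.

Let quadE z : quad pcoef z = (x0 - z) * (8 / 3 * a * (z + x0) + 4 / 3 * a + 2 * b) / (2 * pi).
Proof.
hyps. by rewrite /quad /pcoef/= FP; field; lra. Qed.

Lemma pcoef_le0 z : x0 <= z -> z <= 1 -> quad pcoef z <= 0.
Proof.
hyps.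
move=> z1 z2; rewrite quadE pmulr_lle0 ?invr_gt0 ?mulr_gt0//.
by rewrite mulr_le0_ge0 ?subr_le0//; nra.
Qed.

(* 2 a < b makes - P' at least (2 b - 4 a) / (2 pi) on [-1, 1] *)
Let pc_lower : R := (1 - x0) * (2 * b - 4 * a) / (2 * pi).
Let pc_lower_gt0 : 0 < pc_lower.
Proof.
hyps. by rewrite /pc_lower divr_gt0 ?mulr_gt0//; lra. Qed.

Let neg_der_ge w : -1 < w < x0 -> pc_lower <= quad (neg_der pcoef) w.
Proof.
hyps.
move=> /andP[w1 w2].
have -> : quad (neg_der pcoef) w = ((x0 - w) * (8 / 3 * a * (w + x0) + 4 / 3 * a + 2 * b) / 2
   + (1 - w) * (4 / 3 * a + 2 * b + 16 / 3 * a * w)) / (2 * pi).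
  by rewrite /quad /neg_der /pcoef/= FP; field; lra.
rewrite /pc_lower ler_pM2r ?invr_gt0 ?mulr_gt0//.
have h1 : 0 <= (x0 - w) * (8 / 3 * a * (w + x0) + 4 / 3 * a + 2 * b).
  by rewrite mulr_ge0 ?subr_ge0 ?(ltW w2)//; nra.
have h2 : (1 - x0) * (2 * b - 4 * a) <= (1 - w) * (4 / 3 * a + 2 * b + 16 / 3 * a * w).
  by apply: ler_pM; nra.
by lra.
Qed.

Lemma neg_der_pcoef_ge0 w : -1 < w < x0 -> 0 <= quad (neg_der pcoef) w.
Proof.
hyps. by move=> /neg_der_ge; apply: le_trans; exact: ltW. Qed.

Let cosb phi : al < phi < pi -> -1 < cos phi < x0.
Proof.
hyps.
move=> /andP[h1 h2].
have pp : (pi : R) \in `[0, pi] by rewrite in_itv/= lexx ltW.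
have q1 : phi \in `[0, pi] by rewrite in_itv/=; lra.
have q2 : al \in `[0, pi] by rewrite in_itv/=; lra.
by rewrite -cospi !ltr_cos// h1 h2.
Qed.

(** In terms of u = sqrt (1 - x0) and v = sqrt (x0 - cos phi) both sides are
    rational functions of u, v and of t = atan (v / u); the arctangent of the
    inverse quotient is pi / 2 - t. *)
Lemma densityE phi : al < phi < pi ->
  (f phi)%:E = ((pi^-1)%:E * \int[mu]_(w in `](-1)%R, x0[)
       (quad (neg_der pcoef) w * rsq (1 - w) * rsq (w - cos phi))%:E)%E.
Proof.
hyps.
move=> hp; have /andP[y1 y2] := cosb hp; have /andP[x1 x2] := x01.
rewrite (@eq_integral_supp _ `](cos phi), x0[%classic); first last.
- move=> w; rewrite /= !in_itv/= => /andP[w1 w2] /negP; rewrite w2 andbT -leNgt => wy.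
  by rewrite (@rsq_le0 _ (w - cos phi)) ?mulr0// subr_le0.
- by move=> w; rewrite /= !in_itv/=; lra.
rewrite integral_dens//; last by move=> w hw; apply: neg_der_pcoef_ge0; lra.
rewrite -EFinM; congr EFin.
rewrite /density /F_fun FP.
have -> : cos (2 * phi) = 2 * cos phi ^+ 2 - 1.
  by rewrite mulr_natl mulr2n cosD -!expr2 sin2cos2; ring.
rewrite /pcoef /neg_der/= FP.
set x := x0 in x1 x2 y2 *; set y := cos phi in y1 y2 *.
pose u := Num.sqrt (1 - x); pose v := Num.sqrt (x - y).
have u0 : 0 < u by rewrite sqrtr_gt0; lra.
have v0 : 0 < v by rewrite sqrtr_gt0; lra.
have u2 : 1 - x = u ^+ 2 by rewrite sqr_sqrtr//; lra.
have v2 : x - y = v ^+ 2 by rewrite sqr_sqrtr//; lra.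
have -> : Num.sqrt ((1 - x) / (x - y)) = u / v.
  by rewrite sqrtrM ?sqrtrV//; lra.
have -> : Num.sqrt ((x - y) / (1 - x)) = v / u.
  by rewrite sqrtrM ?sqrtrV//; lra.
rewrite -/u -/v.
have -> : atan (u / v) = pi / 2 - atan (v / u).
  have vu : 0 < v / u by exact: divr_gt0.
  have tv : tan (pi / 2 - atan (v / u)) = u / v.
    have -> : u / v = (tan (atan (v / u)))^-1 by rewrite atanK invf_div.
    by rewrite /tan sinB cosB sin_pihalf cos_pihalf !mul0r !mul1r subr0 add0r invf_div.
  rewrite -tv tanK//.
  have := atan_ltpi2 (v / u); have : 0 < atan (v / u) by rewrite -atan0 lt_atan.
  by rewrite in_itv/=; lra.
have ex : x = 1 - u ^+ 2 by lra.
have ey : y = 1 - u ^+ 2 - v ^+ 2 by lra.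
rewrite ex ey; set t := atan _.
by field; lra.
Qed.

Let measurable_dens_kernel (A : set R) y : measurable_fun A
  (fun w : R => (quad (neg_der pcoef) w * rsq (1 - w) * rsq (w - y))%:E).
Proof.
apply/measurable_EFinP; apply: measurable_funTS.
apply: measurable_funM; first apply: measurable_funM.
- by apply: continuous_measurable_fun => w; rewrite /quad; conta.
- by apply: measurableT_comp measurable_rsq _; exact: measurable_funB.
- by apply: measurableT_comp measurable_rsq _; exact: measurable_funB.
Qed.

Lemma density_gt0 phi : al < phi < pi -> 0 < f phi.
Proof.
hyps.
move=> hp; have /andP[y1 y2] := cosb hp; have /andP[x1 x2] := x01.
have r2 : 0 < rsq 2 :> R by rewrite rsq_gt0.
have k0 : 0 < pc_lower * rsq 2 * rsq 2 by exact: (mulr_gt0 (mulr_gt0 pc_lower_gt0 r2) r2).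
rewrite -lte_fin densityE// mule_gt0// ?lte_fin ?invr_gt0//.
apply: (@lt_le_trans _ _ (\int[mu]_(w in `](cos phi), x0[) cst (pc_lower * rsq 2 * rsq 2)%:E w)%E).
  rewrite integral_cst//= lebesgue_measure_itv/= lte_fin y2 -EFinD -EFinM lte_fin.
  by rewrite mulr_gt0 ?subr_gt0.
apply: (@le_trans _ _ (\int[mu]_(w in `](cos phi), x0[) (quad (neg_der pcoef) w * rsq (1 - w) * rsq (w - cos phi))%:E)%E).
  apply: ge0_le_integral => //.
  - by move=> w _; rewrite lee_fin ltW.
  - exact: measurable_dens_kernel.
  - move=> w; rewrite /= in_itv/= => /andP[w1 w2]; rewrite lee_fin.
    have h : pc_lower <= quad (neg_der pcoef) w by apply: neg_der_ge; lra.
    have l0 := ltW pc_lower_gt0.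
    have h3 : rsq 2 <= rsq (1 - w) by apply: rsq_anti; lra.
    have h4 : rsq 2 <= rsq (w - cos phi) by apply: rsq_anti; lra.
    have r2' := ltW r2.
    exact: (ler_pM (mulr_ge0 l0 r2') r2' (ler_pM l0 r2' h h3) h4).
apply: ge0_subset_integral => //.
- exact: measurable_dens_kernel.
- by move=> w; rewrite /= in_itv/= => hw; rewrite lee_fin !mulr_ge0 ?rsq_ge0// neg_der_pcoef_ge0.
- by move=> w; rewrite /= !in_itv/=; lra.
Qed.

Lemma measurable_density : measurable_fun `]al, pi[ f.
Proof.
hyps.
apply: open_continuous_measurable_fun; first exact: interval_open.
move=> phi; rewrite inE/= in_itv/= => hp; have /andP[y1 y2] := cosb hp; have /andP[x1 x2] := x01.
rewrite /density /F_fun; conta; lra.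
Qed.

(** The left-hand side is the mass computed in [dens_mass], for a density per
    unit of azimuth.  Since P(x0) = 0, the claim becomes a linear equation
    for F, which is the definition of F_const. *)
Lemma mass_pcoef :
  let q := neg_der pcoef in
  let m2 := - q.2 / 3 in
  let m1 := - (q.1.2 + q.2) / 2 in
  let m0 := 2 * m2 - (q.1.1 + q.1.2) in
  2 / pi * ((q.1.1 - m1) * (asn x0 + pi / 2)
      + (m0 + m1 * x0 + m2 * x0 ^+ 2) * Num.sqrt (1 - x0 ^+ 2)) = (2 * pi)^-1.
Proof.
hyps.
move=> q m2 m1 m0.
rewrite -s2 sqrtr_sqr gtr0_norm// asn_cos; last by lra.
have -> : pi / 2 - al + pi / 2 = pi - al by field.
rewrite /m0 /m1 /m2 /q /neg_der /pcoef/=.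
apply: (@mulfI _ (36 * pi ^+ 2 * 2)); first by rewrite !mulf_neq0//; lra.
transitivity (36 * ((F - c - a / 3) * (pi - al)
  + (- (F - c + a / 3 - b) - 16 / 9 * a + (4 / 3 * a + 2 * b)
     + (3 / 2 * (4 / 3 * a + 2 * b) + 4 / 3 * a) * x0 + 40 / 9 * a * x0 ^+ 2) * sin al)); first by field; lra.
transitivity (36 * pi : R); last by field; lra.
transitivity (F * (36 * (pi - al + sin al)) - 36 * (c + a / 3) * (pi - al)
  + 36 * (- 2 * F + c - a / 3 + b - 16 / 9 * a + (4 / 3 * a + 2 * b)
     + (3 / 2 * (4 / 3 * a + 2 * b) + 4 / 3 * a) * x0 + 40 / 9 * a * x0 ^+ 2) * sin al); first by ring.
by rewrite FE FP; field.
Qed.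

Lemma potential_inside xi : -1 < xi ->
  2 * (Apot pcoef xi xi - Apot pcoef xi (-1)) = F - (a * xi ^+ 2 + b * xi + c).
Proof.
hyps. by move=> xi1; rewrite Apot_ends// /pcoef/=; field; lra. Qed.

(** Beyond x0 the integrand of the outer transform is nonpositive, and
    continuing it up to xi can only lower the value. *)
Lemma Apot_decr xi : x0 <= xi -> xi <= 1 -> Apot pcoef xi xi <= Apot pcoef xi x0.
Proof.
hyps.
move=> h1 h2; have /andP[x1 x2] := x01.
have i1 : x0 \in `[x0, xi] by rewrite in_itv/= lexx h1.
have i2 : xi \in `[x0, xi] by rewrite in_itv/= lexx h1.
apply: (ler0_derive1_le_cc _ _ _ i2 i1 h1).
- by move=> z; rewrite in_itv/= => hz; have /(@Apot_der R pcoef xi) [] : -1 < z < xi by lra.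
- move=> z; rewrite in_itv/= => hz.
  have d : is_derive z 1 (Apot pcoef xi) (quad pcoef z * rsq (1 + z) * rsq (xi - z)).
    by apply: Apot_der; lra.
  rewrite derive1E derive_val -mulrA mulr_le0_ge0 ?mulr_ge0 ?rsq_ge0//.
  by apply: pcoef_le0; lra.
- by apply: continuous_subspaceT => z; exact: Apot_cont.
Qed.

Lemma potential_ge xi : -1 < xi <= 1 ->
  F - (a * xi ^+ 2 + b * xi + c) <=
  2 * (Apot pcoef xi (Num.min x0 xi) - Apot pcoef xi (-1)).
Proof.
hyps.
move=> /andP[xi1 xi2]; rewrite -potential_inside// ler_pM2l// lerD2r.
by have [h|h] := leP x0 xi; [exact: Apot_decr|].
Qed.

Lemma potential_eq xi : -1 < xi <= x0 ->
  2 * (Apot pcoef xi (Num.min x0 xi) - Apot pcoef xi (-1)) = F - (a * xi ^+ 2 + b * xi + c).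
Proof.
hyps. by move=> /andP[xi1 xi2]; rewrite -potential_inside// (min_idPr _). Qed.

End Coefficients.

(** * Potentials, atoms and open sets *)

Section SphereMeasures.
Context {R : realType}.
Notation X := (R * R * R)%type.
Notation leb := (@lebesgue_measure R).
Implicit Types (m nu : probability X R) (x y : X).

Lemma measurable_kernel x : sphere x ->
  measurable_fun (@sphere R) (fun y => ((enorm (x - y))%:E)^-1%E).
Proof.
move=> sx; apply: (emeasurable_fun_cvg (fun M y => (kernel_trunc M x y)%:E)).
  by move=> M; exact: measurable_kernel_trunc.
by move=> y sy; exact: kernel_trunc_cvg.
Qed.

Definition potential nu x : \bar R := (\int[nu]_(y in sphere) ((enorm (x - y))%:E)^-1)%E.

Lemma kernel_ge0 x y : (0 <= ((enorm (x - y))%:E)^-1)%E.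
Proof. by rewrite inve_ge0 lee_fin sqrtr_ge0. Qed.

Lemma potential_ge0 nu x : (0 <= potential nu x)%E.
Proof. by apply: integral_ge0 => y _; exact: kernel_ge0. Qed.

Lemma measurable_potential nu : measurable_fun (@sphere R) (potential nu).
Proof.
apply: (emeasurable_fun_cvg (fun M x => \int[nu]_(y in sphere) (kernel_trunc M x y)%:E)%E).
  by move=> M; exact: measurable_inner_kernel_trunc.
move=> x sx.
have -> : potential nu x = (\int[nu]_(y in sphere) (limn (fun M => (kernel_trunc M x y)%:E)))%E.
  apply: eq_integral => y /set_mem sy; apply/esym/cvg_lim => //; exact: kernel_trunc_cvg.
apply: cvg_monotone_convergence => //.
- exact: measurable_sphere.
- by move=> M; exact: measurable_kernel_trunc.
- by move=> M y sy; rewrite lee_fin kernel_trunc_ge0.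
- by move=> y sy; exact: kernel_trunc_nd.
Qed.

Lemma sphere_sph_point x : sphere x -> exists t phi : R,
  [/\ 0 <= t <= 2 * pi, 0 <= phi <= pi & x = sph_point t phi].
Proof.
move=> sx; have [b1 b2 b3] := coord_bound sx; move/sphereP: sx.
case: x b1 b2 b3 => -[x1 x2] x3 /=; rewrite /dot/= => b1 b2 b3 h.
have p0 := @pi_gt0 R.
have c3 : -1 <= x3 <= 1 by rewrite -ler_norml.
pose phi := acos x3.
have cphi : cos phi = x3 by rewrite acosK ?in_itv.
have hphi : 0 <= phi <= pi by rewrite acos_ge0// acos_lepi.
have sphi0 : 0 <= sin phi by exact: sin_ge0_pi.
have s2 : sin phi ^+ 2 = x1 ^+ 2 + x2 ^+ 2 by rewrite sin2cos2 cphi; lra.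
have [sz|sz] := eqVneq (sin phi) 0.
  exists 0, phi; split; [by rewrite lexx mulr_ge0// ltW|exact: hphi|].
  move: s2; rewrite sz expr0n/= => s2.
  have e1 : x1 = 0 by nra.
  have e2 : x2 = 0 by nra.
  by rewrite /sph_point sz cphi e1 e2 !mul0r.
have sp : 0 < sin phi by rewrite lt_neqAle eq_sym sz.
pose u := x1 / sin phi.
have u2 : sin phi ^+ 2 * (1 - u ^+ 2) = x2 ^+ 2.
  have -> : sin phi ^+ 2 * (1 - u ^+ 2) = sin phi ^+ 2 - x1 ^+ 2 by rewrite /u; field; lra.
  by lra.
have u1 : -1 <= u <= 1.
  have : 0 <= 1 - u ^+ 2.
    by rewrite -(@pmulr_rge0 _ (sin phi ^+ 2)) ?exprn_gt0// u2 sqr_ge0.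
  by move=> h1; apply/andP; split; nra.
pose t := acos u.
have ct : cos t = u by rewrite acosK ?in_itv.
have ht : 0 <= t <= pi by rewrite acos_ge0// acos_lepi.
have st0 : 0 <= sin t by exact: sin_ge0_pi.
have st : (sin phi * sin t) ^+ 2 = x2 ^+ 2 by rewrite exprMn (sin2cos2 t) ct u2.
have sE : sin phi * sin t = `|x2|.
  by rewrite -[LHS]ger0_norm ?mulr_ge0// -!sqrtr_sqr st.
have e1 : sin phi * u = x1 by rewrite /u; field; lra.
have [x20|x20] := leP 0 x2.
  exists t, phi; split => //; first by lra.
  by rewrite /sph_point ct e1 cphi sE ger0_norm.
exists (2 * pi - t), phi; split => //; first by lra.
have -> : 2 * pi - t = - t + pi *+ 2 by rewrite mulr_natl addrC.
by rewrite /sph_point cosD2pi sinD2pi cosN sinN ct e1 cphi mulrN sE ltr0_norm// opprK.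
Qed.

Lemma measurable_point x : measurable [set x].
Proof.
have -> : [set x] = ([set x.1.1] `*` [set x.1.2]) `*` [set x.2].
  apply/seteqP; split=> [y -> //|[[y1 y2] y3]/= [[-> ->] ->]].
  by case: x => -[].
by apply: measurableX; [apply: measurableX|].
Qed.

Lemma integral_point m x (g : X -> \bar R) :
  (\int[m]_(y in [set x]) g y = g x * m [set x])%E.
Proof.
rewrite -integral_cst; last exact: measurable_point.
by apply: eq_integral => y; rewrite inE => ->.
Qed.

(** The kernel is +oo on the diagonal: an atom at x would make the potential
    infinite at x, and then the energy infinite. *)
Lemma finite_energy_point m x : sphere x -> (energy m < +oo)%E -> m [set x] = 0%E.
Proof.
move=> sx fin; apply/eqP; apply: contraT => n0.
have m0 : (0 < m [set x])%E by rewrite lt0e n0 measure_ge0.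
have sub : [set x] `<=` @sphere R by move=> y ->.
have ms := @measurable_sphere R; have mx := measurable_point x.
suff : (+oo <= energy m)%E by rewrite leye_eq => /eqP e; rewrite e in fin.
apply: (@le_trans _ _ (\int[m]_(y in [set x]) potential m y)%E); last first.
  apply: ge0_subset_integral => //; first exact: measurable_potential.
  by move=> y _; exact: potential_ge0.
rewrite integral_point.
have -> : potential m x = +oo%E; last by rewrite gt0_mulye.
apply/eqP; rewrite -leye_eq.
apply: (@le_trans _ _ (\int[m]_(y in [set x]) ((enorm (x - y))%:E)^-1)%E).
  rewrite integral_point; have -> : enorm (x - x) = 0.
    by rewrite /enorm subrr/= expr0n/= !addr0 sqrtr0.
  by rewrite inver eqxx gt0_mulye.
apply: ge0_subset_integral => //; first exact: measurable_kernel.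
by move=> y _; exact: kernel_ge0.
Qed.

(** The sup norm is the norm of the product, so that a neighbourhood of a point
    contains a box with rational faces around it, and there are countably many. *)
Lemma open_measurable_R3 (U : set X) : open U -> measurable U.
Proof.
move=> oU.
pose bx (q : (rat * rat) * (rat * rat) * (rat * rat)) : set X :=
  (`](ratr q.1.1.1), (ratr q.1.1.2)[ `*` `](ratr q.1.2.1), (ratr q.1.2.2)[)
   `*` `](ratr q.2.1), (ratr q.2.2)[.
have mbx q : measurable (bx q).
  apply: measurableX; last exact: measurable_itv.
  by apply: measurableX; exact: measurable_itv.
have -> : U = \bigcup_q (if pselect (bx q `<=` U) then bx q else set0).
  apply/seteqP; split=> [x Ux|x [q _]]; last by case: pselect => // s /s.
  have [e /= e0 he] : exists2 e : R, 0 < e & ball x e `<=` U by apply/nbhs_ballP; exact: open_nbhs_nbhs.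
  have near (r : R) : exists q : rat * rat, [/\ ratr q.1 < r, r < ratr q.2,
      r - e < ratr q.1 & ratr q.2 < r + e].
    have [q1] := @rat_in_itvoo R (r - e) r ltac:(by rewrite ltrBlDr ltrDl).
    have [q2] := @rat_in_itvoo R r (r + e) ltac:(by rewrite ltrDl).
    rewrite !in_itv/= => /andP[h1 h2] /andP[h3 h4]; by exists (q1, q2).
  have nb (u v q1 q2 : R) : u - e < q1 -> q2 < u + e -> q1 < v -> v < q2 -> `|u - v| < e.
    by clear; move=> ? ? ? ?; rewrite ltr_norml; apply/andP; split; lra.
  have [qa [a1 a2 a3 a4]] := near x.1.1.
  have [qb [b1 b2 b3 b4]] := near x.1.2.
  have [qc [c1 c2 c3 c4]] := near x.2.
  have sub : bx (qa, qb, qc) `<=` U.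
    move=> y; rewrite /bx/= !in_itv/= => -[[/andP[h1 h2] /andP[h3 h4]] /andP[h5 h6]].
    apply: he; split; [split|]; rewrite /ball/=.
    - exact: (nb _ _ _ _ a3 a4 h1 h2).
    - exact: (nb _ _ _ _ b3 b4 h3 h4).
    - exact: (nb _ _ _ _ c3 c4 h5 h6).
  apply: (ex_intro2 _ _ (qa, qb, qc) I) => /=; case: pselect => // ?.
  by rewrite /bx/= !in_itv/= a1 a2 b1 b2 c1 c2.
apply: countable_bigcupT_measurable; first exact: countableP.
move=> q; case: pselect => ?.
exact: mbx.
exact: measurable0.
Qed.

Let cfst3 : continuous (fun x : X => x.1). Proof. by move=> x; exact: cvg_fst. Qed.
Lemma continuous_c1 : continuous (fun x : X => x.1.1). Proof. by move=> x; apply: (continuous_comp (@cfst3 x)); exact: cvg_fst. Qed.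
Lemma continuous_c2 : continuous (fun x : X => x.1.2). Proof. by move=> x; apply: (continuous_comp (@cfst3 x)); exact: cvg_snd. Qed.
Lemma continuous_c3 : continuous (fun x : X => x.2). Proof. by move=> x; exact: cvg_snd. Qed.
Lemma continuous_enorm : continuous (@enorm R).
Proof.
move=> x. rewrite /enorm. 
have H := (@contSqrt _ _ _ _ (@contD _ _ _ _ _ (@contD _ _ _ _ _ (@contX _ _ _ 2 _ (@continuous_c1 x)) (@contX _ _ _ 2 _ (@continuous_c2 x))) (@contX _ _ _ 2 _ (@continuous_c3 x)))).
exact: H.
Qed.
Let k1 : continuous (fun x : R * R => x.1). Proof. by move=> x; exact: cvg_fst. Qed.
Let k2 : continuous (fun x : R * R => x.2). Proof. by move=> x; exact: cvg_snd. Qed.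
Lemma continuous_sphp : continuous (@sphp R).
Proof.
move=> z; rewrite /sphp /sph_point.
have A := @contM _ _ _ _ _ (@contSin _ _ _ _ (@k1 z)) (@contCos _ _ _ _ (@k2 z)).
have B := @contM _ _ _ _ _ (@contSin _ _ _ _ (@k1 z)) (@contSin _ _ _ _ (@k2 z)).
have C := @contCos _ _ _ _ (@k1 z).
have D := @cvg_pair _ _ _ (nbhs z) (nbhs (sin z.1 * cos z.2)) (nbhs (sin z.1 * sin z.2))
  (nbhs_filter _) (nbhs_filter _) (nbhs_filter _) _ _ A B.
have E := @cvg_pair _ _ _ (nbhs z) (nbhs (sin z.1 * cos z.2, sin z.1 * sin z.2)) (nbhs (cos z.1))
  (nbhs_filter _) (nbhs_filter _) (nbhs_filter _) _ _ D C.
exact: E.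
Qed.

Lemma integral_gt0 (A : set R) (g : R -> R) : measurable A -> measurable_fun A g ->
  (forall r, A r -> 0 < g r) -> (0 < leb A)%E -> (0 < \int[leb]_(x in A) (g x)%:E)%E.
Proof.
move=> mA mg g0 A0.
have i0 : (0 <= \int[leb]_(x in A) (g x)%:E)%E.
  by apply: integral_ge0 => x Ax; rewrite lee_fin ltW// g0.
rewrite lt0e i0 andbT; apply/eqP => e0.
have mgE : measurable_fun A (EFin \o g) by exact/measurable_EFinP.
have : (\int[leb]_(x in A) `|(EFin \o g) x| = 0)%E.
  rewrite -e0; apply: eq_integral => x /set_mem Ax.
  by rewrite gee0_abs// lee_fin ltW// g0.
move/(ae_eq_integral_abs leb mA mgE) => [N [mN N0 sub]].
have AN : A `<=` N.
  by move=> x Ax; apply: sub => /= /(_ Ax) [] e; have := g0 x Ax; rewrite e ltxx.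
suff : (leb A <= leb N)%E by rewrite N0 leNgt A0.
by apply: le_measure => //; rewrite inE.
Qed.

End SphereMeasures.

(** * The extremal measure *)

Section Extremal.
Context {R : realType}.
Notation X := (R * R * R)%type.
Notation leb := (@lebesgue_measure R).
Variables (a b c al : R).
Hypotheses (a_gt0 : 0 < a) (b_gt0 : 0 < b) (hab : 4 * a ^+ 2 < b ^+ 2)
  (hbc : b ^+ 2 <= 4 * a * c)
  (al01 : 0 < al < pi) (sol : transcendental_eq a b al).
Notation x0 := (cos al).
Notation F := (F_const a b c al).
Notation f := (density a b c al).
Notation Q := (quad_field a b c).
Notation p := (pcoef a b c al).

Let f0 phi : al < phi < pi -> 0 <= f phi.
Proof. by move=> h; apply/ltW/density_gt0. Qed.
Let mf : measurable_fun `]al, pi[ f. Proof. exact: measurable_density. Qed.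
Let al0 : 0 <= al. Proof. by case/andP: al01 => /ltW. Qed.

(* b^2 <= 4 a c makes the quadratic polynomial nonnegative, so that the
   integrals below may be split without integrability conditions *)
Let Q_ge0 x : 0 <= Q x.
Proof.
have h1 := hbc; have h2 := a_gt0; rewrite /quad_field.
have : 0 <= 4 * a * (a * x.2 ^+ 2 + b * x.2 + c).
  have -> : 4 * a * (a * x.2 ^+ 2 + b * x.2 + c) = (2 * a * x.2 + b) ^+ 2 + (4 * a * c - b ^+ 2) by ring.
  by rewrite addr_ge0 ?sqr_ge0// subr_ge0.
by rewrite pmulr_rge0// mulr_gt0.
Qed.

Let boundedQ : sphere_bounded Q.
Proof.
split.
  rewrite /quad_field; apply: measurable_funD => //; apply: measurable_funD.
    by apply: measurable_funM => //; apply: measurable_funX; exact: measurable_c3.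
  by apply: measurable_funM => //; exact: measurable_c3.
have h1 := a_gt0; have h2 := b_gt0.
exists (a + b + `|c|) => x /coord_bound[_ _]; rewrite /quad_field ler_norml => /andP[u1 u2].
rewrite (le_trans (ler_normD _ _))// lerD2r (le_trans (ler_normD _ _))//.
have v1 : `|x.2| <= 1 by rewrite ler_norml u1.
have v2 : `|x.2 ^+ 2| <= 1 by rewrite normrX expr_le1.
apply: lerD; rewrite normrM gtr0_norm//.
  by rewrite -[leRHS]mulr1 ler_pM2l.
by rewrite -[leRHS]mulr1 ler_pM2l.
Qed.

Lemma cap_measure_exists : exists nu : probability X R,
  forall G : X -> \bar R, measurable_fun setT G -> (forall x, 0 <= G x)%E ->
  (\int[nu]_x G x = \int[leb]_(phi in `]al, pi[) \int[leb]_(theta in `[0%R, (2 * pi)%R])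
     ((f phi * sin phi)%:E * G (sph_point theta phi)))%E.
Proof.
apply: cap_probability => //.
rewrite -(@mass_pcoef R a b c al a_gt0 b_gt0 hab al01 sol).
apply: (@dens_mass R al p f) => //.
- by move=> w; exact: neg_der_pcoef_ge0.
- by move=> phi; exact: densityE.
Qed.

(* the measure of [cap_measure_exists], through its integrals only *)
Variable nu : probability X R.
Hypothesis nuE : forall G : X -> \bar R, measurable_fun setT G -> (forall x, 0 <= G x)%E ->
  (\int[nu]_x G x = \int[leb]_(phi in `]al, pi[) \int[leb]_(theta in `[0%R, (2 * pi)%R])
     ((f phi * sin phi)%:E * G (sph_point theta phi)))%E.

Lemma integral_cap (G : X -> \bar R) : measurable_fun (@sphere R) G ->
  (forall x, sphere x -> 0 <= G x)%E ->
  (\int[nu]_(x in sphere) G x = \int[leb]_(phi in `]al, pi[) \int[leb]_(theta in `[0%R, (2 * pi)%R])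
     ((f phi * sin phi)%:E * G (sph_point theta phi)))%E.
Proof.
move=> mG G0; rewrite integral_mkcond nuE.
- apply: eq_integral => phi _; apply: eq_integral => th _; rewrite patchE ifT//.
  by rewrite inE; exact: sph_sphere.
- by apply/(measurable_restrictT _ _).1 => //; exact: measurable_sphere.
- by move=> x; rewrite patchE; case: ifPn => // /set_mem /G0.
Qed.

Let nu_setT : nu setT = 1%E. Proof. exact: probability_setT. Qed.

Lemma on_sphere_cap : on_sphere nu.
Proof.
rewrite /on_sphere -nu_setT.
have i1 (A : set X) : measurable A -> nu A = (\int[nu]_(x in A) cst 1 x)%E.
  by move=> mA; rewrite integral_cst// mul1e.
rewrite (i1 sphere); last exact: measurable_sphere.
by rewrite integral_cap// (i1 setT)// nuE.
Qed.

(** By rotation symmetry only the height matters; at the poles the circle of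
    latitude degenerates and the formula is not claimed. *)
Lemma potential_cap (x : X) : sphere x -> -1 < x.2 < 1 ->
  potential nu x = (2 * (Apot p x.2 (Num.min x0 x.2) - Apot p x.2 (-1)))%:E.
Proof.
move=> sx x2; have [t [phi [ht hphi xE]]] := sphere_sph_point sx.
rewrite /potential integral_cap; first last.
- by move=> y _; exact: kernel_ge0.
- exact: measurable_kernel.
have e2 : x.2 = cos phi by rewrite xE.
rewrite e2 in x2 *.
have hphi' : 0 < phi < pi.
  move: x2; case/andP: hphi => h1 h2.
  rewrite !lt_neqAle h1 h2 !andbT => /andP[/andP[n1 _] /andP[n2 _]].
  by apply/andP; split; [apply: contraNneq n2 => <-; rewrite cos0|
    apply: contraNneq n1 => ->; rewrite cospi].
have px0 : quad p x0 = 0 by apply: pcoef_root.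
have q0 w : -1 < w < x0 -> 0 <= quad (neg_der p) w by exact: neg_der_pcoef_ge0.
have fE phi' : al < phi' < pi -> (f phi')%:E = ((pi^-1)%:E * \int[leb]_(w in `](-1)%R, x0[)
       (quad (neg_der p) w * rsq (1 - w) * rsq (w - cos phi'))%:E)%E by exact: densityE.
by rewrite -(cap_potentialE al01 px0 q0 mf f0 fE ht hphi') /cap_potential xE.
Qed.

Lemma potential_cap_ge (x : X) : sphere x -> -1 < x.2 < 1 -> (F%:E <= potential nu x + (Q x)%:E)%E.
Proof.
move=> sx x2; rewrite potential_cap// -EFinD lee_fin -lerBlDr.
by apply: potential_ge => //; case/andP: x2 => -> /ltW.
Qed.

Let cosb phi : al < phi < pi -> -1 < cos phi < x0 /\ x0 < 1.
Proof.
have p0 := @pi_gt0 R; case/andP: al01 => a0 a1 /andP[h1 h2].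
have z0 : (0 : R) \in `[0, pi] by rewrite in_itv/= lexx ltW.
have pp : (pi : R) \in `[0, pi] by rewrite in_itv/= lexx ltW.
have q1 : phi \in `[0, pi] by rewrite in_itv/=; lra.
have q2 : al \in `[0, pi] by rewrite in_itv/=; lra.
by rewrite -cospi -(@cos0 R) !ltr_cos// h1 h2 a0.
Qed.

Lemma potential_cap_eq theta phi : al < phi < pi ->
  (potential nu (sph_point theta phi) + (Q (sph_point theta phi))%:E = F%:E)%E.
Proof.
move=> hp; have [/andP[y1 y2] x1] := cosb hp.
rewrite potential_cap/=; [|exact: sph_sphere|by rewrite y1 (lt_trans y2)].
rewrite -EFinD; congr EFin; rewrite potential_eq//; last by rewrite y1 ltW.
by rewrite /quad_field/= subrK.
Qed.

Let F_ge0 : 0 <= F.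
Proof.
have [h1 h2] := andP al01.
have hp : al < (al + pi) / 2 < pi by lra.
rewrite -lee_fin -(potential_cap_eq 0 hp) adde_ge0 ?potential_ge0// lee_fin; exact: Q_ge0.
Qed.

Lemma integralQ (m : probability X R) :
  (\int[m]_(x in sphere) (Q x)%:E = (mom m Q)%:E)%E.
Proof. exact: (momE m boundedQ). Qed.

Let momQ_ge0 (m : probability X R) : 0 <= mom m Q.
Proof.
rewrite /mom /Rintegral fine_ge0//.
by apply: integral_ge0 => x _; rewrite lee_fin; exact: Q_ge0.
Qed.

Let integral_potentialQ (m : probability X R) :
  (\int[m]_(x in sphere) (potential nu x + (Q x)%:E) = mutual m nu + (mom m Q)%:E)%E.
Proof.
rewrite ge0_integralD//.
- by rewrite integralQ.
- exact: measurable_sphere.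
- by move=> x _; exact: potential_ge0.
- exact: measurable_potential.
- by move=> x _; rewrite lee_fin; exact: Q_ge0.
- by apply/measurable_EFinP; apply: measurable_funTS; have [] := boundedQ.
Qed.

(** U + Q = F holds on the open cap, which carries nu. *)
Lemma energy_cap : (mutual nu nu + (mom nu Q)%:E = F%:E)%E.
Proof.
rewrite -integral_potentialQ integral_cap.
- transitivity (\int[nu]_(x in sphere) cst F%:E x)%E.
    rewrite integral_cap; [|exact: measurable_cst|by move=> x _; rewrite /= lee_fin].
    apply: eq_integral => phi; rewrite inE/= in_itv/= => hp.
    by apply: eq_integral => th _; rewrite potential_cap_eq.
  rewrite integral_cst; last exact: measurable_sphere.
  by rewrite -[RHS]mule1; congr (_ * _)%E; exact: on_sphere_cap.
- apply: emeasurable_funD; first exact: measurable_potential.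
  by apply/measurable_EFinP; apply: measurable_funTS; have [] := boundedQ.
- by move=> x _; rewrite adde_ge0 ?potential_ge0// lee_fin; exact: Q_ge0.
Qed.

Variable muQ : probability X R.
Hypothesis hmuQ : extremal Q muQ.

Let finite_cap : (mutual nu nu < +oo)%E.
Proof.
apply: (@le_lt_trans _ _ F%:E); last exact: ltry.
by rewrite -energy_cap leeDl// lee_fin.
Qed.

(* the only use of minimality: comparison with nu *)
Let extremal_le : (mutual muQ muQ + 2%:E * (mom muQ Q)%:E <= mutual nu nu + 2%:E * (mom nu Q)%:E)%E.
Proof.
have [_ e] := hmuQ; rewrite -!integralQ.
have -> : (mutual muQ muQ + 2%:E * \int[muQ]_(x in sphere) (Q x)%:E = weighted_energy Q muQ)%E by [].
rewrite e; apply: ereal_inf_lbound; exists nu => //; exact: on_sphere_cap.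
Qed.

Let finite_extremal : (mutual muQ muQ < +oo)%E.
Proof.
apply: (@le_lt_trans _ _ (mutual muQ muQ + 2%:E * (mom muQ Q)%:E)%E).
  by rewrite leeDl// -EFinM lee_fin mulr_ge0.
apply: le_lt_trans extremal_le _; rewrite -EFinM.
by rewrite lte_add_pinfty// ltry.
Qed.

Let null_poles : {ae muQ, forall x, sphere x -> -1 < x.2 < 1}.
Proof.
have n1 (x : X) : sphere x -> muQ.-negligible [set x].
  move=> sx; exists [set x]; split => //; first exact: measurable_point.
  exact: (finite_energy_point sx finite_extremal).
have := negligibleU (n1 (0, 0, 1) ltac:(by apply/sphereP; rewrite /dot/=; ring))
  (n1 (0, 0, -1) ltac:(by apply/sphereP; rewrite /dot/=; ring)).
apply: negligibleS => -[[x1 x2] x3]/= /not_implyP[sx n].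
have [_ _] := coord_bound sx; rewrite /= ler_norml => /andP[b1 b2].
have /= e : x1 * x1 + x2 * x2 + x3 * x3 = 1 by move/sphereP: sx.
have [x31|x31] := eqVneq x3 1.
  have e1 : x1 = 0 by nra.
  have e2 : x2 = 0 by nra.
  by left; rewrite x31 e1 e2.
have [x32|x32] := eqVneq x3 (-1).
  have e1 : x1 = 0 by nra.
  have e2 : x2 = 0 by nra.
  by right; rewrite x32 e1 e2.
by case: n; rewrite !lt_neqAle b1 b2 x31 eq_sym x32.
Qed.

(* U + Q >= F integrated against muQ, which does not charge the poles *)
Let mutual_ge : (F%:E <= mutual muQ nu + (mom muQ Q)%:E)%E.
Proof.
have [oS _] := hmuQ.
have -> : F%:E = (\int[muQ]_(x in sphere) cst F%:E x)%E.
  rewrite integral_cst; last exact: measurable_sphere.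
  by rewrite -[LHS]mule1; congr (_ * _)%E; exact/esym.
rewrite -integral_potentialQ; apply: ae_ge0_le_integral => //.
- exact: measurable_sphere.
- by move=> x _; rewrite adde_ge0 ?potential_ge0// lee_fin; exact: Q_ge0.
- apply: emeasurable_funD; first exact: measurable_potential.
  by apply/measurable_EFinP; apply: measurable_funTS; have [] := boundedQ.
- by apply: filterS null_poles => x h sx /=; apply: potential_cap_ge => //; exact: h.
Qed.

(** From I(muQ) + 2 q1 <= I(nu) + 2 q2, I(nu) + q2 = F and
    I(muQ, nu) + q1 >= F, with q1, q2 the integrals of Q, it follows that
    I(muQ) + I(nu) <= 2 (F - q1) <= 2 I(muQ, nu). *)
Lemma extremal_unique (A : set X) : measurable A -> muQ A = nu A.
Proof.
have [oS _] := hmuQ; apply: (measure_moments oS on_sphere_cap) => n h hw.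
apply: (mom_eq hw finite_extremal finite_cap).
move: extremal_le mutual_ge energy_cap finite_extremal finite_cap.
move: (mutual_ge0 muQ muQ) (mutual_ge0 nu nu) (mutual_ge0 muQ nu).
case: (mutual muQ muQ) => [e1| |]//; case: (mutual nu nu) => [e2| |]//.
case: (mutual muQ nu) => [e12| |]// _ _ _; last first.
  by move=> *; rewrite gt0_muley ?leey// lte_fin.
rewrite -!EFinM -!EFinD !lee_fin => h1 h2 [h3] _ _; lra.
Qed.

(* f is only measurable on ]al, pi[; k is jointly measurable everywhere *)
Let ff := f \_ `]al, pi[.
Let k (A : set X) phi theta : R := \1_A (sph_point theta phi) * ff phi * sin phi.

Let ffE phi : al < phi < pi -> ff phi = f phi.
Proof. by move=> hp; rewrite /ff patchE ifT// inE/= in_itv/=. Qed.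

Let mk (A : set X) : measurable A -> measurable_fun setT (fun z : R * R => k A z.1 z.2).
Proof.
move=> mA.
have mff : measurable_fun setT ff.
  by apply/(measurable_restrictT _ _).1 => //; exact: measurable_itv.
rewrite /k; apply: measurable_funM; first apply: measurable_funM.
- by apply: (measurableT_comp (measurable_indic mA)); exact: measurable_sphp.
- by apply: (measurableT_comp mff); exact: measurable_fst.
- apply: (measurableT_comp (f := @sin R)); last exact: measurable_fst.
  by apply: continuous_measurable_fun; exact: continuous_sin.
Qed.

Let k0 (A : set X) (phi theta : R) :
  `]al, pi[%classic phi -> `[0, 2 * pi]%classic theta -> 0 <= k A phi theta.
Proof.
rewrite /= !in_itv/= => hp _; rewrite /k ffE//.
have s0 : 0 <= sin phi by apply: sin_ge0_pi; have h := al0; lra.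
by rewrite mulr_ge0// mulr_ge0 ?f0.
Qed.

Let mD : measurable (`]al, pi[ : set R). Proof. exact: measurable_itv. Qed.
Let mE : measurable (`[0, 2 * pi] : set R). Proof. exact: measurable_itv. Qed.

Let extremalE (A : set X) : measurable A ->
  (muQ A = \int[leb]_(phi in `]al, pi[) \int[leb]_(theta in `[0%R, (2 * pi)%R]) (k A phi theta)%:E)%E.
Proof.
move=> mA; rewrite extremal_unique// -[nu A]mul1e -integral_cst// integral_mkcond nuE.
- apply: eq_integral => phi; rewrite inE/= in_itv/= => hp; apply: eq_integral => th _.
  rewrite patchE /k ffE// indicE; case: (_ \in A); rewrite ?mule1 ?mule0 ?mul0r ?mul1r//.
- by apply/(measurable_restrictT _ _).1.
- by move=> x; rewrite patchE; case: ifP.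
Qed.

Lemma cap_density : has_cap_density muQ al f.
Proof.
move=> A mA; rewrite (extremalE mA).
transitivity (\int[leb]_(phi in `]al, pi[) \int[leb]_(theta in `[0%R, (2 * pi)%R])
    (\1_A (sph_point theta phi) * f phi * sin phi)%:E)%E.
  apply: eq_integral => phi; rewrite inE/= in_itv/= => hp.
  by apply: eq_integral => th _; rewrite /k ffE.
apply/esym/integral_itv_bndoo.
apply: eq_measurable_fun (measurable_integral2 mD mE (mk mA) (@k0 A)) => phi.
rewrite inE/= in_itv/= => hp.
by apply: eq_integral => th _; rewrite /k ffE.
Qed.

(* an open set meeting the cap contains the image of a rectangle of the
   coordinate plane, on which f sin is positive *)
Let pos_open (U : set X) (theta phi : R) : open U -> 0 <= theta <= 2 * pi -> al <= phi <= pi ->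
  U (sph_point theta phi) -> (0 < muQ U)%E.
Proof.
move=> oU /andP[t1 t2] /andP[h1 h2] Ux; have p0 := @pi_gt0 R; have /andP[a0 a1] := al01.
have mU := open_measurable_R3 oU.
have [e /= e0 he] : exists2 e : R, 0 < e & ball (phi, theta) e `<=` (@sphp R) @^-1` U.
  by apply/nbhs_ballP; apply: continuous_sphp; exact: open_nbhs_nbhs.
pose i1 := Num.max al (phi - e); pose i2 := Num.min pi (phi + e).
pose j1 := Num.max 0 (theta - e); pose j2 := Num.min (2 * pi) (theta + e).
have hi : i1 < i2 by rewrite lt_min !gt_max; lra.
have hj : j1 < j2 by rewrite lt_min !gt_max; lra.
have subI : `]i1, i2[%classic `<=` `]al, pi[%classic.
  by move=> x /=; rewrite !in_itv/= gt_max lt_min => /andP[/andP[-> _] /andP[-> _]].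
have subJ : `]j1, j2[%classic `<=` `[0, 2 * pi]%classic.
  move=> x /=; rewrite !in_itv/= gt_max lt_min => /andP[/andP[u _] /andP[v _]].
  by rewrite (ltW u) (ltW v).
have inU x y : `]i1, i2[%classic x -> `]j1, j2[%classic y -> U (sph_point y x).
  rewrite /= !in_itv/= !gt_max !lt_min => /andP[/andP[_ u1] /andP[_ u2]] /andP[/andP[_ v1] /andP[_ v2]].
  by apply: (he (x, y)); split; rewrite /ball/= ltr_norml; apply/andP; split; lra.
have mI : measurable (`]i1, i2[ : set R) by exact: measurable_itv.
have mJ : measurable (`]j1, j2[ : set R) by exact: measurable_itv.
have mfs : measurable_fun `]i1, i2[ (fun x => f x * sin x * (j2 - j1)).
  apply: measurable_funM => //; apply: measurable_funM; first exact: measurable_funS mf.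
  by apply: measurable_funTS; apply: continuous_measurable_fun; exact: continuous_sin.
rewrite extremalE//.
apply: (@lt_le_trans _ _ (\int[leb]_(x in `]i1, i2[) (f x * sin x * (j2 - j1))%:E)%E).
  apply: integral_gt0 => //.
  - move=> x /subI; rewrite /= in_itv/= => hx.
    apply: mulr_gt0; last by rewrite subr_gt0.
    apply: mulr_gt0; first exact: density_gt0.
    by apply: sin_gt0_pi; lra.
  - by rewrite lebesgue_measure_itv/= lte_fin hi -EFinD lte_fin subr_gt0.
apply: (@le_trans _ _ (\int[leb]_(x in `]i1, i2[)
    \int[leb]_(theta in `[0%R, (2 * pi)%R]) (k U x theta)%:E)%E).
  apply: ge0_le_integral => //.
  - move=> x /subI; rewrite /= in_itv/= => hx; rewrite lee_fin; apply: mulr_ge0; last by rewrite subr_ge0 ltW.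
    by rewrite mulr_ge0 ?f0//; apply: sin_ge0_pi; lra.
  - apply/measurable_EFinP; exact: mfs.
  - exact: (measurable_funS mD subI (measurable_integral2 mD mE (mk mU) (@k0 U))).
  - move=> x Ix; have Dx := subI _ Ix.
    have hx : al < x < pi by move: Dx; rewrite /= in_itv.
    apply: (@le_trans _ _ (\int[leb]_(theta in `]j1, j2[) (k U x theta)%:E)%E).
      have -> : (f x * sin x * (j2 - j1))%:E = (\int[leb]_(theta in `]j1, j2[) cst (f x * sin x)%:E theta)%E.
        rewrite integral_cst//= lebesgue_measure_itv/= lte_fin hj.
        by rewrite -EFinD -EFinM.
      rewrite le_eqVlt; apply/orP; left; apply/eqP; apply: eq_integral => y; rewrite inE => Jy.
      by rewrite /k indicE mem_set ?mul1r ?ffE//; exact: inU.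
    apply: ge0_subset_integral => //.
    - apply/measurable_EFinP; apply: measurable_funTS.
      exact: (measurableT_comp (f := fun z : R * R => k U z.1 z.2) (g := pair x) (mk mU) (pair1_measurable x)).
    - by move=> y Jy; rewrite lee_fin; exact: k0.
apply: ge0_subset_integral => //.
- exact: (measurable_integral2 mD mE (mk mU) (@k0 U)).
- by move=> x Dx; apply: integral_ge0 => y Jy; rewrite lee_fin; exact: k0.
Qed.

Let open_sphereC : open (~` @sphere R).
Proof.
have -> : ~` @sphere R = @enorm R @^-1` [set r | r != 1].
  by apply/seteqP; split=> x /=; [move/eqP|move/eqP].
apply: open_comp; last exact: open_neq.
by move=> x _; exact: continuous_enorm.
Qed.

Lemma support_cap : msupport muQ = cap al.
Proof.
have [oS _] := hmuQ; have p0 := @pi_gt0 R; have /andP[a0 a1] := al01.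
apply/seteqP; split=> x.
  move=> sx; apply: contrapT => ncap.
  suff [V [oV Vx V0]] : exists V : set X, [/\ open V, V x & muQ V = 0%E].
    by have := sx V oV Vx; rewrite V0 ltxx.
  have [xs|xs] := pselect (sphere x); last first.
    exists (~` sphere); split; [exact: open_sphereC|by []|].
    rewrite probability_setC; last exact: measurable_sphere.
    have -> : (1 - muQ sphere = 1 - 1)%E by congr (_ - _)%E; exact: oS.
    by rewrite subee.
  have [t [phi [ht hphi xE]]] := sphere_sph_point xs.
  have h : phi < al.
    rewrite ltNge; apply/negP => le; apply: ncap; exists t, phi; split=> //.
    by case/andP: hphi => _ ->; rewrite le.
  have oV : open [set y : X | x0 < y.2].
    have -> : [set y : X | x0 < y.2] = (fun y : X => y.2) @^-1` [set r | x0 < r] by [].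
    by apply: open_comp; [move=> y _; exact: cvg_snd|exact: open_gt].
  exists [set y | x0 < y.2]; split => //.
  - by rewrite xE/= ltr_cos// in_itv/=; lra.
  - rewrite extremalE; last exact: open_measurable_R3.
    apply: integral0_eq => ph; rewrite /= in_itv/= => hp; apply: integral0_eq => th _.
    have [/andP[_ c2] _] := cosb hp.
    by rewrite /k indicE memNset ?mul0r//= ltNge (ltW c2).
move=> [theta [phi [ht hphi ->]]] U oU Ux; exact: pos_open Ux.
Qed.

End Extremal.

Theorem theorem2p10 (R : realType) (a b c : R)
    (a_gt0 : 0 < a) (b_gt0 : 0 < b)
    (hab : 4 * a ^+ 2 < b ^+ 2) (hbc : b ^+ 2 <= 4 * a * c)
    (alpha0 : R) (halpha0 : 0 < alpha0 < pi)
    (alpha0_sol : transcendental_eq a b alpha0)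
    (alpha0_uniq : forall beta : R, 0 < beta < pi ->
      transcendental_eq a b beta -> beta = alpha0)
    (muQ : probability (R * R * R)%type R)
    (hmuQ : extremal (quad_field a b c) muQ) :
  msupport muQ = cap alpha0 /\
  has_cap_density muQ alpha0 (density a b c alpha0).
Proof.
have [nu nuE] := cap_measure_exists c a_gt0 b_gt0 hab halpha0 alpha0_sol.
split.
  exact: (support_cap a_gt0 b_gt0 hab hbc halpha0 alpha0_sol nuE hmuQ).
exact: (cap_density a_gt0 b_gt0 hab hbc halpha0 alpha0_sol nuE hmuQ).
Qed.
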